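(* Let $X,Y,Z$ be random vectors in $\mathbb{R}^p,\mathbb{R}^q,\mathbb{R}^d$ with joint distribution $P_{XYZ}$. Let $k_{\mathscr{X}}(x,x')=\|x-x_0\|+\|x'-x_0\|-\|x-x'\|$ on $\mathbb{R}^p$ and $k_{\mathscr{Y}}(y,y')=\|y-y_0\|+\|y'-y_0\|-\|y-y'\|$ on $\mathbb{R}^q$, for some $x_0\in\mathbb{R}^p$, $y_0\in\mathbb{R}^q$ (the kernels induced by the Euclidean distances $\rho_{\mathscr{X}}(x,x')=\|x-x'\|$, $\rho_{\mathscr{Y}}(y,y')=\|y-y'\|$). Let $k_{\mathscr{Z}}(z,z')=\eta(z)\eta(z')$, $z,z'\in\mathbb{R}^d$, for some real-valued function $\eta$ on $\mathbb{R}^d$. Suppose $P_X\in\mathcal{M}^2_{k_{\mathscr{X}}}(\mathbb{R}^p)$, $P_Y\in\mathcal{M}^2_{k_{\mathscr{Y}}}(\mathbb{R}^q)$, $P_Z\in\mathcal{M}^1_{k_{\mathscr{Z}}}(\mathbb{R}^d)$, and $$\int|\eta(z)|\,\big\|\phi_{XY|Z=z}-\phi_{X|Z=z}\phi_{Y|Z=z}\big\|_{L^2(w)}\,dP_Z(z)<\infty,$$ where $w(u,s)=\frac{1}{c_pc_q}\|u\|^{-p-1}\|s\|^{-q-1}$, $u\in\mathbb{R}^p$, $s\in\mathbb{R}^q$. Then, with $\ddot{X}=(X,Z)$, $$\|\Sigma_{Y\ddot{X}|Z}\|_{HS}^2=\left\|\int\eta(z)\big(\phi_{XY|Z=z}-\phi_{X|Z=z}\phi_{Y|Z=z}\big)\,dP_Z(z)\right\|_{L^2(w)}^2.$$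 In particular, for $t>0$ and some $a\in\mathbb{R}^d$, if $\eta(z)=\frac{1}{t^d}\theta\!\left(\frac{a-z}{t}\right)$, $z\in\mathbb{R}^d$, where $\theta$ is a bounded continuous function with $\int\theta(z)\,dz=1$, and $P_Z$ has a bounded uniformly continuous density $p_Z$ on $\mathbb{R}^d$ such that $$\int\int\sup_z\big|\phi_{XY|Z=z}(u,s)-\phi_{X|Z=z}(u)\phi_{Y|Z=z}(s)\big|^2\,w(u,s)\,du\,ds<\infty,$$ then $$\lim_{t\to0}\|\Sigma_{Y\ddot{X}|Z}\|_{HS}^2=p_Z^2(a)\,\mathcal{V}^2(X,Y|Z=a).$$
   Context: $\|\cdot\|$ is the Euclidean norm on vectors; $\|\cdot\|_{HS}$ is the Hilbert-Schmidt norm. $c_m=\pi^{(m+1)/2}/\Gamma((m+1)/2)$. $L^2(w)$ is the $L^2$ space on $\mathbb{R}^p\times\mathbb{R}^q$ of complex-valued functions with respect to $w(u,s)\,du\,ds$. Conditional characteristic functions: $\phi_{XY|Z=z}(u,s)=\mathbb{E}[e^{i\langle u,X\rangle+i\langle s,Y\rangle}|Z=z]$, $\phi_{X|Z=z}(u)=\phi_{XY|Z=z}(u,0)$, $\phi_{Y|Z=z}(s)=\phi_{XY|Z=z}(0,s)$; $\phi_{X|Z=z}\phi_{Y|Z=z}$ denotes $(u,s)\mapsto\phi_{X|Z=z}(u)\phi_{Y|Z=z}(s)$. Conditional distance covariance: $\mathcal{V}^2(X,Y|Z=z)=\|\phi_{XY|Z=z}-\phi_{X|Z=z}\phi_{Y|Z=z}\|_{L^2(w)}^2$.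 $\mathcal{M}^{r}_{k}$ is the set of finite signed Borel measures $v$ with $\int k^{r}(x,x)\,d|v|(x)<\infty$. $\mathscr{H}_k$ is the RKHS with reproducing kernel $k$. The random element $\ddot{X}=(X,Z)$ is equipped with the product kernel $k_{\ddot{X}}((x,z),(x',z'))=k_{\mathscr{X}}(x,x')k_{\mathscr{Z}}(z,z')$ with RKHS $\mathscr{H}_{\ddot{X}}=\mathscr{H}_{k_{\mathscr{X}}}\otimes\mathscr{H}_{k_{\mathscr{Z}}}$. The operator $\Sigma_{Y\ddot{X}|Z}:\mathscr{H}_{\ddot{X}}\to\mathscr{H}_{k_{\mathscr{Y}}}$ is the unique bounded linear operator with $$\langle g,\Sigma_{Y\ddot{X}|Z}f\rangle_{\mathscr{H}_{k_{\mathscr{Y}}}}=\mathbb{E}[f(\ddot{X})g(Y)]-\mathbb{E}_Z\big[\mathbb{E}[f(\ddot{X})|Z]\,\mathbb{E}[g(Y)|Z]\big]$$ for all $f\in\mathscr{H}_{\ddot{X}}$, $g\in\mathscr{H}_{k_{\mathscr{Y}}}$.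
   Formalization: The limit also assumes that, for a.e. (u,s), a is a Lebesgue point (w.r.t. P_Z) of z ↦ φ_{XY|Z=z}(u,s) − φ_{X|Z=z}(u)φ_{Y|Z=z}(s); otherwise the law at Z=a is arbitrary and the claim fails. This holds for a.e. a and wherever this map is continuous. *)

(* Defs.v *)
From HB Require Import structures.
From mathcomp Require Import all_boot all_order all_algebra.
From mathcomp Require Import complex.
From mathcomp Require Import all_classical all_reals all_analysis measurable_realfun.

Set Implicit Arguments.
Unset Strict Implicit.
Unset Printing Implicit Defensive.

Import Order.TTheory GRing.Theory Num.Theory.
Import numFieldNormedType.Exports.

Local Open Scope classical_set_scope.
Local Open Scope ring_scope.

Definition borel_display : measure_display. Proof. exact: default_measure_display. Qed.

(* R^n carries its Borel sigma-algebra.  The library topology on ['rV[R]_n] is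
   that of the sup norm, which is also the Euclidean one. *)
Section borel_rV.
Variables (R : realType) (n : nat).

Let borel := <<s [set U : set 'rV[R]_n | open U] >>.

Let borel0 : borel set0. Proof. exact: sigma_algebra0. Qed.

Let borelC A : borel A -> borel (~` A). Proof. exact: sigma_algebraC. Qed.

Let borel_bigcup (F : (set 'rV[R]_n)^nat) :
  (forall i, borel (F i)) -> borel (\bigcup_i (F i)).
Proof. exact: sigma_algebra_bigcup. Qed.

HB.instance Definition _ := @isMeasurable.Build borel_display
  'rV[R]_n borel borel0 borelC borel_bigcup.

End borel_rV.

Section measurable_rV.
Context d (T : measurableType d) (R : realType) (n : nat).

Lemma open_measurable_rV (U : set 'rV[R]_n) : open U -> measurable U.
Proof. by move=> oU; exact: sub_sigma_algebra. Qed.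

Lemma measurable_fun_coord (i : 'I_n) :
  measurable_fun [set: 'rV[R]_n] (fun v : 'rV[R]_n => v ord0 i).
Proof.
apply: (measurability _ (RGenOpens.measurableE R)) => _ [_ [a [b ->]] <-].
rewrite setTI; apply: open_measurable_rV.
by apply: open_comp => [v _|]; [exact: coord_continuous|exact: interval_open].
Qed.

Lemma measurable_fun_rV (f : T -> 'rV[R]_n) :
  (forall i, measurable_fun [set: T] (fun x => f x ord0 i)) ->
  measurable_fun [set: T] f.
Proof.
move=> mf.
apply: (@measurability _ _ _ _ _ _ [set U : set 'rV[R]_n | open U]) => //.
move=> _ [U oU <-]; rewrite setTI.
pose box (q : 'rV[rat]_n * nat) : set 'rV[R]_n :=
  [set v | forall i, `|v ord0 i - ratr (q.1 ord0 i)| < q.2.+1%:R^-1].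
have boxm q : measurable (f @^-1` box q).
  have -> : f @^-1` box q = \bigcap_(i in [set: 'I_n])
     (fun x => `|f x ord0 i - ratr (q.1 ord0 i)|) @^-1` `]-oo, q.2.+1%:R^-1[.
    apply/seteqP; split=> x /= h i; first by move=> _; rewrite /= in_itv/=; exact: h.
    by have := h i Logic.I; rewrite /= in_itv.
  apply: fin_bigcap_measurable => // i _; rewrite -[X in measurable X]setTI.
  have m : measurable_fun [set: T] (fun x => `|f x ord0 i - ratr (q.1 ord0 i)|).
    by apply: measurableT_comp => //; apply: measurable_funB => //; exact: mf.
  exact: m.
pose F q := if pselect (box q `<=` U) then f @^-1` box q else set0.
have -> : f @^-1` U = \bigcup_q F q.
  apply/seteqP; split=> [x /= Ufx|x [q _]]; last first.
    by rewrite /F; case: pselect => // qU; exact: qU.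
  have : nbhs (f x) U by exact: open_nbhs_nbhs.
  move=> /nbhs_ballP[e /= e0 xeU].
  have [k ke] : exists k : nat, k.+1%:R^-1 + k.+1%:R^-1 < e :> R.
    have e20 : 0 < e / 2 by rewrite divr_gt0.
    have [k _ /(_ k (leqnn k))/= ke] := near_infty_natSinv_lt (PosNum e20).
    by exists k; rewrite [ltRHS]splitr ltrD.
  have /choice[q qP] : forall i, exists r : rat,
      `|f x ord0 i - ratr r| < k.+1%:R^-1 :> R.
    move=> i; have : f x ord0 i - k.+1%:R^-1 < f x ord0 i + k.+1%:R^-1.
      by rewrite ltrD2l gtrN ?invr_gt0.
    move=> /rat_in_itvoo[r]; rewrite in_itv/= => /andP[r1 r2]; exists r.
    by rewrite distrC ltr_distl r1.
  exists (\row_i q i, k) => //; rewrite /F; case: pselect => [_ i|]/=.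
    by rewrite mxE.
  case=> v vq; apply: xeU; split => // i j; rewrite ord1 {i}.
  have := vq j; rewrite mxE /= => vj; apply: le_lt_trans ke.
  rewrite -[_ - _](subrKA (ratr (q j))) (le_trans (ler_normD _ _))// lerD//.
  - by rewrite ltW.
  - by rewrite distrC ltW.
apply: countable_bigcupT_measurable => // q; rewrite /F.
by case: pselect => [?|?]; [exact: boxm|exact: measurable0].
Qed.

End measurable_rV.

Section lebesgue_rV.
Variable R : realType.

Definition cons_rV n (xv : measurableTypeR R * 'rV[R]_n) : 'rV[R]_n.+1 :=
  \row_i oapp (fun j => xv.2 ord0 j) xv.1 (unlift ord0 i).

Lemma measurable_cons_rV n : measurable_fun setT (@cons_rV n).
Proof.
apply: measurable_fun_rV => i; rewrite /cons_rV.
under eq_fun do rewrite mxE.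
case: unliftP => [j _|_] /=; last exact: measurable_fst.
exact: (measurableT_comp (measurable_fun_coord j) measurable_snd).
Qed.

Definition uncons_rV n (v : 'rV[R]_n.+1) : measurableTypeR R * 'rV[R]_n :=
  (v ord0 ord0, \row_j v ord0 (lift ord0 j)).

Lemma cons_rVK n : cancel (@cons_rV n) (@uncons_rV n).
Proof.
move=> [x v]; rewrite /uncons_rV /cons_rV mxE unlift_none; congr pair.
by apply/rowP => j; rewrite !mxE liftK.
Qed.

Lemma measurable_uncons_rV n : measurable_fun setT (@uncons_rV n).
Proof.
apply/measurable_fun_pairP; split; first exact: measurable_fun_coord.
apply: measurable_fun_rV => j; rewrite /uncons_rV /=.
under eq_fun do rewrite mxE.
exact: measurable_fun_coord.
Qed.

Section step.
Variables (n : nat) (mu : {sigma_finite_measure set 'rV[R]_n -> \bar R}).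

Definition lebesgue_step : set 'rV[R]_n.+1 -> \bar R :=
  pushforward (@lebesgue_measure R \x mu)%E (@cons_rV n).

Let preimage_cons_measurable A :
  measurable A -> measurable (@cons_rV n @^-1` A).
Proof.
by move=> mA; rewrite -[X in measurable X]setTI; exact: measurable_cons_rV.
Qed.

Let step0 : lebesgue_step set0 = 0%E.
Proof. by rewrite /lebesgue_step /pushforward preimage_set0 measure0. Qed.

Let step_ge0 A : (0 <= lebesgue_step A)%E.
Proof. exact: (measure_ge0 (@lebesgue_measure R \x mu)%E). Qed.

Let step_sigma_additive : semi_sigma_additive lebesgue_step.
Proof.
move=> F mF tF mUF; rewrite /lebesgue_step /pushforward preimage_bigcup.
apply: measure_semi_sigma_additive.
- by move=> k; exact: preimage_cons_measurable.
- apply/trivIsetP => /= i j _ _ ij; rewrite -preimage_setI.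
  by move/trivIsetP : tF => /(_ _ _ _ _ ij) ->//; rewrite preimage_set0.
- by rewrite -preimage_bigcup; exact: preimage_cons_measurable.
Qed.

HB.instance Definition _ :=
  isMeasure.Build _ _ _ lebesgue_step step0 step_ge0 step_sigma_additive.

Lemma lebesgue_step_sigma_finite : sigma_finite setT lebesgue_step.
Proof.
have /sigma_finiteP[F [TF ndF Foo]] := sigma_finiteT (@lebesgue_measure R).
have /sigma_finiteP[G [TG ndG Goo]] := sigma_finiteT mu.
exists (fun k => @uncons_rV n @^-1` (F k `*` G k)).
  rewrite -preimage_bigcup (_ : \bigcup_k _ = setT) ?preimage_setT//.
  apply/seteqP; split => // -[x v] _.
  have [i _ Fix] : (\bigcup_k F k) x by rewrite -TF.
  have [j _ Gjv] : (\bigcup_k G k) v by rewrite -TG.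
  exists (maxn i j) => //; split => /=.
    by move: x Fix; exact/subsetPset/ndF/leq_maxl.
  by move: v Gjv; exact/subsetPset/ndG/leq_maxr.
move=> k; have [mF Fk] := Foo k; have [mG Gk] := Goo k; split.
  by rewrite -[X in measurable X]setTI; apply: measurable_uncons_rV => //;
    exact: measurableX.
rewrite /lebesgue_step /pushforward -comp_preimage.
rewrite (_ : _ \o _ = id); last by apply/funext => x /=; rewrite cons_rVK.
by rewrite preimage_id product_measure1E// lte_mul_pinfty// ge0_fin_numE.
Qed.

HB.instance Definition _ :=
  Measure_isSigmaFinite.Build _ _ _ lebesgue_step lebesgue_step_sigma_finite.

End step.

(* n-dimensional Lebesgue measure, as the image of the product of the
   one-dimensional and the (n-1)-dimensional ones under [cons_rV]. *)
Fixpoint lebesgue_rV n : {sigma_finite_measure set 'rV[R]_n -> \bar R} :=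
  if n is n'.+1 then lebesgue_step (lebesgue_rV n')
  else \d_(0 : 'rV[R]_0).

End lebesgue_rV.

Section euclidean.
Context {R : realType} {n : nat}.
Implicit Types u v : 'rV[R]_n.

Definition dotp u v : R := \sum_(i < n) u ord0 i * v ord0 i.

(* The library norm [`|u|] on ['rV[R]_n] is the sup norm. *)
Definition enorm u : R := Num.sqrt (dotp u u).

End euclidean.

Section kernels.
Context {R : realType}.

Definition dist_kernel n (x0 x x' : 'rV[R]_n) : R :=
  enorm (x - x0) + enorm (x' - x0) - enorm (x - x').

Definition rank1_kernel T (eta : T -> R) (z z' : T) : R := eta z * eta z'.

Definition prod_kernel S T (k : S -> S -> R) (l : T -> T -> R)
  (a b : S * T) : R := k a.1 b.1 * l a.2 b.2.

(* Membership in the class M^r_k.  It is stated for nonnegative measures only,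
   for which the total variation |mu| is mu itself. *)
Definition moment_class d (T : measurableType d) (mu : {measure set T -> \bar R})
    (r : R) (k : T -> T -> R) : Prop :=
  (\int[mu]_x (k x x `^ r)%:E < +oo)%E.

End kernels.

Section hilbert.
Variable R : realType.

(* A real Hilbert space: a complete normed space whose norm is induced by [hdot]. *)
Record hilbert := Hilbert {
  hilbert_space :> completeNormedModType R ;
  hdot : hilbert_space -> hilbert_space -> R ;
  hdotC : forall f g, hdot f g = hdot g f ;
  hdot_linear : forall (a : R) f g h,
    hdot (a *: f + g) h = a * hdot f h + hdot g h ;
  hdot_norm : forall f, hdot f f = `|f| ^+ 2 }.

Definition orthonormal_basis (H : hilbert) (B : set H) : Prop :=
  [/\ forall e, B e -> hdot e e = 1,
      forall e e', B e -> B e' -> e <> e' -> hdot e e' = 0 &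
      forall f, (forall e, B e -> hdot f e = 0) -> f = 0].

(* Square root of the sum of the [`|A e| ^+ 2] over an orthonormal basis of H.
   The value does not depend on the basis; [get] selects one of them. *)
Definition hs_norm (H K : hilbert) (A : H -> K) : \bar R :=
  ((\esum_(e in get (@orthonormal_basis H)) (`|A e| ^+ 2)%:E) `^ 2^-1)%E.

Definition bounded_op (H K : hilbert) (A : H -> K) : Prop :=
  exists M : R, forall f, `|A f| <= M * `|f|.

(* A Hilbert space of functions on [T], given by its elements [f] together with
   the functions [rkhs_eval f] that they are, in which [k] reproduces. *)
Record rkhs (T : Type) (k : T -> T -> R) := RKHS {
  rkhs_hilbert :> hilbert ;
  rkhs_eval : rkhs_hilbert -> T -> R ;
  rkhs_eval_inj : injective rkhs_eval ;
  rkhs_section : T -> rkhs_hilbert ;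
  rkhs_sectionE : forall x y, rkhs_eval (rkhs_section x) y = k y x ;
  rkhs_reproducing : forall f x, rkhs_eval f x = hdot f (rkhs_section x) }.

End hilbert.

Section weighted_L2.
Variable R : realType.

Definition Gamma (a : R) : R :=
  \int[@lebesgue_measure R]_(x in `]0, +oo[) (x `^ (a - 1) * expR (- x)).

Definition c_ (m : nat) : R :=
  pi `^ (m.+1%:R / 2) / Gamma (m.+1%:R / 2).

Definition weight p q (us : 'rV[R]_p * 'rV[R]_q) : R :=
  (c_ p * c_ q)^-1 * enorm us.1 ^- p.+1 * enorm us.2 ^- q.+1.

Definition normC (z : R[i]) : R := ComplexField.Normc.normc z.

Definition L2w_norm p q (f : 'rV[R]_p * 'rV[R]_q -> R[i]) : \bar R :=
  ((\int[lebesgue_rV R p \x lebesgue_rV R q]_us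
      (normC (f us) ^+ 2 * weight us)%:E) `^ 2^-1)%E.

Definition cintegral d (T : measurableType d) (mu : {measure set T -> \bar R})
    (f : T -> R[i]) : R[i] :=
  ((\int[mu]_x complex.Re (f x)) +i* (\int[mu]_x complex.Im (f x)))%C.

End weighted_L2.

Section conditioning.
Context {R : realType} {p q d : nat}.
Context {dO : measure_display} {Omega : measurableType dO}.
Context {P : probability Omega R}.

(* [kappa z] is the conditional distribution of (X, Y) given Z = z. *)
Definition cond_distribution
    (X : {RV P >-> 'rV[R]_p}) (Y : {RV P >-> 'rV[R]_q})
    (Z : {RV P >-> 'rV[R]_d})
    (kappa : R.-pker 'rV[R]_d ~> ('rV[R]_p * 'rV[R]_q)%type) : Prop :=
  forall (A : set ('rV[R]_p * 'rV[R]_q)) (B : set 'rV[R]_d),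
    measurable A -> measurable B ->
    P ((fun w => (X w, Y w)) @^-1` A `&` Z @^-1` B) =
    (\int[distribution P Z]_(z in B) kappa z A)%E.

Variable kappa : R.-pker 'rV[R]_d ~> ('rV[R]_p * 'rV[R]_q)%type.

(* E[h(X, Y) | Z = z].  All conditional quantities are taken with respect to the
   same conditional distribution [kappa]. *)
Definition cond_expectation (h : 'rV[R]_p * 'rV[R]_q -> R) (z : 'rV[R]_d) : R :=
  \int[kappa z]_xy h xy.

Definition cf_XY (z : 'rV[R]_d) (us : 'rV[R]_p * 'rV[R]_q) : R[i] :=
  cintegral (kappa z) (fun xy =>
    let a := dotp us.1 xy.1 + dotp us.2 xy.2 in (cos a +i* sin a)%C).

Definition cf_X (z : 'rV[R]_d) (u : 'rV[R]_p) : R[i] := cf_XY z (u, 0).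

Definition cf_Y (z : 'rV[R]_d) (s : 'rV[R]_q) : R[i] := cf_XY z (0, s).

Definition cf_diff (z : 'rV[R]_d) (us : 'rV[R]_p * 'rV[R]_q) : R[i] :=
  cf_XY z us - cf_X z us.1 * cf_Y z us.2.

Definition cond_dcov2 (z : 'rV[R]_d) : \bar R := (L2w_norm (cf_diff z) ^+ 2)%E.

(* [Sigma] is the bounded operator Sigma_{Y (X,Z) | Z}; the defining identity
   determines it.  The RKHS of the product kernel [prod_kernel kX kZ] is the
   tensor product of the RKHSs of kX and kZ.  The identity is between extended
   reals, so both expectations are required to be finite. *)
Definition cond_cross_cov_op
    (X : {RV P >-> 'rV[R]_p}) (Y : {RV P >-> 'rV[R]_q})
    (Z : {RV P >-> 'rV[R]_d})
    (kX : 'rV[R]_p -> 'rV[R]_p -> R) (kY : 'rV[R]_q -> 'rV[R]_q -> R)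
    (kZ : 'rV[R]_d -> 'rV[R]_d -> R)
    (HXZ : rkhs (prod_kernel kX kZ)) (HY : rkhs kY)
    (Sigma : {linear HXZ -> HY}) : Prop :=
  bounded_op Sigma /\
  forall (f : HXZ) (g : HY),
    ((hdot g (Sigma f))%:E =
     'E_P[fun w => (rkhs_eval f (X w, Z w) * rkhs_eval g (Y w))%R] -
     'E_(distribution P Z)[fun z =>
        (cond_expectation (fun xy => rkhs_eval f (xy.1, z)) z *
         cond_expectation (fun xy => rkhs_eval g xy.2) z)%R])%E.

(* The point a is a Lebesgue point of psi with respect to PZ, averages being
   normalized by r^d.  If PZ has a bounded density and psi is bounded and
   measurable, this holds for almost every a, and at every a where psi is
   continuous; if that density vanishes at a and is continuous, it also holds
   at a.  For psi = [cf_diff kappa ^~ us] it ties the conditional distribution at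
   the single point a, which is otherwise arbitrary because {a} is PZ-null, to
   its values near a. *)
Definition cond_lebesgue_point (PZ : {measure set 'rV[R]_d -> \bar R})
    (psi : 'rV[R]_d -> R[i]) (a : 'rV[R]_d) : Prop :=
  (fun r : R => ((r ^- d)%:E *
    \int[PZ]_(z in ball a r) (normC (psi z - psi a))%:E)%E) @ 0^'+ --> 0%E.

End conditioning.

Definition bandwidth_kernel (R : realType) d (theta : 'rV[R]_d -> R)
    (a : 'rV[R]_d) (t : R) (z : 'rV[R]_d) : R :=
  t ^- d * theta (t^-1 *: (a - z)).

(* Main.v *)
Require Import Defs.
From HB Require Import structures.
From mathcomp Require Import all_boot all_order all_algebra.
From mathcomp Require Import finmap complex ring lra.
From mathcomp Require Import all_classical all_reals all_analysis measurable_realfun.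

Set Implicit Arguments.
Unset Strict Implicit.
Unset Printing Implicit Defensive.

Import Order.TTheory GRing.Theory Num.Theory.
Import numFieldNormedType.Exports.

Local Open Scope classical_set_scope.
Local Open Scope ring_scope.

(** The proof rests on symmetrization.  Let (x, y) and (x', y') be two draws from
    the conditional distribution of (X, Y), independent given Z = z.  A
    conditional covariance of f(X) and g(Y) is half the conditional expectation
    of (f(x) - f(x')) (g(y) - g(y')) ([covariance_two_draws]), and both sides of
    the identity become integrals over z, two draws, and an independent copy of
    all of these.

    On the operator side, the defining identity says that Sigma is the integral
    of the rank-one operators f |-> <f, a> b, where a is half the increment of
    the feature map between (x, z) and (x', z), and b is its increment between y
    and y'.  Parseval's identity turns the squared Hilbert-Schmidt norm into the
    double integral of <a1, a2> <b1, b2> ([hs_norm_double_integral]), and for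
    distance-induced kernels these inner products are, up to factors eta/2,
    second differences of Euclidean distances ([hs_norm_cross_dist]).

    On the Fourier side, the integral of eta times phi_XY - phi_X phi_Y is the
    integral of eta/2 times the product of the increments of e^(i<u,.>) and
    e^(i<s,.>).  Adding its squared modulus at (u, s) and at (-u, s) removes the
    terms odd in u, and what remains is a double integral of a function of u
    times a function of s.  Integrating against the weight gives the same second
    differences of distances ([integral_osc_density_cross_dist]) because
      |x| = (1/c_n) \int (1 - cos<u, x>) |u|^-(n+1) du
    ([enorm_integral_onem_cos]).  That formula comes from writing |u|^-(n+1) as a
    mixture of Gaussians, whose Fourier transforms are Gaussian.  All exchanges
    of integrals are dominated by the product of two copies of
    |eta| |x - x'|^(1/2) |y - y'|^(1/2), whose integrability is what the moment
    conditions provide ([integrable_eta_sqrt_dist]).  Hence both sides agree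
    ([hs_norm_L2w_norm]).

    For the limit, the identity applies to every t > 0, with eta an approximate
    identity at a.  At a Lebesgue point a of z |-> psi_z(u, s), where psi_z =
    phi_XY - phi_X phi_Y, the integral of eta psi_z against P_Z tends to
    p_Z(a) psi_a(u, s) ([cvg_bandwidth]).  The squared moduli are bounded by a
    constant times sup_z |psi_z|^2, whose integral against the weight is finite
    by hypothesis, so dominated convergence applies ([cvg_L2w_norm_bandwidth]). *)

(** * Integrals under image measures and affine maps *)

Section image_measure.
Context d1 d2 (X : measurableType d1) (Y : measurableType d2) (R : realType).
Variables (mu : {measure set X -> \bar R}) (nu : {measure set Y -> \bar R}).
Variable phi : X -> Y.
Hypothesis mphi : measurable_fun setT phi.
Hypothesis nuE : forall A, measurable A -> nu A = mu (phi @^-1` A).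
Let mphi_mixin := isMeasurableFun.Build _ _ _ _ _ mphi.
Let phi_mfun : {mfun _ >-> _} := HB.pack phi mphi_mixin.

Lemma ge0_integral_image (f : Y -> \bar R) :
  measurable_fun setT f -> (forall y, 0 <= f y)%E ->
  (\int[nu]_y f y = \int[mu]_x f (phi x))%E.
Proof.
move=> mf f0.
rewrite (@eq_measure_integral _ _ _ _ (pushforward mu phi_mfun)); last first.
  by move=> A mA _; exact: nuE.
by rewrite ge0_integral_pushforward// ?preimage_setT.
Qed.

Lemma integrable_image (f : Y -> \bar R) : measurable_fun setT f ->
  mu.-integrable setT (f \o phi) -> nu.-integrable setT f.
Proof.
move=> mf /integrableP[_ fi]; apply/integrableP; split => //.
by rewrite ge0_integral_image//; exact: measurableT_comp.
Qed.

Lemma integrable_comp_image (f : Y -> \bar R) :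
  nu.-integrable setT f -> mu.-integrable setT (f \o phi).
Proof.
move=> /integrableP[mf fi]; apply/integrableP; split; first exact: measurableT_comp.
by move: fi; rewrite ge0_integral_image//; exact: measurableT_comp.
Qed.

Lemma integral_image (f : Y -> \bar R) : measurable_fun setT f ->
  mu.-integrable setT (f \o phi) ->
  (\int[nu]_y f y = \int[mu]_x f (phi x))%E.
Proof.
move=> mf fi.
rewrite (@eq_measure_integral _ _ _ _ (pushforward mu phi_mfun)); last first.
  by move=> A mA _; exact: nuE.
by rewrite integral_pushforward// ?preimage_setT.
Qed.

End image_measure.

Section affine_change_of_variables.
Variable R : realType.
Notation leb := (@lebesgue_measure R).

Lemma measurable_affine (c b : R) :
  measurable_fun [set: measurableTypeR R]
    ((fun x => c * x + b) : measurableTypeR R -> measurableTypeR R).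
Proof. by apply: measurable_funD => //; exact: measurable_funM. Qed.

(** By uniqueness of Lebesgue measure, it is enough to compare the two sides on
    half-open intervals. *)
Lemma ge0_integral_translate_dilate (c b : R) (f : measurableTypeR R -> \bar R) :
  0 < c -> measurable_fun setT f -> (forall x, 0 <= f x)%E ->
  (\int[leb]_x f x = c%:E * \int[leb]_x f (c * x + b)%R)%E.
Proof.
move=> c0 mf f0.
pose phi : measurableTypeR R -> measurableTypeR R := fun x => c * x + b.
have mphi : measurable_fun setT phi by exact: measurable_affine.
have ci0 : (0 <= c^-1)%R by rewrite invr_ge0 ltW.
have phiE A : measurable A -> mscale (NngNum ci0) leb A = leb (phi @^-1` A).
  move=> mA; suff h : leb A = (c%:E * leb (phi @^-1` A))%E.
    rewrite /mscale/=; change (c^-1%:E * leb A = leb (phi @^-1` A))%E.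
    by rewrite h muleA -EFinM mulVf ?gt_eqF// mul1e.
  have cE : (0 <= c)%R by exact: ltW.
  pose Phi : {mfun measurableTypeR R >-> measurableTypeR R} :=
    HB.pack phi (isMeasurableFun.Build _ _ _ _ _ mphi).
  apply: (@lebesgue_measure_unique R (mscale (NngNum cE) (pushforward leb Phi))) => //.
  move=> _ [[u v]] _ <- /=; rewrite /mscale/= /pushforward.
  rewrite (_ : phi @^-1` _ = `](u - b) / c, (v - b) / c]%classic); last first.
    apply/seteqP; split=> x /=; rewrite !in_itv/= /phi.
      by rewrite ltr_pdivrMr// ler_pdivlMr// ltrBlDr lerBrDr mulrC.
    by rewrite ltr_pdivrMr// ler_pdivlMr// ltrBlDr lerBrDr mulrC.
  rewrite /= !lebesgue_measure_itv/= !lte_fin ltr_pM2r ?invr_gt0// ltrD2r.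
  case: ifPn => _; last by rewrite mule0.
  by rewrite -!EFinD -EFinM; congr EFin; field; rewrite gt_eqF.
rewrite -(ge0_integral_image mphi phiE mf f0) ge0_integral_mscale//=.
by rewrite muleA -EFinM mulfV ?gt_eqF// mul1e.
Qed.

Lemma ge0_integral_affine (c b : R) (f : measurableTypeR R -> \bar R) :
  c != 0 -> measurable_fun setT f -> (forall x, 0 <= f x)%E ->
  (\int[leb]_x f x = `|c|%:E * \int[leb]_x f (c * x + b)%R)%E.
Proof.
move=> c0 mf f0; have [cp|cn|c00] := ltgtP c 0; last by rewrite c00 eqxx in c0.
- have -> : (\int[leb]_x f x = \int[leb]_x f (- x)%R)%E.
    have mN : measurable_fun setT (-%R : measurableTypeR R -> measurableTypeR R) by [].
    by apply: (ge0_integral_image mN) => // A mA; exact/esym/lebesgue_measureN.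
  rewrite (@ge0_integral_translate_dilate (- c) (- b) (fun x => f (- x)))//.
  + rewrite ltr0_norm//; congr (_ * _)%E; apply: eq_integral => x _.
    by congr f; rewrite opprD opprK mulNr opprK.
  + by rewrite oppr_gt0.
  + exact: measurableT_comp.
- by rewrite gtr0_norm//; exact: ge0_integral_translate_dilate.
Qed.

Lemma ge0_integral_lebesgue_rVS n (f : 'rV[R]_n.+1 -> \bar R) :
  measurable_fun setT f -> (forall u, 0 <= f u)%E ->
  (\int[lebesgue_rV R n.+1]_u f u =
   \int[leb]_x \int[lebesgue_rV R n]_v f (cons_rV (x, v)))%E.
Proof.
move=> mf f0.
have -> := @ge0_integral_image _ _ _ _ _ (leb \x lebesgue_rV R n)%E
  (lebesgue_rV R n.+1) _ (@measurable_cons_rV R n) (fun A _ => erefl) f mf f0.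
rewrite fubini_tonelli1//.
by apply: measurableT_comp => //; exact: measurable_cons_rV.
Qed.

Lemma measurable_affine_rV n (c : R) (b : 'rV[R]_n) :
  measurable_fun setT (fun u : 'rV[R]_n => c *: u + b).
Proof.
apply: measurable_fun_rV => i; under eq_fun do rewrite !mxE.
by apply: measurable_funD => //; apply: measurable_funM => //;
  exact: measurable_fun_coord.
Qed.

(** Coordinates are split off one at a time; each contributes a factor |c|. *)
Lemma ge0_integral_affine_rV n (c : R) (b : 'rV[R]_n) (f : 'rV[R]_n -> \bar R) :
  c != 0 -> measurable_fun setT f -> (forall u, 0 <= f u)%E ->
  (\int[lebesgue_rV R n]_u f u =
   (`|c| ^+ n)%:E * \int[lebesgue_rV R n]_u f (c *: u + b)%R)%E.
Proof.
move=> c0; elim: n b f => [|n ih] b f mf f0.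
  rewrite expr0 mul1e; apply: eq_integral => u _; congr f.
  by apply/rowP => -[].
rewrite !ge0_integral_lebesgue_rVS//; last first.
  by apply: measurableT_comp => //; exact: measurable_affine_rV.
pose b0 := b ord0 ord0; pose b1 := \row_j b ord0 (lift ord0 j).
have consE x v : cons_rV (c * x + b0, c *: v + b1) = c *: cons_rV (x, v) + b :> 'rV[R]_n.+1.
  apply/rowP => i; rewrite !mxE /=; case: unliftP => [j ->|->]//=.
  by rewrite !mxE.
have mfc : measurable_fun setT (f \o @cons_rV R n).
  by apply: measurableT_comp => //; exact: measurable_cons_rV.
rewrite (@ge0_integral_affine c b0) => //; last 2 first.
- exact: (measurable_fun_fubini_tonelli_F _ mfc (fun _ => f0 _)).
- by move=> x; exact: integral_ge0.
rewrite exprS EFinM -muleA; congr (_ * _)%E.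
rewrite -ge0_integralZl//; last 2 first.
- suff m : measurable_fun setT (fun xv => f (c *: @cons_rV R n xv + b)).
    exact: (measurable_fun_fubini_tonelli_F (m2 := lebesgue_rV R n) _ m (fun _ => f0 _)).
  apply: (measurableT_comp mf).
  exact: (measurableT_comp (measurable_affine_rV c b) (@measurable_cons_rV R n)).
- by move=> x _; exact: integral_ge0.
apply: eq_integral => x _; rewrite (ih b1)//.
- by congr (_ * _)%E; apply: eq_integral => v _; rewrite -consE.
- apply: (measurableT_comp mfc); exact: measurable_pair1.
Qed.

Lemma ge0_integral_oppr_rV n (f : 'rV[R]_n -> \bar R) :
  measurable_fun setT f -> (forall u, 0 <= f u)%E ->
  (\int[lebesgue_rV R n]_u f (- u)%R = \int[lebesgue_rV R n]_u f u)%E.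
Proof.
move=> mf f0; rewrite [RHS](@ge0_integral_affine_rV n (-1) 0)// ?oppr_eq0 ?oner_eq0//.
rewrite normrN1 expr1n mul1e; apply: eq_integral => u _.
by rewrite scaleN1r addr0.
Qed.

End affine_change_of_variables.

(** * Fourier transform of the Gaussian on the line *)

Lemma integrable_le_dominated d (T : measurableType d) (R : realType)
    (mu : {measure set T -> \bar R}) (f g : T -> R) :
  measurable_fun setT f -> (forall x, `|f x| <= g x) ->
  mu.-integrable setT (EFin \o g) -> mu.-integrable setT (EFin \o f).
Proof.
move=> mf fg; apply: le_integrable => //; first exact/measurable_EFinP.
by move=> x _ /=; rewrite lee_fin (le_trans (fg x))// ler_norm.
Qed.

Section gaussian_fourier.
Variable R : realType.
Notation leb := (@lebesgue_measure R).

Lemma measurable_cos_comp d (T : measurableType d) (f : T -> R) :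
  measurable_fun setT f -> measurable_fun setT (fun x => cos (f x)).
Proof.
move=> mf; apply: (measurableT_comp _ mf); apply: continuous_measurable_fun.
exact: continuous_cos.
Qed.

Lemma measurable_sin_comp d (T : measurableType d) (f : T -> R) :
  measurable_fun setT f -> measurable_fun setT (fun x => sin (f x)).
Proof.
move=> mf; apply: (measurableT_comp _ mf); apply: continuous_measurable_fun.
exact: continuous_sin.
Qed.

Lemma measurable_mulrl (x : R) : measurable_fun setT (fun u : R => x * u).
Proof. exact: measurable_funM. Qed.

Lemma integrable_bounded_gauss (f : R -> R) : measurable_fun setT f ->
  (forall u, `|f u| <= 1) ->
  leb.-integrable setT (EFin \o (fun u => f u * gauss_fun u)).
Proof.
move=> mf f1; apply: integrable_le_dominated (integrableT_gauss (R := R)).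
  by apply: measurable_funM => //; exact: measurable_gauss_fun.
move=> u; rewrite normrM (ger0_norm (gauss_fun_ge0 u)).
by rewrite ler_piMl// gauss_fun_ge0.
Qed.

(** The elementary bound |u| <= 1 + u^2/2 <= exp(u^2/2) reduces the first
    absolute moment to a dilated Gaussian integral. *)
Lemma integrable_normr_gauss :
  leb.-integrable setT (EFin \o (fun u => `|u| * gauss_fun u)).
Proof.
have mg : measurable_fun setT (fun u : R => expR (- u ^+ 2 / 2)).
  apply: measurableT_comp => //; apply: measurable_funM => //.
  by apply: measurableT_comp => //; exact: measurable_funX.
apply: (@integrable_le_dominated _ _ R leb _ (fun u : R => expR (- u ^+ 2 / 2))).
- apply: measurable_funM; last exact: measurable_gauss_fun.
  exact: normr_measurable.
- move=> u; rewrite normrM normr_id (ger0_norm (gauss_fun_ge0 u)).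
  have -> : gauss_fun u = expR (- u ^+ 2 / 2) * expR (- u ^+ 2 / 2).
    by rewrite -expRD /gauss_fun; congr expR; lra.
  rewrite mulrA -[leRHS]mul1r ler_wpM2r ?expR_ge0//.
  have -> : - u ^+ 2 / 2 = - (u ^+ 2 / 2) by rewrite mulNr.
  rewrite expRN ler_pdivrMr ?expR_gt0// mul1r.
  apply: le_trans (expR_ge1Dx _).
  rewrite -[u ^+ 2]real_normK ?num_real//.
  have := sqr_ge0 (`|u| - 1); nra.
- apply/integrableP; split; first exact/measurable_EFinP.
  have s2 : Num.sqrt 2 != 0 :> R by rewrite gt_eqF// sqrtr_gt0.
  rewrite (@ge0_integral_affine R (Num.sqrt 2) 0)//; last 1 first.
    by apply: measurableT_comp => //; exact/measurable_EFinP.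
  rewrite lte_mul_pinfty ?lee_fin//.
  rewrite (eq_integral (fun u : measurableTypeR R => (gauss_fun u)%:E)); last first.
    move=> u _ /=; rewrite ger0_norm ?expR_ge0// addr0 exprMn sqr_sqrtr//.
    by rewrite mulrC mulrN mulKf.
  by rewrite integralT_gauss ltry.
Qed.

(** Dominated convergence over the intervals [-n, n], on which the fundamental
    theorem of calculus applies. *)
Lemma Rintegral_derive_vanishing (h h' : R -> R) :
  (forall u : R, is_derive u (1 : R) h (h' u)) -> continuous h' ->
  leb.-integrable setT (EFin \o h') ->
  h n%:R - h (- n%:R) @[n --> \oo] --> 0 ->
  \int[leb]_u h' u = 0.
Proof.
move=> dh ch' ih' h0.
have mh' : measurable_fun setT h' by exact: continuous_measurable_fun.
pose D n := `[- n%:R, n%:R]%classic : set R.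
have ftc n : (\int[leb]_(u in D n.+1) (h' u)%:E =
    (h n.+1%:R - h (- n.+1%:R))%:E)%E.
  have ch : continuous h.
    by move=> x; apply: differentiable_continuous; apply/derivable1_diffP;
      have [] := dh x.
  rewrite EFinB; apply: continuous_FTC2.
  - by rewrite (@lt_trans _ _ 0) ?oppr_lt0 ?ltr0n.
  - exact: continuous_subspaceT.
  - split=> [x _||]; first by have [] := dh x.
    + by apply: cvg_at_right_filter; exact: ch.
    + by apply: cvg_at_left_filter; exact: ch.
  - by move=> x _; rewrite derive1E; have [_ ->] := dh x.
have [| | | | |_ _ cv] := @dominated_convergence _ _ R leb setT measurableT
  (fun n => ((EFin \o h') \_ (D n.+1))) (EFin \o h') (fun u => `|h' u|%:E).
- move=> n; apply/(measurable_restrictT (EFin \o h')); first exact: measurable_itv.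
  exact/measurable_EFinP/measurable_funTS.
- exact/measurable_EFinP.
- apply/aeW => x _; apply: cvg_near_cst.
  near=> n; rewrite patchE mem_set// /D/= in_itv/= -ler_norml.
  rewrite (@le_trans _ _ n%:R)//; last by rewrite ler_nat.
  by near: n; exact: nbhs_infty_ger.
- exact: integrable_norm ih'.
- apply/aeW => x n _; rewrite patchE; case: ifPn => _ /=; rewrite ?normr0//.
  by rewrite lee_fin.
- have cv0 : (\int[leb]_u ((EFin \o h') \_ (D n.+1)) u)%E @[n --> \oo] --> (0%:E : \bar R).
    under eq_fun do rewrite -integral_mkcond ftc.
    apply: cvg_EFin; first exact: nearW.
    rewrite /comp/=.
    by move: h0; rewrite -cvg_shiftS.
  by rewrite /Rintegral -(cvg_unique _ cv0 cv)//.
Unshelve. all: end_near. Qed.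

Lemma integrable_cos_gauss (x : R) :
  leb.-integrable setT (EFin \o (fun u => cos (x * u) * gauss_fun u)).
Proof.
apply: integrable_bounded_gauss => [|u]; last exact: cos_max.
by apply: measurable_cos_comp; exact: measurable_mulrl.
Qed.

Lemma integrable_sin_gauss (x : R) :
  leb.-integrable setT (EFin \o (fun u => sin (x * u) * gauss_fun u)).
Proof.
apply: integrable_bounded_gauss => [|u]; last exact: sin_max.
by apply: measurable_sin_comp; exact: measurable_mulrl.
Qed.

Lemma integrable_sin_moment_gauss (x : R) :
  leb.-integrable setT (EFin \o (fun u => u * sin (x * u) * gauss_fun u)).
Proof.
apply: integrable_le_dominated integrable_normr_gauss.
  apply: measurable_funM; last exact: measurable_gauss_fun.
  by apply: measurable_funM => //; apply: measurable_sin_comp; exact: measurable_mulrl.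
move=> u; rewrite !normrM (ger0_norm (gauss_fun_ge0 u)) ler_wpM2r ?gauss_fun_ge0//.
by rewrite ler_piMr// sin_max.
Qed.

(** The integrand is odd. *)
Lemma Rintegral_sin_gauss (x : R) : \int[leb]_u (sin (x * u) * gauss_fun u) = 0.
Proof.
have mN : measurable_fun setT (-%R : measurableTypeR R -> measurableTypeR R) by [].
have NE A : measurable A -> leb A = leb ((-%R : R -> R) @^-1` A).
  by move=> mA; exact/esym/lebesgue_measureN.
have oddE : (EFin \o (fun u => sin (x * u) * gauss_fun u)) \o -%R =
    (fun u => (- (sin (x * u) * gauss_fun u))%:E).
  by apply/funext => u /=; rewrite mulrN sinN /gauss_fun sqrrN mulNr.
have isg := integrable_sin_gauss x.
have E : \int[leb]_u (sin (x * u) * gauss_fun u) =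
    \int[leb]_u (- (sin (x * u) * gauss_fun u)).
  rewrite {1}/Rintegral (integral_image mN NE).
  - by congr fine; apply: eq_integral => u _ /=; rewrite mulrN sinN /gauss_fun sqrrN mulNr.
  - by move/integrableP : isg => [].
  - by rewrite oddE; under eq_fun do rewrite EFinN; exact: integrableN.
move: E; rewrite (_ : (fun u => - _) = (fun u => -1 * (sin (x * u) * gauss_fun u))).
  by rewrite RintegralZl//; lra.
by apply/funext => u; rewrite mulN1r.
Qed.

Let is_derive_gauss (u : R) : is_derive u (1 : R) gauss_fun (- (2 * u) * gauss_fun u).
Proof.
rewrite /gauss_fun.
have -> : (fun x : R => expR (- x ^+ 2)) = expR \o (fun x => - x ^+ 2) by [].
apply: is_derive_eq.
by rewrite /= /GRing.scale/=; ring.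
Qed.

Let is_derive_scale (x u : R) : is_derive u (1 : R) (fun u => x * u) x.
Proof. by apply: is_derive_eq; rewrite /GRing.scale/=; ring. Qed.

(** Integrating the derivative of sin(xu) exp(-u^2) expresses the derivative of
    the Fourier transform of the Gaussian through the transform itself. *)
Lemma gauss_fourier_ode (x : R) :
  \int[leb]_u (u * sin (x * u) * gauss_fun u) =
  x / 2 * \int[leb]_u (cos (x * u) * gauss_fun u).
Proof.
pose h u := sin (x * u) * gauss_fun u.
pose h' u := x * (cos (x * u) * gauss_fun u) - 2 * (u * sin (x * u) * gauss_fun u).
have ci := integrable_cos_gauss x.
have si := integrable_sin_moment_gauss x.
have xci : leb.-integrable setT (EFin \o (fun u => x * (cos (x * u) * gauss_fun u))).
  by rewrite /comp; under eq_fun do rewrite EFinM; exact: integrableZl.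
have xsi : leb.-integrable setT (EFin \o (fun u => 2 * (u * sin (x * u) * gauss_fun u))).
  by rewrite /comp; under eq_fun do rewrite EFinM; exact: integrableZl.
have : \int[leb]_u h' u = 0.
  apply: (Rintegral_derive_vanishing (h := h)).
  - move=> u; rewrite /h /h'.
    have d1 : is_derive u (1 : R) (fun u => sin (x * u)) (cos (x * u) * x).
      have -> : (fun u => sin (x * u)) = sin \o (fun u => x * u) by [].
      by apply: is_derive_eq; rewrite /GRing.scale/=; ring.
    apply: is_derive_eq.
    by rewrite /gauss_fun /GRing.scale/=; ring.
  - move=> u; rewrite /h'.
    have cg : gauss_fun z @[z --> u] --> gauss_fun u by exact: continuous_gauss_fun.
    have cm : x * z @[z --> u] --> x * u by apply: cvgM => //; exact: cvg_cst.
    apply: cvgB; apply: cvgM; try exact: cvg_cst; apply: cvgM => //.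
      by apply: (cvg_comp _ _ cm); exact: continuous_cos.
    apply: cvgM => //.
    by apply: (cvg_comp _ _ cm); exact: continuous_sin.
  - by rewrite /comp /h'; under eq_fun do rewrite EFinB; exact: integrableB.
  - have -> : (fun n : nat => h n%:R - h (- n%:R)) =
        (fun n : nat => 2 * sin (x * n%:R) * gauss_fun n%:R).
      by apply/funext => n; rewrite /h mulrN sinN /gauss_fun sqrrN; ring.
    have g0 : (2 * gauss_fun n%:R : R) @[n --> \oo] --> (0 : R).
      rewrite -[X in _ --> X](mulr0 2); apply: cvgMr.
      by apply: (cvg_comp _ _ cvgr_idn); exact: cvg_gauss_fun.
    apply/norm_cvg0P; apply: (squeeze_cvgr _ (cvg_cst 0) g0).
    apply: nearW => n; rewrite normr_ge0/= !normrM (ger0_norm (gauss_fun_ge0 _)).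
    by rewrite ler_wpM2r ?gauss_fun_ge0// normr_nat ler_piMr// sin_max.
rewrite /h' RintegralB// !RintegralZl// => /eqP; rewrite subr_eq0 => /eqP E.
by rewrite mulrAC E; field.
Qed.

(** By [gauss_fourier_ode] the transform F satisfies F' = - (x/2) F, so F times
    exp(x^2/4) is constant, and F 0 is the Gaussian integral. *)
Lemma Rintegral_cos_gauss (x : R) :
  \int[leb]_u (cos (x * u) * gauss_fun u) = Num.sqrt pi * expR (- x ^+ 2 / 4).
Proof.
pose F x := \int[leb]_u (cos (x * u) * gauss_fun u).
have dF y : is_derive y (1 : R) F (- (y / 2 * F y)).
  have d1 z u : is_derive z (1:R) (fun z => cos (z * u) * gauss_fun u)
      (- (u * sin (z * u) * gauss_fun u)).
    have d2 : is_derive z (1:R) (fun z => cos (z * u)) (- sin (z * u) * u).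
      have -> : (fun z => cos (z * u)) = cos \o (fun z => z * u) by [].
      by apply: is_derive_eq; rewrite /GRing.scale/=; ring.
    by apply: is_derive_eq; rewrite /GRing.scale/=; ring.
  have I : `]y - 1, y + 1[%classic y by rewrite /= in_itv/=; apply/andP; split; lra.
  have h1 z : `]y - 1, y + 1[%classic z -> leb.-integrable setT
      (EFin \o (fun u => cos (z * u) * gauss_fun u)).
    by move=> _; exact: integrable_cos_gauss.
  have h2 (z u : R) : `]y - 1, y + 1[%classic z -> [set: R] u ->
      derivable (fun z : R => cos (z * u) * gauss_fun u) z (1 : R).
    by move=> _ _; have [] := d1 z u.
  have h3 (z u : R) : `]y - 1, y + 1[%classic z -> [set: R] u ->
     `|partial1of2 (fun z u => cos (z * u) * gauss_fun u) z u| <= `|u| * gauss_fun u.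
    move=> _ _; rewrite partial1of2E; have [_ ->] := d1 z u.
    rewrite normrN !normrM (ger0_norm (gauss_fun_ge0 u)) ler_wpM2r ?gauss_fun_ge0//.
    by rewrite ler_piMr// sin_max.
  have h0 (u : R) : 0 <= `|u| * gauss_fun u by rewrite mulr_ge0// gauss_fun_ge0.
  have dv := derivable_under_integral measurableT I h1 h2 h0 integrable_normr_gauss h3.
  have ev := differentiation_under_integral measurableT I h1 h2 h0 integrable_normr_gauss h3.
  apply: DeriveDef; first exact: dv.
  rewrite -derive1E ev.
  rewrite (@eq_Rintegral _ _ _ _ _ (fun u : measurableTypeR R => -1 * (u * sin (y * u) * gauss_fun u))).
    rewrite RintegralZl//; last exact: integrable_sin_moment_gauss.
    by rewrite gauss_fourier_ode mulN1r.
  move=> u _; rewrite partial1of2E; have [_ ->] := d1 y u.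
  by rewrite mulN1r.
have dG y : is_derive y (1 : R) (fun y => F y * expR (y ^+ 2 / 4)) 0.
  have d1 : is_derive y (1:R) (fun y => expR (y ^+ 2 / 4)) (y / 2 * expR (y ^+ 2 / 4)).
    have -> : (fun y => expR (y ^+ 2 / 4)) = expR \o (fun y => y ^+ 2 * 4^-1) by [].
    by apply: is_derive_eq; rewrite /GRing.scale/=; field.
  by apply: is_derive_eq; rewrite /GRing.scale/=; ring.
have := is_derive_0_is_cst x 0 dG.
rewrite expr0n mul0r expR0 mulr1.
have -> : F 0 = Num.sqrt pi.
  rewrite /F /Rintegral; under eq_integral do rewrite mul0r cos0 mul1r.
  by rewrite integralT_gauss.
rewrite -/(F x) mulNr expRN => <-.
by rewrite mulfK// gt_eqF// expR_gt0.
Qed.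

End gaussian_fourier.

(** * The integral of t^(-1/2) (1 - exp(-1/(4t))) *)

Section stable_half_integral.
Variable R : realType.
Notation leb := (@lebesgue_measure R).

Let G (x : R) := \int[leb]_(t in `]-oo, x]) gauss_fun t.

Let is_derive_G (x : R) : is_derive x (1 : R) G (gauss_fun x).
Proof.
have i : leb.-integrable [set` Interval -oo%O (BRight (x + 1))] (EFin \o gauss_fun).
  by apply: integrableS (integrableT_gauss (R := R)) => //; exact: measurable_itv.
have xu : x < x + 1 by rewrite ltrDl.
have [dG G'] := @continuous_FTC1 R gauss_fun -oo%O x (x + 1) xu i (ltNyr x)
  (@continuous_gauss_fun R x).
by apply: DeriveDef; [exact: dG|rewrite -derive1E].
Qed.

Let G0 : G 0 = Num.sqrt pi / 2.
Proof.
have E : (\int[leb]_x (gauss_fun x)%:E = (G 0)%:E + (Num.sqrt pi / 2)%:E)%E.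
  have -> : [set: measurableTypeR R] = `]-oo, 0%R] `|` `]0%R, +oo[.
    by rewrite -setCitvr setvU.
  rewrite ge0_integral_setU//=; last 3 first.
  - by apply/measurable_EFinP/measurable_funTS; exact: measurable_gauss_fun.
  - by move=> x _; rewrite lee_fin gauss_fun_ge0.
  - by apply/disj_setPS => x /=; rewrite !in_itv/= andbT => -[]; rewrite ltNge => ->.
  congr (_ + _)%E.
    rewrite /G /Rintegral fineK//; apply: integrable_fin_num => //.
    by apply: integrableS (integrableT_gauss (R := R)).
  rewrite -integral0y_gauss integral_itv_obnd_cbnd//.
  by apply/measurable_EFinP/measurable_funTS; exact: measurable_gauss_fun.
move: E; rewrite integralT_gauss -EFinD => -[]; lra.
Qed.

Let Gy : G n%:R @[n --> \oo] --> Num.sqrt pi.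
Proof.
have h := @ge0_nondecreasing_set_cvg_integral _ _ R
  (fun n => `]-oo, n%:R]%classic : set (measurableTypeR R)) (EFin \o gauss_fun) leb.
have {h} : (\int[leb]_(x in `]-oo, n%:R]) (gauss_fun x)%:E)%E @[n --> \oo] -->
    (\int[leb]_x (gauss_fun x)%:E)%E.
  have -> : [set: measurableTypeR R] = \bigcup_n `]-oo, n%:R]%classic.
    apply/seteqP; split => // x _; exists (Num.truncn `|x|).+1 => //=.
    rewrite in_itv/= (le_trans (ler_norm x))// ltW//.
    by have /truncn_itv/andP[] := normr_ge0 x.
  apply: h => //.
  - by move=> m n mn; apply/subsetPset => x /=; rewrite !in_itv/= => /le_trans; apply; rewrite ler_nat.
  - by move=> i; apply/measurable_EFinP/measurable_funTS; exact: measurable_gauss_fun.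
  - by move=> i x _; rewrite lee_fin gauss_fun_ge0.
rewrite integralT_gauss => /fine_cvg/=.
by [].
Qed.

(** The substitution s = t^(-1/2)/2 after an integration by parts, packaged as
    the antiderivative
    2 t^(1/2) (1 - exp(-1/(4t))) - 2 \int_(-oo)^(t^(-1/2)/2) exp(-s^2) ds. *)
Lemma integral_powRN2_onem_expR :
  (\int[leb]_(t in `]0%R, +oo[)
     (t `^ (- 2^-1) * (1 - expR (- (4 * t)^-1)))%:E = (Num.sqrt pi)%:E)%E.
Proof.
pose f t : R := t `^ (- 2^-1) * (1 - expR (- (4 * t)^-1)).
pose F t : R := 2 * t `^ 2^-1 * (1 - expR (- (4 * t)^-1)) - 2 * G (2^-1 * t `^ (- 2^-1)).
have d1 (t : R) : 0 < t -> is_derive t (1:R) (fun t => 1 - expR (- (4 * t)^-1))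
    (- (expR (- (4 * t)^-1) * (4 * t ^+ 2)^-1)).
  move=> t0; have t40 : 4 * t != 0 by rewrite mulf_neq0 ?gt_eqF.
  have d : is_derive t (1:R) (fun t => - (4 * t)^-1) ((4 * t ^+ 2)^-1).
    have d0 : is_derive t (1:R) (fun t => 4 * t) 4.
      by apply: is_derive_eq; rewrite /GRing.scale/=; ring.
    have dV := is_deriveV t40 d0.
    apply: is_derive_eq; rewrite /GRing.scale/=.
    by field; rewrite gt_eqF.
  have -> : (fun t => 1 - expR (- (4 * t)^-1)) = cst 1 - (expR \o (fun t => - (4 * t)^-1)) by [].
  by apply: is_derive_eq; rewrite sub0r.
have dF (t : R) : 0 < t -> is_derive t (1 : R) F (f t).
  move=> t0; have t_neq0 : t != 0 by rewrite gt_eqF.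
  have d2 : is_derive t (1:R) (fun t => G (2^-1 * t `^ (- 2^-1)))
      (gauss_fun (2^-1 * t `^ (- 2^-1)) * (2^-1 * (- 2^-1 * t `^ (- 2^-1 - 1)))).
    have d3 := is_derive1_powR (- 2^-1) t0.
    have -> : (fun t => G (2^-1 * t `^ (- 2^-1))) = G \o (fun t => 2^-1 * t `^ (- 2^-1)) by [].
    have d4 : is_derive t (1:R) (fun t => 2^-1 * t `^ (- 2^-1)) (2^-1 * (- 2^-1 * t `^ (- 2^-1 - 1))).
      by apply: is_derive_eq; rewrite /GRing.scale/=; ring.
    exact: is_derive1_comp.
  have d3 := is_derive1_powR (2^-1) t0.
  have d1t := d1 t t0.
  apply: is_derive_eq; rewrite /GRing.scale/= /f.
  have -> : 2^-1 - 1 = - 2^-1 :> R by lra.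
  have -> : t `^ (- 2^-1 - 1) = t `^ (- 2^-1) / t.
    by rewrite powRD ?t_neq0 ?implybT// powR_inv1// ltW.
  rewrite powRN; set T := t `^ 2^-1.
  have T0 : 0 < T by rewrite powR_gt0.
  have tE : t = T ^+ 2 by rewrite -powR_mulrn ?powR_ge0// -powRrM mulVf ?powRr1// ltW.
  have -> : gauss_fun (2^-1 * T^-1) = expR (- (4 * t)^-1).
    rewrite /gauss_fun tE; congr expR; field.
    by rewrite gt_eqF.
  move: (expR _) T0 tE => E; move: T => T T0 ->.
  by field; rewrite gt_eqF.
have f0 t : 0 < t -> 0 <= f t.
  move=> t0; rewrite mulr_ge0 ?powR_ge0// subr_ge0 -expR0 ler_expR oppr_le0.
  by rewrite invr_ge0 mulr_ge0// ltW.
have cf (t : R) : 0 < t -> {for t, continuous f}.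
  move=> t0; have d1t := d1 t t0.
  have d3 := is_derive1_powR (- 2^-1) t0.
  apply: differentiable_continuous; apply/derivable1_diffP.
  by apply: ex_derive.
(* At t = a k the argument t^(-1/2)/2 of G equals k+2, and at t = b k it
   equals 1/(k+2). *)
pose a k : R := (4 * k.+2%:R ^+ 2)^-1.
pose b k : R := k.+2%:R ^+ 2 / 4.
have k1 k : 1 <= k.+2%:R :> R by rewrite ler1n.
have a0 k : 0 < a k by rewrite invr_gt0 mulr_gt0// exprn_gt0.
have ab k : a k < b k.
  rewrite /a /b -div1r ltr_pdivrMr ?mulr_gt0 ?exprn_gt0//.
  have : 2 <= k.+2%:R :> R by rewrite ler_nat.
  move: (k.+2%:R : R) => x x2.
  have x24 : 4 <= x ^+ 2 by rewrite (_ : 4 = 2 ^+ 2) ?ler_sqr ?nnegrE; lra.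
  nra.
have ftc k : (\int[leb]_(t in `[a k, b k]) (f t)%:E = (F (b k) - F (a k))%:E)%E.
  have cF t : 0 < t -> {for t, continuous F}.
    move=> t0; apply: differentiable_continuous; apply/derivable1_diffP.
    by have [] := dF t t0.
  rewrite EFinB; apply: continuous_FTC2 => //.
  - apply: continuous_in_subspaceT => t; rewrite inE/= in_itv/= => /andP[at_ _].
    by apply: cf; exact: lt_le_trans at_.
  - split.
    + move=> t; rewrite in_itv/= => /andP[at_ _].
      by have [] := dF t (lt_trans (a0 k) at_).
    + by apply: cvg_at_right_filter; exact: cF.
    + by apply: cvg_at_left_filter; apply: cF; exact: lt_trans (ab k).
  - move=> t; rewrite in_itv/= => /andP[at_ _]; rewrite derive1E.
    by have [_ ->] := dF t (lt_trans (a0 k) at_).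
have sqrtK (x : R) : 0 < x -> (x ^+ 2) `^ 2^-1 = x.
  by move=> x0; rewrite powR12_sqrt ?sqr_ge0// sqrtr_sqr gtr0_norm.
have Fb k : F (b k) = k.+2%:R * (1 - expR (- (k.+2%:R ^+ 2)^-1)) - 2 * G k.+2%:R^-1.
  rewrite /F /b; have := k1 k; move: (k.+2%:R : R) => x x1.
  have x0 : 0 < x by exact: lt_le_trans x1.
  rewrite powRN (_ : x ^+ 2 / 4 = (x / 2) ^+ 2); last by field.
  rewrite sqrtK ?divr_gt0// (_ : 4 * (x / 2) ^+ 2 = x ^+ 2); last by field.
  congr (_ * _ - _ * G _); first by field.
  by field; rewrite gt_eqF.
have Fa k : F (a k) = k.+2%:R^-1 * (1 - expR (- (k.+2%:R ^+ 2))) - 2 * G k.+2%:R.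
  rewrite /F /a; have := k1 k; move: (k.+2%:R : R) => x x1.
  have x0 : 0 < x by exact: lt_le_trans x1.
  rewrite powRN (_ : (4 * x ^+ 2)^-1 = (2 * x)^-1 ^+ 2); last first.
    by field; rewrite gt_eqF.
  rewrite sqrtK ?invr_gt0 ?mulr_gt0//.
  rewrite (_ : (4 * (2 * x)^-1 ^+ 2)^-1 = x ^+ 2); last by field; rewrite gt_eqF.
  by congr (_ * _ - _ * G _); field; rewrite gt_eqF.
have kV0 : (k.+2%:R^-1 : R) @[k --> \oo] --> (0 : R).
  by have := @cvg_harmonic R; rewrite -cvg_shiftS.
have lim1 : (\int[leb]_(t in `[a k, b k]) (f t)%:E)%E @[k --> \oo] --> (Num.sqrt pi)%:E.
  under eq_fun do rewrite ftc Fb Fa.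
  apply: cvg_EFin; first exact: nearW.
  rewrite /comp/=.
  have -> : Num.sqrt pi = (0 - 2 * (Num.sqrt pi / 2)) - (0 - 2 * Num.sqrt pi) :> R by lra.
  have sub1 (x : R) : 0 <= x -> 0 <= 1 - expR (- x) <= x.
    move=> x0; rewrite subr_ge0 -{1}expR0 ler_expR oppr_le0 x0/=.
    by have := expR_ge1Dx (- x); lra.
  apply: cvgB; apply: cvgB.
  - apply: (squeeze_cvgr _ (cvg_cst 0) kV0); apply: nearW => k.
    have := k1 k; move: (k.+2%:R : R) => x x1.
    have x0 : 0 < x by exact: lt_le_trans x1.
    have /andP[e0 e1] := sub1 (x ^+ 2)^-1 ltac:(by rewrite invr_ge0 sqr_ge0).
    rewrite mulr_ge0 ?(ltW x0)//=.
    rewrite (le_trans (ler_wpM2l (ltW x0) e1))//.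
    by rewrite expr2 invfM mulrA mulfV ?gt_eqF// mul1r.
  - apply: cvgM; first exact: cvg_cst.
    rewrite -G0; apply: (cvg_comp _ _ kV0).
    apply: differentiable_continuous; apply/derivable1_diffP.
    by have [] := is_derive_G 0.
  - apply: (squeeze_cvgr _ (cvg_cst 0) kV0); apply: nearW => k.
    have := k1 k; move: (k.+2%:R : R) => x x1.
    have x0 : 0 < x by exact: lt_le_trans x1.
    have := sub1 (x ^+ 2) (sqr_ge0 x); have := expR_gt0 (- x ^+ 2) => e0 /andP[e1 _].
    rewrite mulr_ge0 ?invr_ge0 ?(ltW x0)//= ler_piMr ?invr_ge0 ?(ltW x0)//; lra.
  - apply: cvgM; first exact: cvg_cst.
    by have := Gy; rewrite -(cvg_shiftn 2); under eq_fun do rewrite addn2.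
have lim2 : (\int[leb]_(t in `[a k, b k]) (f t)%:E)%E @[k --> \oo] -->
    (\int[leb]_(t in `]0%R, +oo[) (f t)%:E)%E.
  have -> : `]0%R, +oo[%classic = \bigcup_k `[a k, b k]%classic.
    apply/seteqP; split => [t /=|t [k _] /=]; rewrite !in_itv/= ?andbT; last first.
      by move=> /andP[+ _]; apply: lt_le_trans.
    move=> t0; exists (Num.truncn (t^-1 + 4 * t)) => //=; rewrite in_itv/=.
    have s0 : 0 <= t^-1 + 4 * t by rewrite addr_ge0 ?invr_ge0 ?mulr_ge0 // ltW.
    have /truncn_itv/andP[_] := s0; set m := Num.truncn _ => tm.
    rewrite /a /b; have := k1 m; have : m.+1%:R <= m.+2%:R :> R by rewrite ler_nat.
    move: (m.+2%:R : R) => x mx x1.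
    have tV : 0 < t^-1 by rewrite invr_gt0.
    have xx : x <= x ^+ 2 by rewrite expr2 ler_peMl// (le_trans _ x1).
    rewrite -{1}(invrK t) lef_pV2 ?posrE ?mulr_gt0 ?exprn_gt0 ?(lt_le_trans _ x1)//.
    apply/andP; split; [nra|lra].
  apply: ge0_nondecreasing_set_cvg_integral.
  - move=> m n mn; apply/subsetPset => x /=; rewrite !in_itv/= => /andP[am bm].
    have mn2 : m.+2%:R ^+ 2 <= n.+2%:R ^+ 2 :> R.
      by rewrite ler_sqr ?nnegrE// ler_nat.
    rewrite (le_trans _ am) ?(le_trans bm)//.
      by rewrite /b ler_wpM2r.
    by rewrite /a lef_pV2 ?posrE ?mulr_gt0 ?exprn_gt0// ler_wpM2l.
  - by move=> i; exact: measurable_itv.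
  - move=> i; apply/measurable_EFinP.
    apply: subspace_continuous_measurable_fun; first exact: measurable_itv.
    apply: continuous_in_subspaceT => t; rewrite inE/= in_itv/= => /andP[at_ _].
    by apply: cf; exact: lt_le_trans at_.
  - move=> i x; rewrite /= in_itv/= => /andP[ax _]; rewrite lee_fin.
    by apply: f0; exact: lt_le_trans ax.
exact: cvg_unique lim2 lim1.
Qed.
End stable_half_integral.

(** * Product measures and the Gaussian on R^n *)

Section product_integrals.
Context d1 d2 (T1 : measurableType d1) (T2 : measurableType d2) (R : realType).
Variables (m1 : {sigma_finite_measure set T1 -> \bar R})
  (m2 : {sigma_finite_measure set T2 -> \bar R}).

Lemma ge0_integral_prodM (f : T1 -> \bar R) (g : T2 -> \bar R) :
  measurable_fun setT f -> measurable_fun setT g ->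
  (forall x, 0 <= f x)%E -> (forall y, 0 <= g y)%E ->
  (\int[m1 \x m2]_z (f z.1 * g z.2) = (\int[m1]_x f x) * \int[m2]_y g y)%E.
Proof.
move=> mf mg f0 g0; rewrite fubini_tonelli1//=; last 2 first.
- by apply: emeasurable_funM; [exact: (measurableT_comp mf measurable_fst)|exact: (measurableT_comp mg measurable_snd)].
- by move=> z; rewrite mule_ge0.
rewrite -ge0_integralZr//; last by apply: integral_ge0.
by apply: eq_integral => x _; rewrite /fubini_F/= ge0_integralZl.
Qed.

Lemma integrable_prodM (f : T1 -> R) (g : T2 -> R) :
  m1.-integrable setT (EFin \o f) -> m2.-integrable setT (EFin \o g) ->
  (m1 \x m2)%E.-integrable setT (EFin \o (fun z => f z.1 * g z.2)).
Proof.
move=> fi gi; have [mf foo] := integrableP _ _ _ fi; have [mg goo] := integrableP _ _ _ gi.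
apply/integrableP; split.
  apply/measurable_EFinP; apply: measurable_funM.
    by apply: (measurableT_comp _ measurable_fst); exact/measurable_EFinP.
  by apply: (measurableT_comp _ measurable_snd); exact/measurable_EFinP.
under eq_integral do rewrite /= normrM EFinM.
rewrite (ge0_integral_prodM (f := abse \o (EFin \o f)) (g := abse \o (EFin \o g)))//.
- have a0 : (0 <= \int[m1]_x (abse \o (EFin \o f)) x)%E by apply: integral_ge0 => x _ /=.
  by rewrite lte_mul_pinfty ?ge0_fin_numE.
- exact: measurableT_comp.
- exact: measurableT_comp.
- by move=> x; exact: abse_ge0.
- by move=> x; exact: abse_ge0.
Qed.

Lemma Rintegral_prodM (f : T1 -> R) (g : T2 -> R) :
  m1.-integrable setT (EFin \o f) -> m2.-integrable setT (EFin \o g) ->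
  \int[(m1 \x m2)%E]_z (f z.1 * g z.2) = (\int[m1]_x f x) * \int[m2]_y g y.
Proof.
move=> fi gi; rewrite {1}/Rintegral -(integral12_prod_meas1 (integrable_prodM fi gi)).
rewrite /fubini_F/=.
under eq_integral => x _.
  under eq_integral do rewrite EFinM.
  rewrite integralZl// -[X in (_ * X)%E]fineK ?integrable_fin_num//.
  over.
rewrite /= integralZr//= -[X in (X * _)%E]fineK ?integrable_fin_num//.
Qed.

End product_integrals.

Section gaussian_rV.
Variable R : realType.
Notation leb := (@lebesgue_measure R).

Lemma measurable_dotp d (T : measurableType d) n (f g : T -> 'rV[R]_n) :
  measurable_fun setT f -> measurable_fun setT g ->
  measurable_fun setT (fun x => dotp (f x) (g x)).
Proof.
move=> mf mg; apply: measurable_sum => i; apply: measurable_funM.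
  exact: (measurableT_comp (measurable_fun_coord i) mf).
exact: (measurableT_comp (measurable_fun_coord i) mg).
Qed.

Lemma measurable_sqrtr d (T : measurableType d) (f : T -> R) :
  measurable_fun setT f -> measurable_fun setT (fun x => Num.sqrt (f x)).
Proof.
by apply: measurableT_comp; apply: continuous_measurable_fun; exact: sqrt_continuous.
Qed.

Lemma measurable_enorm d (T : measurableType d) n (f : T -> 'rV[R]_n) :
  measurable_fun setT f -> measurable_fun setT (fun x => enorm (f x)).
Proof. by move=> mf; apply: measurable_sqrtr; exact: measurable_dotp. Qed.

Lemma measurable_subr_rV d (T : measurableType d) n (f g : T -> 'rV[R]_n) :
  measurable_fun setT f -> measurable_fun setT g -> measurable_fun setT (fun x => f x - g x).
Proof.
move=> mf mg; apply: measurable_fun_rV => i; under eq_fun do rewrite !mxE.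
apply: measurable_funB; first exact: (measurableT_comp (measurable_fun_coord i) mf).
exact: (measurableT_comp (measurable_fun_coord i) mg).
Qed.

Lemma measurable_enormB d (T : measurableType d) n (f g : T -> 'rV[R]_n) :
  measurable_fun setT f -> measurable_fun setT g ->
  measurable_fun setT (fun x => enorm (f x - g x)).
Proof. by move=> mf mg; apply: measurable_enorm; exact: measurable_subr_rV. Qed.

Lemma dotp_cons_rV n (a : R) (v : 'rV[R]_n) (x : 'rV[R]_n.+1) :
  dotp (cons_rV (a, v)) x = a * x ord0 ord0 + dotp v (\row_j x ord0 (lift ord0 j)).
Proof.
rewrite /dotp big_ord_recl; congr (_ + _).
  by rewrite mxE unlift_none.
by apply: eq_bigr => j _; rewrite !mxE liftK.
Qed.

Lemma dotp_ge0 n (u : 'rV[R]_n) : 0 <= dotp u u.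
Proof. by apply: sumr_ge0 => i _; rewrite -expr2 sqr_ge0. Qed.

Lemma dotpC n (u v : 'rV[R]_n) : dotp u v = dotp v u.
Proof. by apply: eq_bigr => i _; rewrite mulrC. Qed.

Lemma dotp0l n (u : 'rV[R]_n) : dotp 0 u = 0.
Proof. by apply: big1 => i _; rewrite mxE mul0r. Qed.

Lemma dotpZl n c (u v : 'rV[R]_n) : dotp (c *: u) v = c * dotp u v.
Proof. by rewrite /dotp mulr_sumr; apply: eq_bigr => i _; rewrite mxE mulrA. Qed.

Lemma dotp0r n (u : 'rV[R]_n) : dotp u 0 = 0.
Proof. by rewrite dotpC dotp0l. Qed.

Lemma dotpZr n c (u v : 'rV[R]_n) : dotp u (c *: v) = c * dotp u v.
Proof. by rewrite dotpC dotpZl dotpC. Qed.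

Lemma dotpDr n (u v w : 'rV[R]_n) : dotp u (v + w) = dotp u v + dotp u w.
Proof. by rewrite /dotp -big_split; apply: eq_bigr => i _; rewrite mxE mulrDr. Qed.

Lemma dotpNr n (u v : 'rV[R]_n) : dotp u (- v) = - dotp u v.
Proof. by rewrite /dotp -sumrN; apply: eq_bigr => i _; rewrite mxE mulrN. Qed.

Lemma dotpBr n (u v w : 'rV[R]_n) : dotp u (v - w) = dotp u v - dotp u w.
Proof. by rewrite dotpDr dotpNr. Qed.

Lemma dotpNl n (u v : 'rV[R]_n) : dotp (- u) v = - dotp u v.
Proof. by rewrite dotpC dotpNr dotpC. Qed.

Lemma enorm_ge0 n (u : 'rV[R]_n) : 0 <= enorm u.
Proof. exact: sqrtr_ge0. Qed.

Lemma sqr_enorm n (u : 'rV[R]_n) : enorm u ^+ 2 = dotp u u.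
Proof. by rewrite sqr_sqrtr// dotp_ge0. Qed.

Lemma enorm0 n : enorm (0 : 'rV[R]_n) = 0.
Proof. by rewrite /enorm dotp0l sqrtr0. Qed.

Lemma enormN n (u : 'rV[R]_n) : enorm (- u) = enorm u.
Proof. by rewrite /enorm dotpNl dotpNr opprK. Qed.

Lemma enormB n (u v : 'rV[R]_n) : enorm (u - v) = enorm (v - u).
Proof. by rewrite -enormN opprB. Qed.

Lemma dotp_eq0 n (u : 'rV[R]_n) : (dotp u u == 0) = (u == 0).
Proof.
apply/eqP/eqP => [|->]; last exact: dotp0l.
move=> /eqP; rewrite psumr_eq0; last by move=> i _; rewrite -expr2 sqr_ge0.
move=> /allP h; apply/rowP => i; rewrite mxE.
by have := h i (mem_index_enum _); rewrite /= mulf_eq0 orbb => /eqP.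
Qed.

Definition gauss_rV n (u : 'rV[R]_n) : R := expR (- dotp u u).

Lemma measurable_gauss_rV n : measurable_fun setT (@gauss_rV n).
Proof.
apply: measurableT_comp => //; apply: measurableT_comp => //.
by apply: measurable_dotp; exact: measurable_id.
Qed.

Lemma gauss_rV_cons n (a : R) (v : 'rV[R]_n) :
  gauss_rV (cons_rV (a, v)) = gauss_fun a * gauss_rV v.
Proof.
rewrite /gauss_rV dotp_cons_rV opprD expRD mxE unlift_none; congr (_ * expR (- _)).
by apply: eq_bigr => j _; rewrite !mxE liftK.
Qed.

Lemma integrable_gauss_rV n : (lebesgue_rV R n).-integrable setT (EFin \o @gauss_rV n).
Proof.
elim: n => [|n ih].
  apply: (measurable_bounded_integrable measurableT).
  - by rewrite /= diracT ltry.
  - exact: measurable_gauss_rV.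
  - exists 1; split => // M M1 u _ /=; rewrite (le_trans _ (ltW M1))//.
    by rewrite ger0_norm ?expR_ge0// -expR0 ler_expR oppr_le0 dotp_ge0.
apply: (integrable_image (mu := (leb \x lebesgue_rV R n)%E) (@measurable_cons_rV R n)) => //.
  by apply/measurable_EFinP; exact: measurable_gauss_rV.
rewrite (_ : _ \o _ = EFin \o (fun z => gauss_fun z.1 * gauss_rV z.2)).
  by apply: integrable_prodM => //; exact: integrableT_gauss.
by apply/funext => -[a v] /=; rewrite gauss_rV_cons.
Qed.

Lemma integrable_bounded_gauss_rV n (f : 'rV[R]_n -> R) : measurable_fun setT f ->
  (forall u, `|f u| <= 1) ->
  (lebesgue_rV R n).-integrable setT (EFin \o (fun u => f u * gauss_rV u)).
Proof.
move=> mf f1; apply: integrable_le_dominated (integrable_gauss_rV n).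
  by apply: measurable_funM => //; exact: measurable_gauss_rV.
move=> u; rewrite normrM (ger0_norm (expR_ge0 _)).
by rewrite ler_piMl// expR_ge0.
Qed.

Lemma measurable_dotpr n (x : 'rV[R]_n) : measurable_fun setT (fun u => dotp u x).
Proof. by apply: measurable_dotp => //; exact: measurable_id. Qed.

Lemma integrable_cos_gauss_rV n (x : 'rV[R]_n) :
  (lebesgue_rV R n).-integrable setT (EFin \o (fun u => cos (dotp u x) * gauss_rV u)).
Proof.
apply: integrable_bounded_gauss_rV => [|u]; last exact: cos_max.
by apply: measurable_cos_comp; exact: measurable_dotpr.
Qed.

Lemma integrable_sin_gauss_rV n (x : 'rV[R]_n) :
  (lebesgue_rV R n).-integrable setT (EFin \o (fun u => sin (dotp u x) * gauss_rV u)).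
Proof.
apply: integrable_bounded_gauss_rV => [|u]; last exact: sin_max.
by apply: measurable_sin_comp; exact: measurable_dotpr.
Qed.

(** The sine transform is carried along because splitting off a coordinate
    uses the addition formula. *)
Lemma Rintegral_cos_sin_gauss_rV n (x : 'rV[R]_n) :
  \int[lebesgue_rV R n]_u (cos (dotp u x) * gauss_rV u) =
    Num.sqrt pi ^+ n * expR (- dotp x x / 4) /\
  \int[lebesgue_rV R n]_u (sin (dotp u x) * gauss_rV u) = 0.
Proof.
elim: n x => [|n ih] x.
  have E (u v : 'rV[R]_0) : dotp u v = 0 by rewrite /dotp big_ord0.
  have mg := @measurable_gauss_rV 0; have md := measurable_dotpr x.
  have mc : measurable_fun setT (fun u => (cos (dotp u x) * gauss_rV u)%:E).
    by apply/measurable_EFinP; apply: measurable_funM => //; exact: measurable_cos_comp.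
  have ms : measurable_fun setT (fun u => (sin (dotp u x) * gauss_rV u)%:E).
    by apply/measurable_EFinP; apply: measurable_funM => //; exact: measurable_sin_comp.
  by split; rewrite /Rintegral integral_dirac// diracT mul1e/= /gauss_rV !E
    ?sin0 ?cos0 ?oppr0 ?mul0r ?expR0 ?mul1r.
set x0 := x ord0 ord0; pose x' : 'rV[R]_n := \row_j x ord0 (lift ord0 j).
have [ihc ihs] := ih x'.
have xx : dotp x x = x0 ^+ 2 + dotp x' x'.
  rewrite /dotp big_ord_recl expr2; congr (_ + _).
  by apply: eq_bigr => j _; rewrite !mxE.
have c1 := integrable_cos_gauss x0; have s1 := integrable_sin_gauss x0.
have cn := integrable_cos_gauss_rV x'; have sn := integrable_sin_gauss_rV x'.
have cc := integrable_prodM c1 cn; have ss := integrable_prodM s1 sn.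
have cs := integrable_prodM c1 sn; have sc := integrable_prodM s1 cn.
have split_cons (F : 'rV[R]_n.+1 -> R) (A B : measurableTypeR R * 'rV[R]_n -> R) :
    measurable_fun setT F -> (forall z, F (cons_rV z) = A z + B z) ->
    (leb \x lebesgue_rV R n)%E.-integrable setT (EFin \o A) ->
    (leb \x lebesgue_rV R n)%E.-integrable setT (EFin \o B) ->
    \int[lebesgue_rV R n.+1]_u F u =
    \int[(leb \x lebesgue_rV R n)%E]_z A z + \int[(leb \x lebesgue_rV R n)%E]_z B z.
  move=> mF FE Ai Bi; rewrite -RintegralD// /Rintegral.
  rewrite (integral_image (mu := (leb \x lebesgue_rV R n)%E)
    (nu := lebesgue_rV R n.+1) (@measurable_cons_rV R n) (fun _ _ => erefl)).
  - by congr fine; apply: eq_integral => z _; rewrite FE.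
  - exact/measurable_EFinP.
  - rewrite (_ : _ \o _ = (EFin \o A) \+ (EFin \o B)); first exact: integrableD.
    by apply/funext => z /=; rewrite FE EFinD.
have mg := @measurable_gauss_rV n.+1; have md := measurable_dotpr x.
have Nss : (leb \x lebesgue_rV R n)%E.-integrable setT (EFin \o (fun z =>
    -1 * (sin (x0 * z.1) * gauss_fun z.1 * (sin (dotp z.2 x') * gauss_rV z.2)))).
  by rewrite /comp; under eq_fun do rewrite EFinM; exact: integrableZl.
split.
- rewrite (split_cons _ _ _ _ _ cc Nss).
  + rewrite RintegralZl// (Rintegral_prodM c1 cn) (Rintegral_prodM s1 sn).
    rewrite ihc ihs Rintegral_cos_gauss mulr0 mulr0 addr0 xx [_ ^+ n.+1]exprS.
    by rewrite [- (_ + _)]opprD mulrDl expRD; ring.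
  + by apply: measurable_funM => //; exact: measurable_cos_comp.
  + move=> [a v] /=; rewrite gauss_rV_cons dotp_cons_rV -/x0 -/x' [a * x0]mulrC cosD.
    by ring.
- rewrite (split_cons _ _ _ _ _ sc cs).
  + rewrite (Rintegral_prodM s1 cn) (Rintegral_prodM c1 sn) ihs Rintegral_sin_gauss.
    by rewrite mul0r mulr0 addr0.
  + by apply: measurable_funM => //; exact: measurable_sin_comp.
  + move=> [a v] /=; rewrite gauss_rV_cons dotp_cons_rV -/x0 -/x' [a * x0]mulrC sinD.
    by ring.
Qed.

End gaussian_rV.

(** * The Euclidean norm as an integral of 1 - cos<u,x> *)

Section distance_formula.
Variable R : realType.
Notation leb := (@lebesgue_measure R).
Implicit Types (t : R).

Lemma onem_expR_ge0 (b : R) : 0 <= b -> 0 <= 1 - expR (- b).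
Proof. by move=> b0; rewrite subr_ge0 -expR0 ler_expR oppr_le0. Qed.

Let pos : set R := `]0, +oo[%classic.

Lemma integral_setE_indic d (T : measurableType d) (mu : {measure set T -> \bar R})
    (A : set T) (f : T -> R) :
  (\int[mu]_(x in A) (f x)%:E = \int[mu]_x (\1_A x * f x)%:E)%E.
Proof.
rewrite integral_mkcond; apply: eq_integral => x _.
by rewrite patchE indicE; case: (x \in A); rewrite ?mul1r ?mul0r.
Qed.

Lemma ge0_integral_oy_dilate (c : R) (f : R -> R) : 0 < c ->
  measurable_fun (`]0%R, +oo[%classic : set R) f -> (forall t, 0 < t -> 0 <= f t) ->
  (\int[leb]_(t in `]0%R, +oo[) (f t)%:E =
   c%:E * \int[leb]_(t in `]0%R, +oo[) (f (c * t))%:E)%E.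
Proof.
move=> c0 mf f0; rewrite [LHS]integral_mkcond [in RHS]integral_mkcond.
rewrite (@ge0_integral_translate_dilate R c 0)//; last 2 first.
- apply/(measurable_restrictT _ _).1; first exact: measurable_itv.
  exact/measurable_EFinP.
- move=> x; rewrite patchE; case: ifPn => //; rewrite inE/= in_itv/= andbT => x0.
  by rewrite lee_fin f0.
congr (_ * _)%E; apply: eq_integral => x _; rewrite addr0 !patchE.
have -> // : (c * x \in `]0, +oo[%classic) = (x \in `]0, +oo[%classic).
by apply/idP/idP; rewrite !inE/= !in_itv/= !andbT pmulr_rgt0.
Qed.

Let measurable_onem_cos n (x : 'rV[R]_n) :
  measurable_fun setT (fun u => 1 - cos (dotp u x)).
Proof. by apply: measurable_funB => //; apply: measurable_cos_comp; exact: measurable_dotpr. Qed.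

Lemma onem_cos_ge0 (a : R) : 0 <= 1 - cos a.
Proof. by rewrite subr_ge0 cos_le1. Qed.

(** The dilation u = t^(-1/2) v reduces to the standard Gaussian, whose cosine
    transforms at 0 and at t^(-1/2) x are subtracted. *)
Lemma integral_onem_cos_gauss n (x : 'rV[R]_n) (t : R) : 0 < t ->
  (\int[lebesgue_rV R n]_u ((1 - cos (dotp u x)) * expR (- (t * dotp u u)))%:E =
   (Num.sqrt pi ^+ n * t `^ (- (n%:R / 2)) *
     (1 - expR (- (dotp x x / (4 * t)))))%:E)%E.
Proof.
move=> t0; pose c := t `^ (- 2^-1).
have c0 : 0 < c by rewrite powR_gt0.
have c2 : c ^+ 2 = t^-1.
  by rewrite /c -powR_mulrn ?powR_ge0// -powRrM mulNr mulVf// powR_inv1// ltW.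
rewrite (@ge0_integral_affine_rV R n c 0); last 3 first.
- by rewrite gt_eqF.
- apply/measurable_EFinP; apply: measurable_funM; first exact: measurable_onem_cos.
  apply: (measurableT_comp (@measurable_expR R)).
  apply: (measurableT_comp (@oppr_measurable R setT)).
  by apply: measurable_funM => //; apply: measurable_dotp; exact: measurable_id.
- by move=> u; rewrite lee_fin mulr_ge0 ?expR_ge0 ?onem_cos_ge0.
have cn : `|c| ^+ n = t `^ (- (n%:R / 2)).
  rewrite gtr0_norm// /c -powR_mulrn ?powR_ge0// -powRrM.
  by congr (_ `^ _); ring.
rewrite cn -[RHS]EFinM.
have -> : Num.sqrt pi ^+ n * t `^ (- (n%:R / 2)) * (1 - expR (- (dotp x x / (4 * t)))) =
  t `^ (- (n%:R / 2)) * (\int[lebesgue_rV R n]_u (cos (dotp u 0) * gauss_rV u) -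
    \int[lebesgue_rV R n]_u (cos (dotp u (c *: x)) * gauss_rV u)).
  have [-> _] := Rintegral_cos_sin_gauss_rV (0 : 'rV[R]_n).
  have [-> _] := Rintegral_cos_sin_gauss_rV (c *: x).
  rewrite dotp0l oppr0 mul0r expR0 dotpZl dotpZr.
  have -> : - (c * (c * dotp x x)) / 4 = - (dotp x x / (4 * t)).
    by rewrite mulrA -expr2 c2; field; rewrite gt_eqF.
  by ring.
have c1 := integrable_cos_gauss_rV (0 : 'rV[R]_n).
have cx := integrable_cos_gauss_rV (c *: x).
rewrite EFinM -RintegralB// /Rintegral fineK; last first.
  apply: integrable_fin_num => //; under eq_fun do rewrite EFinB.
  exact: integrableB.
congr (_ * _)%E; apply: eq_integral => u _; congr EFin.
rewrite addr0 dotp0r cos0 !dotpZl !dotpZr.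
have -> : t * (c * (c * dotp u u)) = t * c ^+ 2 * dotp u u by ring.
by rewrite c2 mulfV ?gt_eqF// mul1r /gauss_rV mul1r; ring.
Qed.

Let measurable_half_power (b : R) : measurable_fun (`]0%R, +oo[%classic : set R)
  (fun t : R => t `^ (- 2^-1) * (1 - expR (- (b / (4 * t))))).
Proof.
apply: (@eq_measurable_fun _ _ _ _ _
    (fun t : R => t `^ (- 2^-1) * (1 - expR (- (b / 4 * t `^ (-1)))))).
  move=> t; rewrite inE/= in_itv/= andbT => t0; rewrite powR_inv1 ?(ltW t0)//.
  by rewrite invfM mulrA.
apply: measurable_funTS; apply: measurable_funM; first exact: measurable_powR.
apply: measurable_funB => //; apply: (measurableT_comp (@measurable_expR R)).
apply: (measurableT_comp (@oppr_measurable R setT)).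
by apply: measurable_funM => //; exact: measurable_powR.
Qed.

Let half_power_ge0 (b t : R) : 0 <= b -> 0 < t ->
  0 <= t `^ (- 2^-1) * (1 - expR (- (b / (4 * t)))).
Proof.
move=> b0 t0; rewrite mulr_ge0 ?powR_ge0// onem_expR_ge0//.
by rewrite divr_ge0// mulr_ge0// ltW.
Qed.

(** The dilation t = r^2 t' reduces to r = 1. *)
Lemma integral_powRN2_onem_expR_dilate (r : R) : 0 <= r ->
  (\int[leb]_(t in `]0%R, +oo[)
     (t `^ (- 2^-1) * (1 - expR (- (r ^+ 2 / (4 * t)))))%:E = (Num.sqrt pi * r)%:E)%E.
Proof.
rewrite le_eqVlt => /predU1P[<-|r0].
  rewrite mulr0; apply: integral0_eq => t _.
  by rewrite expr0n mul0r oppr0 expR0 subrr mulr0.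
have r20 : 0 < r ^+ 2 by rewrite exprn_gt0.
have mf := measurable_half_power; have f0 := half_power_ge0.
rewrite (@ge0_integral_oy_dilate (r ^+ 2))//; last by move=> t; exact/f0/ltW.
rewrite [X in (_ * X)%E](_ : _ = ((r^-1)%:E * (Num.sqrt pi)%:E)%E).
  by rewrite -!EFinM; congr EFin; field; rewrite gt_eqF.
rewrite -integral_powRN2_onem_expR -ge0_integralZl//=; last 3 first.
- apply/measurable_EFinP; have := mf 1; apply: eq_measurable_fun => t _.
  by rewrite div1r.
- move=> t; rewrite in_itv/= andbT => t0; rewrite lee_fin.
  by have := f0 1 t ler01 t0; rewrite div1r.
- by rewrite lee_fin invr_ge0 ltW.
apply: eq_integral => t; rewrite inE/= in_itv/= andbT => t0; rewrite -EFinM; congr EFin.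
rewrite powRM ?sqr_ge0 ?(ltW t0)// powRN powR12_sqrt ?sqr_ge0// sqrtr_sqr gtr0_norm//.
rewrite -mulrA; congr (_ * (_ * (1 - expR (- _)))).
by field; rewrite !gt_eqF.
Qed.

Lemma measurable_enorm_exprVn n k : measurable_fun setT (fun u : 'rV[R]_n => enorm u ^- k).
Proof.
apply: (@eq_measurable_fun _ _ _ _ _ (fun u => enorm u `^ (- k%:R))).
  by move=> u _; rewrite powR_invn// enorm_ge0.
apply: (measurableT_comp (@measurable_powR R _)).
by apply: measurable_enorm; exact: measurable_id.
Qed.

Section subordination.
Variables (n : nat) (x : 'rV[R]_n).
Let a : R := n.+1%:R / 2.
Let I : \bar R := (\int[leb]_(t in `]0%R, +oo[) (t `^ (a - 1) * expR (- t))%:E)%E.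
Let w (u : 'rV[R]_n) : R := enorm u ^- n.+1.

Let I_ge0 : (0 <= I)%E.
Proof. by apply: integral_ge0 => t _; rewrite lee_fin mulr_ge0 ?powR_ge0 ?expR_ge0. Qed.

(** The substitution t' = t |u|^2 in the integral I, which is Gamma(a), turns
    |u|^-(n+1) into a mixture of the Gaussians exp(-t |u|^2). *)
Let subordinate (u : 'rV[R]_n) :
  (((1 - cos (dotp u x)) * w u)%:E * I =
   \int[leb]_(t in `]0%R, +oo[)
     (t `^ (a - 1) * ((1 - cos (dotp u x)) * expR (- (t * dotp u u))))%:E)%E.
Proof.
have [u0|u0] := eqVneq u 0.
  rewrite u0 !dotp0l cos0 subrr mul0r mul0e; apply/esym/integral0_eq => t _.
  by rewrite mul0r mulr0.
have D0 : 0 < dotp u u by rewrite lt_neqAle dotp_ge0 eq_sym dotp_eq0 u0.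
set D := dotp u u in D0 *.
have a0 : 0 < a by rewrite divr_gt0.
rewrite (@ge0_integral_oy_dilate D^-1); last 3 first.
- by rewrite invr_gt0.
- apply: measurable_funTS; apply: measurable_funM; first exact: measurable_powR.
  apply: measurable_funM => //; apply: (measurableT_comp (@measurable_expR R)).
  by apply: (measurableT_comp (@oppr_measurable R setT)); exact: mulrr_measurable.
- by move=> t t0; rewrite !mulr_ge0 ?powR_ge0 ?expR_ge0 ?onem_cos_ge0.
rewrite (@eq_integral _ _ _ _ _ (fun t : measurableTypeR R => ((1 - cos (dotp u x)) * D^-1 `^ (a - 1))%:E * (t `^ (a - 1) * expR (- t))%:E)%E); last first.
  move=> t; rewrite inE/= in_itv/= andbT => t0; rewrite -EFinM; congr EFin.
  rewrite powRM ?invr_ge0 ?(ltW t0) ?(ltW D0)// (mulrAC D^-1) mulVf ?gt_eqF// mul1r.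
  by ring.
rewrite ge0_integralZl//=; last 3 first.
- apply/measurable_EFinP; apply: measurable_funTS; apply: measurable_funM; first exact: measurable_powR.
  by apply: (measurableT_comp (@measurable_expR R)); exact: oppr_measurable.
- by move=> t _; rewrite lee_fin mulr_ge0 ?powR_ge0 ?expR_ge0.
- by rewrite lee_fin mulr_ge0 ?powR_ge0 ?onem_cos_ge0.
rewrite muleA -EFinM; congr (_%:E * _)%E.
rewrite mulrCA; congr (_ * _).
rewrite mulr_powRB1 ?invr_ge0 ?(ltW D0)// /w /a /enorm -/D.
rewrite [_ / 2]mulrC powRrM powR12_sqrt ?invr_ge0 ?(ltW D0)//.
by rewrite powR_mulrn ?sqrtr_ge0// sqrtrV ?(ltW D0)// exprVn.
Qed.

(** Tonelli: the integral over u is Gaussian for fixed t, and the remaining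
    integral over t is [integral_powRN2_onem_expR_dilate].  Working with extended
    reals avoids proving finiteness of either factor beforehand. *)
Let onem_cos_weight_integral :
  ((\int[lebesgue_rV R n]_u ((1 - cos (dotp u x)) * w u)%:E) * I =
   (Num.sqrt pi ^+ n.+1 * enorm x)%:E)%E.
Proof.
have ma : measurable_fun setT (fun t : R => \1_(`]0%R, +oo[%classic : set R) t * t `^ (a - 1)).
  by apply: measurable_funM; [apply: measurable_indic|exact: measurable_powR].
pose H (z : 'rV[R]_n * measurableTypeR R) : \bar R :=
  ((\1_(`]0%R, +oo[%classic : set R) z.2 * z.2 `^ (a - 1)) *
   ((1 - cos (dotp z.1 x)) * expR (- (z.2 * dotp z.1 z.1))))%:E.
have mH : measurable_fun setT H.
  apply/measurable_EFinP; apply: measurable_funM.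
    exact: (measurableT_comp ma measurable_snd).
  apply: measurable_funM.
    exact: (measurableT_comp (measurable_onem_cos x) measurable_fst).
  apply: (measurableT_comp (@measurable_expR R)).
  apply: (measurableT_comp (@oppr_measurable R setT)).
  by apply: measurable_funM => //; apply: measurable_dotp.
have H0 z : (0 <= H z)%E.
  by rewrite lee_fin !mulr_ge0 ?powR_ge0 ?expR_ge0 ?onem_cos_ge0.
rewrite -ge0_integralZr//=; last 2 first.
- apply/measurable_EFinP; apply: measurable_funM; first exact: measurable_onem_cos.
  exact: measurable_enorm_exprVn.
- by move=> u _; rewrite lee_fin mulr_ge0 ?onem_cos_ge0// invr_ge0 exprn_ge0 ?enorm_ge0.
transitivity (\int[lebesgue_rV R n]_u \int[leb]_t H (u, t))%E.
  apply: eq_integral => u _; rewrite subordinate integral_setE_indic.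
  by apply: eq_integral => t _; rewrite /H/= mulrA.
rewrite (fubini_tonelli H mH H0).
transitivity (\int[leb]_(t in `]0%R, +oo[) ((Num.sqrt pi ^+ n)%:E *
   (t `^ (- 2^-1) * (1 - expR (- (enorm x ^+ 2 / (4 * t)))))%:E))%E.
  rewrite [RHS]integral_mkcond; apply: eq_integral => t _; rewrite patchE.
  case: ifPn => tp; last first.
    by apply: integral0_eq => u _; rewrite /H/= indicE (negbTE tp) !mul0r.
  have t0 : 0 < t by move: tp; rewrite inE/= in_itv/= andbT.
  rewrite /H/= indicE tp mul1r; under eq_integral do rewrite EFinM.
  rewrite ge0_integralZl//=; last 2 first.
  - apply/measurable_EFinP; apply: measurable_funM; first exact: measurable_onem_cos.
    apply: (measurableT_comp (@measurable_expR R)).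
    apply: (measurableT_comp (@oppr_measurable R setT)).
    by apply: measurable_funM => //; apply: measurable_dotp; exact: measurable_id.
  - by rewrite lee_fin powR_ge0.
  rewrite integral_onem_cos_gauss// -!EFinM; congr EFin; rewrite sqr_enorm.
  rewrite -mulrA mulrCA; congr (_ * _); rewrite mulrA; congr (_ * _).
  rewrite -powRD ?(gt_eqF t0) ?implybT//; congr (_ `^ _).
  by rewrite /a -natr1; field.
rewrite ge0_integralZl//=; last 2 first.
- by apply/measurable_EFinP; exact (measurable_half_power (enorm x ^+ 2)).
- move=> t; rewrite in_itv/= andbT => t0; rewrite lee_fin half_power_ge0//.
  by rewrite exprn_ge0 ?enorm_ge0.
rewrite integral_powRN2_onem_expR_dilate ?enorm_ge0// -EFinM exprS.
by congr EFin; ring.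
Qed.

(** For x != 0 the product of the singular integral with the Gamma integral is
    positive and finite, so both factors are. *)
Lemma onem_cos_weight_integral_Gamma : x != 0 -> 0 < Gamma a /\
  ((\int[lebesgue_rV R n]_u ((1 - cos (dotp u x)) * enorm u ^- n.+1)%:E) * (Gamma a)%:E =
   (Num.sqrt pi ^+ n.+1 * enorm x)%:E)%E.
Proof.
move=> x0; suff [IE G0] : I = (Gamma a)%:E /\ 0 < Gamma a.
  by split=> //; rewrite -IE onem_cos_weight_integral.
have E := onem_cos_weight_integral.
have x_gt0 : 0 < enorm x by rewrite sqrtr_gt0 lt_neqAle dotp_ge0 eq_sym dotp_eq0 x0.
have A0 : (0 <= \int[lebesgue_rV R n]_u ((1 - cos (dotp u x)) * w u)%:E)%E.
  apply: integral_ge0 => u _.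
  by rewrite lee_fin mulr_ge0 ?onem_cos_ge0// invr_ge0 exprn_ge0 ?enorm_ge0.
have pos0 : 0 < Num.sqrt pi ^+ n.+1 * enorm x :> R.
  by rewrite mulr_gt0// exprn_gt0// sqrtr_gt0 pi_gt0.
move: E A0 I_ge0; rewrite -[Gamma a]/(fine I).
case: I => [g| |] //=; last first.
  case: (\int[_]_u _)%E => [b| |] //.
  - move=> + b0 _; rewrite le_eqVlt in b0; case/predU1P: b0 => [<-|b0].
      by rewrite mul0e => -[] /esym/eqP; rewrite gt_eqF.
    by rewrite gt0_muley// lte_fin.
case: (\int[_]_u _)%E => [b| |] //; last first.
  move=> + _ g0; rewrite le_eqVlt in g0; case/predU1P: g0 => [<-|g0].
    by rewrite mule0 => -[] /esym/eqP; rewrite gt_eqF.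
  by rewrite gt0_mulye// lte_fin.
rewrite !lee_fin -EFinM => -[E] b0 g0; split=> //.
by rewrite lt_neqAle g0 andbT; apply/eqP => g00; move: pos0; rewrite -E -g00 mulr0 ltxx.
Qed.

End subordination.

Lemma Gamma_half_gt0 n : (0 < n)%N -> 0 < Gamma (n.+1%:R / 2 : R).
Proof.
case: n => // n _.
have x0 : (const_mx 1 : 'rV[R]_n.+1) != 0.
  by apply/eqP => /rowP/(_ ord0); rewrite !mxE; exact/eqP/oner_neq0.
by have [] := onem_cos_weight_integral_Gamma x0.
Qed.

Lemma c_gt0 n : (0 < n)%N -> 0 < c_ R n.
Proof. by move=> n0; rewrite divr_gt0 ?Gamma_half_gt0// powR_gt0// pi_gt0. Qed.

(** Dividing [onem_cos_weight_integral_Gamma] by the value of Gamma leaves the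
    constant c_n. *)
Lemma enorm_integral_onem_cos n (x : 'rV[R]_n) : (0 < n)%N ->
  (\int[lebesgue_rV R n]_u
     ((1 - cos (dotp u x)) * ((c_ R n)^-1 * enorm u ^- n.+1))%:E = (enorm x)%:E)%E.
Proof.
move=> n0; have [->|x0] := eqVneq x 0.
  rewrite enorm0; apply: integral0_eq => u _.
  by rewrite dotp0r cos0 subrr mul0r.
have [G0 E] := onem_cos_weight_integral_Gamma x0.
have cE : c_ R n = Num.sqrt pi ^+ n.+1 / Gamma (n.+1%:R / 2 : R).
  rewrite /c_ [_ / 2]mulrC powRrM powR12_sqrt ?pi_ge0// powR_mulrn ?sqrtr_ge0//.
have c0 := c_gt0 n0.
under eq_integral do rewrite mulrCA EFinM.
rewrite ge0_integralZl//=; last 3 first.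
- apply/measurable_EFinP; apply: measurable_funM; first exact: measurable_onem_cos.
  exact: measurable_enorm_exprVn.
- by move=> u _; rewrite lee_fin mulr_ge0 ?onem_cos_ge0// invr_ge0 exprn_ge0 ?enorm_ge0.
- by rewrite lee_fin invr_ge0 ltW.
move: E; case: (\int[_]_u _)%E => [b| |] //=; last 2 first.
- by rewrite gt0_mulye ?lte_fin.
- by rewrite gt0_mulNye ?lte_fin.
rewrite -!EFinM => -[E]; congr EFin; rewrite cE.
have s0 : Num.sqrt pi ^+ n.+1 != 0 :> R by rewrite expf_neq0// gt_eqF// sqrtr_gt0 pi_gt0.
by rewrite invf_div mulrAC [Gamma _ * _]mulrC E mulrAC mulfV// mul1r.
Qed.

End distance_formula.

(** * Orthonormal bases and Parseval's identity *)

Section hilbert_geometry.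
Variables (R : realType) (H : hilbert R).
Implicit Types f g h : H.

Lemma hdotDl f g h : hdot (f + g) h = hdot f h + hdot g h.
Proof. by have := hdot_linear 1 f g h; rewrite scale1r mul1r. Qed.

Lemma hdot0l h : hdot 0 h = 0.
Proof. by have := hdotDl 0 0 h; rewrite addr0 => /eqP; rewrite -subr_eq0 opprD addNKr oppr_eq0 => /eqP. Qed.

Lemma hdotZl a f h : hdot (a *: f) h = a * hdot f h.
Proof. by have := hdot_linear a f 0 h; rewrite addr0 hdot0l addr0. Qed.

Lemma hdotNl f h : hdot (- f) h = - hdot f h.
Proof. by rewrite -scaleN1r hdotZl mulN1r. Qed.

Lemma hdotBl f g h : hdot (f - g) h = hdot f h - hdot g h.
Proof. by rewrite hdotDl hdotNl. Qed.

Lemma hdot0r h : hdot h 0 = 0. Proof. by rewrite hdotC hdot0l. Qed.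

Lemma hdotZr a f h : hdot f (a *: h) = a * hdot f h.
Proof. by rewrite hdotC hdotZl hdotC. Qed.

Lemma hdotBr f g h : hdot h (f - g) = hdot h f - hdot h g.
Proof. by rewrite hdotC hdotBl !(hdotC h). Qed.

Lemma hdot_suml I (r : seq I) (F : I -> H) h :
  hdot (\sum_(i <- r) F i) h = \sum_(i <- r) hdot (F i) h.
Proof.
elim: r => [|i r ih]; first by rewrite !big_nil hdot0l.
by rewrite !big_cons hdotDl ih.
Qed.

Lemma hdot_ge0 f : 0 <= hdot f f.
Proof. by rewrite hdot_norm sqr_ge0. Qed.

Lemma hdot_eq0 f : hdot f f = 0 -> f = 0.
Proof. by rewrite hdot_norm => /eqP; rewrite expf_eq0/= normr_eq0 => /eqP. Qed.

Lemma hdot_cauchy_schwarz f g : `|hdot f g| <= `|f| * `|g|.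
Proof.
have [->|g0] := eqVneq g 0; first by rewrite hdot0r normr0 mulr_ge0.
have n0 : 0 < `|g| by rewrite normr_gt0.
rewrite -ler_sqr ?nnegrE ?mulr_ge0// exprMn -!hdot_norm real_normK ?num_real//.
have G0 : 0 < hdot g g by rewrite hdot_norm exprn_gt0.
have := hdot_ge0 (hdot g g *: f - hdot f g *: g).
rewrite hdotBl !hdotBr !hdotZl !hdotZr (hdotC g f).
set a := hdot f f; set b := hdot f g; set c := hdot g g in G0 *.
move=> h; rewrite -subr_ge0 -(pmulr_rge0 _ G0); apply: le_trans h _.
by rewrite le_eqVlt; apply/orP; left; apply/eqP; ring.
Qed.

Section finite_orthogonal_family.
Variables (I : eqType) (e : I -> H).
(** Zero vectors are allowed among the orthonormal ones, so that a countable
    family, even a finite one, can be indexed by nat. *)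
Hypothesis ortho : forall i j, i != j -> hdot (e i) (e j) = 0.
Hypothesis unit_or_zero : forall i f, hdot f (e i) * hdot (e i) (e i) = hdot f (e i).

Let S (r : seq I) f : H := \sum_(i <- r) hdot f (e i) *: e i.

Lemma hdot_partial_expansion (r : seq I) f g :
  hdot (S r f) g = \sum_(i <- r) hdot f (e i) * hdot g (e i).
Proof. by rewrite hdot_suml; apply: eq_bigr => i _; rewrite hdotZl (hdotC _ g). Qed.

Lemma hdot_partial_expansion_coef (r : seq I) f j : uniq r ->
  hdot (S r f) (e j) = (j \in r)%:R * hdot f (e j).
Proof.
move=> ur; rewrite hdot_suml; have [jr|jr] := boolP (j \in r).
  rewrite (bigD1_seq j)//= big1 ?addr0; last by move=> i ij; rewrite hdotZl ortho// mulr0.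
  by rewrite hdotZl unit_or_zero mul1r.
rewrite mul0r big_seq big1// => i ir; rewrite hdotZl ortho ?mulr0//.
by apply: contraNneq jr => <-.
Qed.

Lemma hdot_partial_expansion2 (r : seq I) f : uniq r ->
  hdot (S r f) (S r f) = \sum_(i <- r) (hdot f (e i)) ^+ 2.
Proof.
move=> ur; rewrite hdot_partial_expansion !big_seq; apply: eq_bigr => i ir.
by rewrite hdot_partial_expansion_coef// ir mul1r expr2.
Qed.

(** The squared norm of f minus its partial expansion is nonnegative. *)
Lemma bessel (r : seq I) f : uniq r -> \sum_(i <- r) (hdot f (e i)) ^+ 2 <= hdot f f.
Proof.
move=> ur; have := hdot_ge0 (f - S r f).
rewrite hdotBl !hdotBr (hdotC f) hdot_partial_expansion2// hdot_partial_expansion.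
by under eq_bigr do rewrite -expr2; rewrite subrr subr0 subr_ge0.
Qed.

End finite_orthogonal_family.

Section orthonormal_sequence.
Variables (e : nat -> H).
Hypothesis ortho : forall i j, i != j -> hdot (e i) (e j) = 0.
Hypothesis unit_or_zero : forall i f, hdot f (e i) * hdot (e i) (e i) = hdot f (e i).
Hypothesis total : forall f, (forall i, hdot f (e i) = 0) -> f = 0.

Lemma le_normr_partial_parseval f g n :
  `|\sum_(0 <= i < n) hdot f (e i) * hdot g (e i)| <= `|f| * `|g|.
Proof.
rewrite -hdot_partial_expansion (le_trans (hdot_cauchy_schwarz _ _))// ler_wpM2r//.
rewrite -ler_sqr ?nnegrE// -!hdot_norm hdot_partial_expansion2// ?iota_uniq//.
exact: bessel (iota_uniq _ _).
Qed.

(** Bessel's inequality makes the partial sums Cauchy, and totality identifies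
    their limit, since the limit and f have the same coefficients. *)
Lemma expansion_cvg f : (\sum_(0 <= i < n) hdot f (e i) *: e i) @[n --> \oo] --> f.
Proof.
pose u i := hdot f (e i) *: e i.
have cv : cvgn (series (fun i => (hdot f (e i)) ^+ 2)).
  apply: nondecreasing_is_cvgn.
    by apply: nondecreasing_series => i _ _; exact: sqr_ge0.
  by exists (hdot f f) => _ [n _ <-]; exact: bessel (iota_uniq _ _).
have cu : cvgn (series u).
  apply: cauchy_cvg; apply/cauchy_seriesP => x x0.
  move/cvg_cauchy/cauchy_seriesP : cv => /(_ (x ^+ 2)).
  rewrite exprn_gt0// => /(_ isT); apply: filterS => -[m n] /=.
  rewrite ger0_norm ?sumr_ge0//; last by move=> i _; exact: sqr_ge0.
  by rewrite -hdot_partial_expansion2 ?iota_uniq// hdot_norm ltr_sqr ?nnegrE// ltW.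
suff fE : limn (series u) = f by rewrite -[X in _ --> X]fE.
apply/eqP; rewrite -subr_eq0; apply/eqP; apply: total => j.
have hc : hdot (series u n) (e j) @[n --> \oo] --> hdot (limn (series u)) (e j).
  apply/cvgrPdist_le => x x0.
  have x1 : 0 < x / (`|e j| + 1) by rewrite divr_gt0// ltr_wpDl.
  move/cvgrPdist_le : cu => /(_ _ x1); apply: filterS => n hn.
  rewrite -hdotBl (le_trans (hdot_cauchy_schwarz _ _))//.
  rewrite (le_trans (ler_wpM2r _ hn))// -mulrA ler_piMr ?(ltW x0)//.
  by rewrite ler_pdivrMl ?ltr_wpDl// mulr1 lerDl.
have hc' : hdot (series u n) (e j) @[n --> \oo] --> hdot f (e j).
  apply: cvg_near_cst; near=> n.
  rewrite hdot_partial_expansion_coef ?iota_uniq// mem_index_iota/=.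
  have -> : (j < n)%N by near: n; exact: nbhs_infty_gt.
  by rewrite mul1r.
by rewrite hdotBl (cvg_unique (@Rhausdorff R) hc hc') subrr.
Unshelve. all: end_near. Qed.

Lemma parseval f g :
  (\sum_(0 <= i < n) hdot f (e i) * hdot g (e i)) @[n --> \oo] --> hdot f g.
Proof.
under eq_fun do rewrite -hdot_partial_expansion.
apply/cvgrPdist_le => x x0.
have x1 : 0 < x / (`|g| + 1) by rewrite divr_gt0// ltr_wpDl.
have := @expansion_cvg f; move/cvgrPdist_le => /(_ _ x1); apply: filterS => n hn.
rewrite -hdotBl (le_trans (hdot_cauchy_schwarz _ _))//.
rewrite (le_trans (ler_wpM2r _ hn))// -mulrA ler_piMr ?(ltW x0)//.
by rewrite ler_pdivrMl ?ltr_wpDl// mulr1 lerDl.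
Qed.

End orthonormal_sequence.

(** A nonzero vector orthogonal to a maximal orthonormal set would, once
    normalized, enlarge it; Zorn's lemma provides the maximal set. *)
Lemma orthonormal_basis_exists : exists B : set H, orthonormal_basis B.
Proof.
pose P (B : set H) := (forall e, B e -> hdot e e = 1) /\
  (forall e e', B e -> B e' -> e <> e' -> hdot e e' = 0).
have [F FP tF|B [[B1 B0] maxB]] := @Zorn_bigcup H P.
  split=> [e [X FX Xe]|e e' [X FX Xe] [Y FY Ye']]; first by have [+ _] := FP _ FX; apply.
  have [XY|YX] := tF _ _ FX FY.
    by have [_] := FP _ FY; apply => //; exact: XY.
  by have [_] := FP _ FX; apply => //; exact: YX.
exists B; split => // f fB; apply/eqP/negPn/negP => f0.
have nf : `|f| != 0 by rewrite normr_eq0.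
pose e0 := `|f|^-1 *: f.
have e01 : hdot e0 e0 = 1 by rewrite hdotZl hdotZr hdot_norm; field.
have e0B e : B e -> hdot e0 e = 0 by move=> Be; rewrite hdotZl fB// mulr0.
apply: (maxB (B `|` [set e0])).
  split; first by left.
  move=> /(_ e0 (or_intror erefl)) /e0B; rewrite e01 => /eqP.
  by rewrite oner_eq0.
split=> [e [/B1//|->//]|e e' [Be|->] [Be'|->]] ee' //.
- exact: B0.
- by rewrite hdotC e0B.
- exact: e0B.
Qed.

Lemma orthonormal_basis_get : orthonormal_basis (get (@orthonormal_basis R H)).
Proof. by have [B BB] := orthonormal_basis_exists; exact: getI BB. Qed.

(** Each vector of a total sequence has, by Bessel, only countably many nonzero
    coefficients on an orthonormal family. *)
Lemma countable_orthonormal_basis (B : set H) (s : nat -> H) : orthonormal_basis B ->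
  (forall f, (forall k, hdot f (s k) = 0) -> f = 0) -> countable B.
Proof.
move=> [B1 B0 _] total.
pose C k m := B `&` [set e | m.+1%:R^-1 < (hdot (s k) e) ^+ 2].
have finC k m : finite_set (C k m).
  apply: contrapT => infC.
  (* N basis vectors with squared coefficients above 1/(m+1) would add up to
     more than the squared norm of s k. *)
  pose N := (Num.truncn (hdot (s k) (s k) * m.+1%:R)).+1.
  have [F FC NF] := @infinite_set_fset _ _ N infC.
  pose e h : H := if h \in B then h else 0.
  have eE h : h \in F -> e h = h by move=> hF; rewrite /e; case: ifPn => // /negP[]; rewrite inE; have [] := FC h hF.
  have ortho h h' : h != h' -> hdot (e h) (e h') = 0.
    rewrite /e; case: ifPn => [|_]; last by rewrite hdot0l.
    case: ifPn => [|_]; last by rewrite hdot0r.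
    by rewrite !inE => Bh' Bh /eqP; exact: B0.
  have unit h f : hdot f (e h) * hdot (e h) (e h) = hdot f (e h).
    rewrite /e; case: ifPn => [|_]; last by rewrite !hdot0r mul0r.
    by rewrite inE => /B1 ->; rewrite mulr1.
  have bF := bessel ortho unit (s k) (fset_uniq F).
  have : N%:R * m.+1%:R^-1 <= \sum_(h <- enum_fset F) (hdot (s k) (e h)) ^+ 2.
    apply: (@le_trans _ _ (\sum_(h <- enum_fset F) m.+1%:R^-1)).
      rewrite big_const_seq count_predT iter_addr addr0 -[leRHS]mulr_natl.
      by rewrite ler_wpM2r ?invr_ge0// ler_nat.
    by rewrite big_seq [leRHS]big_seq ler_sum// => h hF; rewrite eE// ltW//; have [] := FC h hF.
  move=> /le_trans/(_ bF); rewrite ler_pdivrMr//; apply/negP; rewrite -ltNge.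
  have /truncn_itv/andP[_ //] : 0 <= hdot (s k) (s k) * m.+1%:R.
  by rewrite mulr_ge0// hdot_ge0.
have -> : B = \bigcup_k \bigcup_m C k m.
  apply/seteqP; split=> [e Be|e [k _ [m _ []]]//].
  have e0 : e != 0.
    by apply/eqP => e0; have := B1 e Be; rewrite e0 hdot0l => /eqP; rewrite eq_sym oner_eq0.
  have [k hk] : exists k, hdot (s k) e != 0.
    apply: contrapT => hn; move/eqP: e0; apply; apply: total => k.
    by apply/eqP/negPn/negP => hk; apply: hn; exists k; rewrite hdotC.
  have h2 : 0 < (hdot (s k) e) ^+ 2 by rewrite lt_neqAle sqr_ge0 eq_sym sqrf_eq0 hk.
  have [m _ /(_ m (leqnn m))/= hm] := near_infty_natSinv_lt (PosNum h2).
  by exists k => //; exists m.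
apply: bigcup_countable => // k _; apply: bigcup_countable => // m _.
exact: finite_set_countable.
Qed.

(** The basis may be finite, so its enumeration takes the value 0 at the indices
    not used; the last clause transports sums over the basis. *)
Lemma orthonormal_basis_sequence (B : set H) : orthonormal_basis B -> countable B ->
  exists e : nat -> H,
  [/\ forall i j, i != j -> hdot (e i) (e j) = 0,
      forall i f, hdot f (e i) * hdot (e i) (e i) = hdot f (e i),
      forall f, (forall i, hdot f (e i) = 0) -> f = 0 &
      forall F : H -> \bar R, (forall f, 0 <= F f)%E -> F 0 = 0%E ->
        (\esum_(f in B) F f = \sum_(i <oo) F (e i))%E].
Proof.
move=> [B1 B0 BT] /countable_injP[j jinj].
pose e n := if pselect (exists2 b, B b & j b = n) is left p then s2val (cid2 p) else 0.
have eB b : B b -> e (j b) = b.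
  move=> Bb; rewrite /e; case: pselect => [p|]; last by case; exists b.
  by case: cid2 => b' /= Bb' jb; apply: jinj => //; rewrite inE.
have eP n : e n = 0 \/ (B (e n) /\ j (e n) = n).
  rewrite /e; case: pselect => [p|]; last by left.
  by right; case: cid2.
exists e; split.
- move=> i k ik; case: (eP i) => [->|[Bi ji]]; first by rewrite hdot0l.
  case: (eP k) => [->|[Bk jk]]; first by rewrite hdot0r.
  by apply: B0 => // ek; move/eqP: ik; apply; rewrite -ji -jk ek.
- move=> i f; case: (eP i) => [->|[Bi ji]]; first by rewrite hdot0r mul0r.
  by rewrite B1// mulr1.
- by move=> f fe; apply: BT => b Bb; rewrite -(eB b Bb).
- move=> F F0 F00; rewrite nneseries_esumT//.
  rewrite (@reindex_esum _ _ _ (j @` B) B e); last first.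
    split.
    + by move=> _ [b Bb <-]; rewrite eB.
    + move=> _ _ /set_mem[b Bb <-] /set_mem[b' Bb' <-].
      by rewrite !eB// => ->.
    + by move=> b Bb; exists (j b); [exists b|rewrite eB].
  rewrite esum_mkcond; apply: eq_esum => i _; case: ifPn => // /negP iB.
  case: (eP i) => [->//|[Bi ji]]; exfalso; apply: iB; rewrite inE.
  by exists (e i).
Qed.

End hilbert_geometry.

(** * Semidirect product of a measure and a kernel *)

Section semidirect_product.
Context d1 d2 (A : measurableType d1) (B : measurableType d2) (R : realType).

Definition pair_left (a : A) (b : B) : A * B := (a, b).

Lemma measurable_pair_left a : measurable_fun setT (pair_left a).
Proof. exact: measurable_pair1. Qed.

HB.instance Definition _ a :=
  isMeasurableFun.Build _ _ _ _ (pair_left a) (measurable_pair_left a).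

Variable k : R.-pker A ~> B.

Definition graph_measure (a : A) : set (A * B) -> \bar R :=
  pushforward (k a) (pair_left a).

Let graph_measure0 a : graph_measure a set0 = 0%E.
Proof. exact: (measure0 (pushforward (k a) (pair_left a))). Qed.

Let graph_measure_ge0 a U : (0 <= graph_measure a U)%E.
Proof. exact: (measure_ge0 (pushforward (k a) (pair_left a))). Qed.

Let graph_measure_sigma_additive a : semi_sigma_additive (graph_measure a).
Proof. exact: (measure_semi_sigma_additive (s := pushforward (k a) (pair_left a))). Qed.

HB.instance Definition _ a := isMeasure.Build _ _ _ (graph_measure a)
  (graph_measure0 a) (graph_measure_ge0 a) (@graph_measure_sigma_additive a).

(** The dummy argument in unit allows the composition of kernels to integrate
    over a. *)
Definition graph_kernel (ua : unit * A) : {measure set (A * B) -> \bar R} :=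
  graph_measure ua.2.

Let measurable_graph_kernel U : measurable U -> measurable_fun setT (graph_kernel ^~ U).
Proof.
move=> mU; have m : measurable_fun setT (fun a => k a (xsection U a)).
  by apply: measurable_fun_xsection_finite_kernel; rewrite inE.
have := measurableT_comp m (@measurable_snd _ _ (unit : measurableType _) A).
apply: eq_measurable_fun => -[u a] _ /=.
by rewrite /graph_kernel/= /graph_measure /pushforward; congr (k a _); apply/seteqP; split => b /=;
  rewrite /xsection/= inE.
Qed.

HB.instance Definition _ := isKernel.Build _ _ _ _ _ graph_kernel measurable_graph_kernel.

Let graph_kernel_prob ua : graph_kernel ua setT = 1%E.
Proof. by rewrite /graph_kernel/= /graph_measure /pushforward preimage_setT prob_kernel. Qed.

HB.instance Definition _ :=
  Kernel_isProbability.Build _ _ _ _ _ graph_kernel graph_kernel_prob.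

Variable mu : probability A R.

Let base : R.-pker unit ~> A := kprobability (measurable_cst (mu : pprobability A R)).

(** The measure mu (x) k of the disintegration theorem, obtained by composing
    the constant kernel mu with the graph kernel. *)
Definition semidirect : set (A * B) -> \bar R := mkcomp base graph_kernel tt.

HB.instance Definition _ := Measure.on semidirect.

Lemma ge0_integral_semidirect (f : A * B -> \bar R) :
  measurable_fun setT f -> (forall ab, 0 <= f ab)%E ->
  (\int[semidirect]_ab f ab = \int[mu]_a \int[k a]_b f (a, b))%E.
Proof.
move=> mf f0; rewrite (integral_kcomp base graph_kernel tt f0 mf).
apply: eq_integral => a _.
exact: (ge0_integral_image (nu := graph_measure a) (@measurable_pair_left a)).
Qed.

Let semidirect_setT : semidirect setT = 1%E.
Proof.
have := @ge0_integral_semidirect (cst 1%E) (measurable_cst _) (fun _ => lee01).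
rewrite integral_cst// mul1e => ->.
under eq_integral do rewrite integral_cst// prob_kernel mule1.
by rewrite integral_cst// mul1e; exact: probability_setT.
Qed.

HB.instance Definition _ :=
  Measure_isProbability.Build _ _ _ semidirect semidirect_setT.

Lemma semidirect_rect (S : set A) (T : set B) : measurable S -> measurable T ->
  semidirect (S `*` T) = (\int[mu]_(a in S) k a T)%E.
Proof.
move=> mS mT; transitivity (\int[mu]_a graph_measure a (S `*` T))%E; first by [].
rewrite [RHS]integral_mkcond; apply: eq_integral => a _.
rewrite /graph_measure /pushforward patchE; case: ifPn => [|aS].
  rewrite inE => aS; congr (k a _); apply/seteqP; split => b //=.
  by case.
rewrite (_ : _ @^-1` _ = set0) ?measure0// -subset0 => b [/= Sa _].
by move/negP : aS; apply; rewrite inE.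
Qed.

Lemma integrable_semidirectP (f : A * B -> \bar R) : measurable_fun setT f ->
  semidirect.-integrable setT f <-> (\int[mu]_a \int[k a]_b `|f (a, b)| < +oo)%E.
Proof.
move=> mf; have E : (\int[semidirect]_ab `|f ab| = \int[mu]_a \int[k a]_b `|f (a, b)|)%E.
  by rewrite ge0_integral_semidirect//; exact: measurableT_comp.
by rewrite -E; split => [/integrableP[]//|?]; apply/integrableP.
Qed.

Lemma measurable_integral_kernel (f : A * B -> \bar R) : measurable_fun setT f ->
  (forall ab, 0 <= f ab)%E -> measurable_fun setT (fun a => \int[k a]_b f (a, b))%E.
Proof. by move=> mf f0; exact: (measurable_fun_integral_finite_kernel f k f0 mf). Qed.

Let integrable_part (f g : A * B -> \bar R) : semidirect.-integrable setT f ->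
  measurable_fun setT g -> (forall ab, 0 <= g ab)%E -> (forall ab, g ab <= `|f ab|)%E ->
  mu.-integrable setT (fun a => \int[k a]_b g (a, b))%E.
Proof.
move=> fi mg g0 gf; have mf := measurable_int _ fi.
apply/integrableP; split; first exact: measurable_integral_kernel.
apply: le_lt_trans ((integrable_semidirectP mf).1 fi).
apply: ge0_le_integral => //.
- by apply: measurableT_comp => //; exact: measurable_integral_kernel.
- apply: (@measurable_integral_kernel (abse \o f)) => [|ab].
    exact: measurableT_comp.
  exact: abse_ge0.
- move=> a _; rewrite gee0_abs ?integral_ge0//; apply: ge0_le_integral => //.
  + exact: measurableT_comp mg (measurable_pair1 _).
  + by apply: measurableT_comp => //; exact: measurableT_comp mf (measurable_pair1 _).
Qed.

Let integral_kernelE (f : A * B -> \bar R) a :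
  (\int[k a]_b f^\+ (a, b) - \int[k a]_b f^\- (a, b) = \int[k a]_b f (a, b))%E.
Proof.
rewrite [RHS]integralE.
by congr (_ - _)%E; apply: eq_integral => b _; rewrite ?funepos.unlock ?funeneg.unlock.
Qed.

Lemma measurable_integral_kernel_signed (f : A * B -> \bar R) : measurable_fun setT f ->
  measurable_fun setT (fun a => \int[k a]_b f (a, b))%E.
Proof.
move=> mf; under eq_fun do rewrite -integral_kernelE.
by apply: emeasurable_funB; apply: measurable_integral_kernel => //;
  [exact: measurable_funepos|exact: measurable_funeneg].
Qed.

Let integrable_pos f : semidirect.-integrable setT f ->
  mu.-integrable setT (fun a => \int[k a]_b f^\+ (a, b))%E.
Proof.
move=> fi; have mf := measurable_int _ fi.
apply: (integrable_part fi) => [||ab]; [exact: measurable_funepos|by []|].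
by rewrite -[leRHS]/((abse \o f) ab) fune_abse leeDl.
Qed.

Let integrable_neg f : semidirect.-integrable setT f ->
  mu.-integrable setT (fun a => \int[k a]_b f^\- (a, b))%E.
Proof.
move=> fi; have mf := measurable_int _ fi.
apply: (integrable_part fi) => [||ab]; [exact: measurable_funeneg|by []|].
by rewrite -[leRHS]/((abse \o f) ab) fune_abse leeDr.
Qed.

Lemma integrable_integral_kernel (f : A * B -> \bar R) : semidirect.-integrable setT f ->
  mu.-integrable setT (fun a => \int[k a]_b f (a, b))%E.
Proof.
move=> fi; under eq_fun do rewrite -integral_kernelE.
by apply: integrableB => //; [exact: integrable_pos|exact: integrable_neg].
Qed.

(** The positive and negative parts are integrated separately; their iterated
    integrals are finite, so that they can be subtracted under the outer integral. *)
Lemma integral_semidirect (f : A * B -> \bar R) : semidirect.-integrable setT f ->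
  (\int[semidirect]_ab f ab = \int[mu]_a \int[k a]_b f (a, b))%E.
Proof.
move=> fi; have mf := measurable_int _ fi.
rewrite [LHS]integralE.
rewrite !ge0_integral_semidirect//; [|exact: measurable_funeneg|exact: measurable_funepos].
rewrite -integralB//; [|exact: integrable_pos|exact: integrable_neg].
by apply: eq_integral => a _; rewrite integral_kernelE.
Qed.

Lemma ae_integrable_semidirect (f : A * B -> \bar R) : semidirect.-integrable setT f ->
  {ae mu, forall a, (k a).-integrable setT (fun b => f (a, b))}.
Proof.
move=> fi; have mf := measurable_int _ fi.
have i : mu.-integrable setT (fun a => \int[k a]_b `|f (a, b)|)%E.
  apply/integrableP; split.
    apply: (@measurable_integral_kernel (abse \o f)) => [|ab].
      exact: measurableT_comp.
    exact: abse_ge0.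
  apply: le_lt_trans ((integrable_semidirectP mf).1 fi).
  by under eq_integral do rewrite gee0_abs ?integral_ge0//.
have := integrable_ae measurableT i; apply: filterS => a /(_ Logic.I) fa.
apply/integrableP; split; first exact: measurableT_comp mf (measurable_pair1 _).
by rewrite ltey_eq fa.
Qed.

End semidirect_product.

Section kernel_precomposition.
Context d1 d2 d3 (A : measurableType d1) (B : measurableType d2) (C : measurableType d3).
Variables (R : realType) (k : R.-pker A ~> B).

Definition kernel_fst (ac : A * C) : {measure set B -> \bar R} := k ac.1.

Let measurable_kernel_fst U : measurable U -> measurable_fun setT (kernel_fst ^~ U).
Proof. by move=> mU; exact: (measurableT_comp (measurable_kernel k U mU) measurable_fst). Qed.

HB.instance Definition _ := isKernel.Build _ _ _ _ _ kernel_fst measurable_kernel_fst.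

Let kernel_fst_prob ac : kernel_fst ac setT = 1%E.
Proof. exact: prob_kernel. Qed.

HB.instance Definition _ :=
  Kernel_isProbability.Build _ _ _ _ _ kernel_fst kernel_fst_prob.

End kernel_precomposition.
Arguments kernel_fst {d1 d2 d3 A B} C {R} k.

Lemma integral_kernel_cst d1 d2 (A : measurableType d1) (B : measurableType d2)
  (R : realType) (k : R.-pker A ~> B) a (c : \bar R) : (\int[k a]_b c = c)%E.
Proof. by rewrite (integral_cst (k a) measurableT c) prob_kernel mule1. Qed.

(** * Hilbert-Schmidt norm of an integral of rank-one operators *)

Lemma sqr_poweR12 (R : realType) (x : \bar R) : (0 <= x -> (x `^ 2^-1) ^+ 2 = x)%E.
Proof.
case: x => [x| |] // x0; last by rewrite poweRyr ?invr_eq0// expe2 mulyy.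
rewrite poweR_EFin powR12_sqrt ?expe2; last by rewrite -lee_fin.
by rewrite -EFinM -expr2 sqr_sqrtr.
Qed.

Section hilbert_schmidt_core.
Context dW (W : measurableType dW) (R : realType) (Q : probability W R).
Variables (H K : hilbert R) (a : W -> H) (b : W -> K) (Sigma : {linear H -> K}).
Hypothesis ma : forall f, measurable_fun setT (fun w => hdot f (a w)).
Hypothesis mb : forall g, measurable_fun setT (fun w => hdot g (b w)).
Hypothesis maa : measurable_fun setT (fun ww : W * W => hdot (a ww.1) (a ww.2)).
Hypothesis mbb : measurable_fun setT (fun ww : W * W => hdot (b ww.1) (b ww.2)).
Hypothesis iab : Q.-integrable setT (EFin \o (fun w => `|a w| * `|b w|)).
Hypothesis SigmaE : forall f g,
  hdot g (Sigma f) = \int[Q]_w (hdot f (a w) * hdot g (b w)).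

Let iabab : (Q \x Q)%E.-integrable setT
  (EFin \o (fun ww => (`|a ww.1| * `|b ww.1|) * (`|a ww.2| * `|b ww.2|))).
Proof. exact: (integrable_prodM iab iab). Qed.

Let term f (ww : W * W) := hdot f (a ww.1) * hdot f (a ww.2) * hdot (b ww.1) (b ww.2).

Let measurable_term f : measurable_fun setT (term f).
Proof.
apply: measurable_funM => //; apply: measurable_funM.
  exact: (measurableT_comp (ma f) measurable_fst).
exact: (measurableT_comp (ma f) measurable_snd).
Qed.

Let normr_mul3 (x y z A B C : R) : `|x| <= A -> `|y| <= B -> `|z| <= C ->
  `|x * y * z| <= A * B * C.
Proof. by move=> xA yB zC; rewrite !normrM !ler_pM// mulr_ge0. Qed.

Let integrable_term f : (Q \x Q)%E.-integrable setT (EFin \o term f).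
Proof.
apply: (@integrable_le_dominated _ _ _ _ _
  (fun ww => (`|f| ^+ 2) * ((`|a ww.1| * `|b ww.1|) * (`|a ww.2| * `|b ww.2|)))) => //.
  move=> ww; apply: le_trans (normr_mul3 (hdot_cauchy_schwarz _ _)
    (hdot_cauchy_schwarz _ _) (hdot_cauchy_schwarz _ _)) _.
  by rewrite le_eqVlt; apply/orP; left; apply/eqP; ring.
by rewrite /comp; under eq_fun do rewrite EFinM; exact: integrableZl.
Qed.

(** <Sigma f, Sigma f> is expanded twice by the integral formula for Sigma. *)
Lemma sqr_norm_double_integral f :
  `|Sigma f| ^+ 2 = \int[(Q \x Q)%E]_ww term f ww.
Proof.
rewrite -hdot_norm SigmaE /Rintegral; congr fine.
rewrite -(integral12_prod_meas1 (integrable_term f)); apply: eq_integral => w _.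
rewrite /fubini_F/= (hdotC (Sigma f)) SigmaE /term/=.
have i : Q.-integrable setT (EFin \o (fun w' => hdot f (a w') * hdot (b w) (b w'))).
  apply: (@integrable_le_dominated _ _ _ _ _
      (fun w' => (`|f| * `|b w|) * (`|a w'| * `|b w'|))).
  - by apply: measurable_funM => //; exact: mb.
  - move=> w'; rewrite normrM (le_trans (ler_pM _ _ (hdot_cauchy_schwarz _ _) (hdot_cauchy_schwarz _ _)))//.
    by rewrite le_eqVlt; apply/orP; left; apply/eqP; ring.
  - by rewrite /comp; under eq_fun do rewrite EFinM; exact: integrableZl.
rewrite /Rintegral EFinM fineK ?integrable_fin_num// -integralZl//.
by apply: eq_integral => w' _; rewrite -EFinM mulrA.
Qed.

(** Expanding over the orthonormal sequence, the partial sums of the squared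
    norms are double integrals in which the partial Parseval sums converge to
    the inner product and stay below the product of the norms. *)
Lemma sum_sqr_norm_double_integral (e : nat -> H) :
  (forall i j, i != j -> hdot (e i) (e j) = 0) ->
  (forall i f, hdot f (e i) * hdot (e i) (e i) = hdot f (e i)) ->
  (forall f, (forall i, hdot f (e i) = 0) -> f = 0) ->
  (\sum_(i <oo) (`|Sigma (e i)| ^+ 2)%:E =
   \int[(Q \x Q)%E]_ww (hdot (a ww.1) (a ww.2) * hdot (b ww.1) (b ww.2))%:E)%E.
Proof.
move=> ortho unit total.
pose part n (ww : W * W) := \sum_(0 <= i < n) term (e i) ww.
have mpart n : measurable_fun setT (part n).
  by apply: measurable_sum => i; exact: measurable_term.
have partE n : (\sum_(0 <= i < n) (`|Sigma (e i)| ^+ 2)%:E)%E =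
    (\int[(Q \x Q)%E]_ww (part n ww)%:E)%E.
  have [ip ->] : (Q \x Q)%E.-integrable setT (EFin \o part n) /\
     (\int[(Q \x Q)%E]_ww (part n ww)%:E)%E = (\sum_(0 <= i < n) (`|Sigma (e i)| ^+ 2)%:E)%E; last by [].
  rewrite /part; elim: n => [|n [ih ihE]].
    split; last by rewrite big_nil; apply: integral0_eq => ww _; rewrite big_nil.
    rewrite (_ : _ \o _ = cst 0%E); first exact: integrable0.
    by apply/funext => ww /=; rewrite big_nil.
  have E : (EFin \o (fun ww => \sum_(0 <= i < n.+1) term (e i) ww)) =
      (EFin \o (fun ww => \sum_(0 <= i < n) term (e i) ww)) \+ (EFin \o term (e n)).
    by apply/funext => ww /=; rewrite big_nat_recr//= EFinD.
  split; first by rewrite E; exact: integrableD.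
  transitivity (\int[(Q \x Q)%E]_ww ((\sum_(0 <= i < n) term (e i) ww)%:E + (term (e n) ww)%:E))%E.
    by apply: eq_integral => ww _; rewrite big_nat_recr//= EFinD.
  rewrite [RHS]big_nat_recr//= integralD//; last exact: integrable_term.
  congr (_ + _)%E; first exact: ihE.
  rewrite sqr_norm_double_integral /Rintegral fineK//.
  exact: integrable_fin_num (integrable_term _).
have partB n ww : part n ww =
    (\sum_(0 <= i < n) hdot (a ww.1) (e i) * hdot (a ww.2) (e i)) * hdot (b ww.1) (b ww.2).
  by rewrite mulr_suml; apply: eq_bigr => i _; rewrite /term !(hdotC (e i)).
have [| | | | |_ _ cv] := @dominated_convergence _ _ R (Q \x Q)%E setT measurableT
  (fun n => EFin \o part n)
  (EFin \o (fun ww => hdot (a ww.1) (a ww.2) * hdot (b ww.1) (b ww.2)))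
  (EFin \o (fun ww => (`|a ww.1| * `|b ww.1|) * (`|a ww.2| * `|b ww.2|))).
- by move=> n; exact/measurable_EFinP.
- by apply/measurable_EFinP; exact: measurable_funM.
- apply/aeW => ww _; apply: cvg_EFin; first exact: nearW.
  rewrite /comp/=; under eq_fun do rewrite partB.
  by apply: cvgM; [exact: parseval|exact: cvg_cst].
- exact: iabab.
- apply/aeW => ww n _ /=; rewrite lee_fin partB normrM.
  rewrite (le_trans (ler_pM _ _ (le_normr_partial_parseval ortho unit _ _ _) (hdot_cauchy_schwarz _ _)))//.
  by rewrite le_eqVlt; apply/orP; left; apply/eqP; ring.
- apply/cvg_lim => //; under eq_fun do rewrite partE.
  exact: cv.
Qed.

(** The total sequence makes every orthonormal basis countable, in particular
    the one selected by [hs_norm]. *)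
Lemma hs_norm_double_integral (s : nat -> H) :
  (forall f, (forall k, hdot f (s k) = 0) -> f = 0) ->
  (hs_norm Sigma ^+ 2 =
   \int[(Q \x Q)%E]_ww (hdot (a ww.1) (a ww.2) * hdot (b ww.1) (b ww.2))%:E)%E.
Proof.
move=> stotal; have BB := orthonormal_basis_get H.
have [e [e1 e2 e3 esumE]] := orthonormal_basis_sequence BB (countable_orthonormal_basis BB stotal).
rewrite -(sum_sqr_norm_double_integral e1 e2 e3) -(esumE (fun f => (`|Sigma f| ^+ 2)%:E)); last 2 first.
- by move=> f; rewrite lee_fin sqr_ge0.
- by rewrite raddf0 normr0 expr0n.
by rewrite /hs_norm sqr_poweR12//; apply: esum_ge0 => f _; rewrite lee_fin sqr_ge0.
Qed.

End hilbert_schmidt_core.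

(** * Function spaces of distance-induced kernels *)

Section euclidean_topology.
Variable R : realType.

Lemma continuous_measurable_rV n (f : 'rV[R]_n -> R) :
  continuous f -> measurable_fun setT f.
Proof.
move=> cf; apply: (measurability _ (RGenOpens.measurableE R)) => _ [_ [a [b ->]] <-].
rewrite setTI; apply: open_measurable_rV.
by apply: open_comp => [v _|]; [exact: cf|exact: interval_open].
Qed.

Lemma continuous_enorm n : continuous (@enorm R n).
Proof.
move=> u; apply: (@continuous_comp _ _ _ (fun v : 'rV[R]_n => dotp v v) Num.sqrt); last exact: sqrt_continuous.
apply: continuous_big => [|i _]; first exact: add_continuous.
move=> v; have cc := @coord_continuous R 1 n ord0 i v.
by apply: (@cvgM _ _ _ (nbhs_filter v) _ _ _ _ cc cc).
Qed.

Lemma enorm_dist_cvg0 n (u : 'rV[R]_n) : enorm (u - v) @[v --> u] --> 0.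
Proof.
have cB : {for u, continuous (fun v : 'rV[R]_n => u - v)}.
  by apply: continuousB; [exact: cst_continuous|exact: cvg_id].
have E : enorm (u - u) = 0 by rewrite subrr enorm0.
by rewrite -E; exact: continuous_comp cB (@continuous_enorm n (u - u)).
Qed.

Lemma rV_rat_near n (u : 'rV[R]_n) (U : set 'rV[R]_n) : nbhs u U ->
  exists q : 'rV[rat]_n, U (map_mx ratr q).
Proof.
move=> /nbhs_ballP[e /= e0 uU].
have /choice[q qP] : forall i, exists r : rat, `|u ord0 i - ratr r| < e.
  move=> i; have : u ord0 i - e < u ord0 i + e by rewrite ltrD2l gtrN.
  move=> /rat_in_itvoo[r]; rewrite in_itv/= => /andP[r1 r2]; exists r.
  by rewrite distrC ltr_distl r1.
exists (\row_i q i); apply: uU; split => // i j; rewrite ord1 !mxE.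
exact: qP.
Qed.

End euclidean_topology.

Section reproducing_kernel_space.
Variable R : realType.

(** A feature map that is 1/2-Hoelder for the Euclidean distance makes every
    element of the space continuous, by Cauchy-Schwarz. *)
Lemma continuous_hdot_holder (H : hilbert R) n (C : R) (s : 'rV[R]_n -> H) (f : H) : 0 <= C ->
  (forall x y, `|s x - s y| ^+ 2 <= C * enorm (x - y)) -> continuous (fun x => hdot f (s x)).
Proof.
move=> C0 sC x; have FF : Filter (nbhs x) := nbhs_filter x.
apply/cvgrPdist_le => e e0.
have f0 : 0 < `|f| + 1 by rewrite ltr_wpDl.
have C1 : 0 < C + 1 by rewrite ltr_wpDl.
have := @enorm_dist_cvg0 R n x.
move/cvgrPdist_le => /(_ ((e / (`|f| + 1)) ^+ 2 / (C + 1))).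
rewrite divr_gt0 ?exprn_gt0 ?divr_gt0// => /(_ isT).
apply: filterS => y; rewrite sub0r normrN ger0_norm ?enorm_ge0// ler_pdivlMr// => h.
rewrite -hdotBr (le_trans (hdot_cauchy_schwarz _ _))//.
apply: (@le_trans _ _ ((`|f| + 1) * (e / (`|f| + 1)))); last first.
  by rewrite mulrCA mulfV ?gt_eqF// mulr1.
apply: ler_pM => //; first by rewrite lerDl.
rewrite -ler_sqr ?nnegrE//; last by rewrite divr_ge0// ltW.
apply: le_trans (sC x y) _; apply: le_trans h.
by rewrite mulrC ler_wpM2l ?enorm_ge0// lerDl.
Qed.

Section general_kernel.
Variables (T : Type) (k : T -> T -> R) (H : rkhs k).

Lemma hdot_section x y : hdot (rkhs_section H x) (rkhs_section H y) = k y x.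
Proof. by rewrite -rkhs_reproducing rkhs_sectionE. Qed.

Lemma rkhs_eval_eq0 (f : H) : (forall x, rkhs_eval f x = 0) -> f = 0.
Proof.
move=> f0; apply: (@rkhs_eval_inj _ _ _ H); apply/funext => x.
by rewrite f0 rkhs_reproducing hdot0l.
Qed.
End general_kernel.

Lemma dist_kernelxx n (x0 x : 'rV[R]_n) : dist_kernel x0 x x = 2 * enorm (x - x0).
Proof. by rewrite /dist_kernel subrr enorm0 subr0 mulr_natl mulr2n. Qed.

Lemma dist_kernelC n (x0 x x' : 'rV[R]_n) : dist_kernel x0 x x' = dist_kernel x0 x' x.
Proof. by rewrite /dist_kernel (enormB x x') [enorm (x - x0) + _]addrC. Qed.

Section distance_kernel_space.
Variables (n : nat) (x0 : 'rV[R]_n) (H : rkhs (dist_kernel x0)).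

Lemma sqr_norm_section_diff (x x' : 'rV[R]_n) :
  `|rkhs_section H x - rkhs_section H x'| ^+ 2 = 2 * enorm (x - x').
Proof.
rewrite -hdot_norm hdotBl !hdotBr !hdot_section !dist_kernelxx (dist_kernelC _ x' x).
by rewrite /dist_kernel; ring.
Qed.

Lemma continuous_rkhs_eval (f : H) : continuous (rkhs_eval f).
Proof.
have -> : rkhs_eval f = (fun x => hdot f (rkhs_section H x)).
  by apply/funext => x; exact: rkhs_reproducing.
by apply: (@continuous_hdot_holder _ _ 2) => // x y; rewrite sqr_norm_section_diff.
Qed.

End distance_kernel_space.

Section product_kernel_space.
Variables (n : nat) (x0 : 'rV[R]_n) (T : pointedType) (eta : T -> R).
Variable H : rkhs (prod_kernel (dist_kernel x0) (rank1_kernel eta)).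

Lemma sqr_norm_section_diff_prod (x x' : 'rV[R]_n) z :
  `|rkhs_section H (x, z) - rkhs_section H (x', z)| ^+ 2 = eta z ^+ 2 * (2 * enorm (x - x')).
Proof.
rewrite -hdot_norm hdotBl !hdotBr !hdot_section /prod_kernel /rank1_kernel/=.
rewrite !dist_kernelxx (dist_kernelC _ x' x) /dist_kernel; ring.
Qed.

(** A point where eta does not vanish, unless eta is identically zero. *)
Let z1 := get [set z | eta z != 0].

(** The kernel has rank one in z, so the sections at (x, z) and at (x, z1) are
    proportional. *)
Lemma rank1_section x z : rkhs_section H (x, z) = (eta z / eta z1) *: rkhs_section H (x, z1).
Proof.
have [e1|e1] := eqVneq (eta z1) 0.
  have eta0 z' : eta z' = 0.
    apply/eqP/negPn/negP => ez'; have := @getI _ [set z | eta z != 0] z' ez'.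
    by rewrite /= -/z1 e1 eqxx.
  suff -> : rkhs_section H (x, z) = 0 by rewrite e1 invr0 mulr0 scale0r.
  apply: hdot_eq0; rewrite hdot_section /prod_kernel /rank1_kernel/= eta0.
  by rewrite !mulr0.
apply: (@rkhs_eval_inj _ _ _ H); apply/funext => y.
rewrite [RHS]rkhs_reproducing hdotZl -rkhs_reproducing !rkhs_sectionE.
by rewrite /prod_kernel /rank1_kernel/=; field.
Qed.

Lemma rkhs_eval_rank1 (f : H) x z :
  rkhs_eval f (x, z) = eta z * (rkhs_eval f (x, z1) / eta z1).
Proof. by rewrite !rkhs_reproducing rank1_section hdotZr; ring. Qed.

Lemma continuous_rkhs_eval_prod (f : H) z : continuous (fun x => rkhs_eval f (x, z)).
Proof.
have -> : (fun x => rkhs_eval f (x, z)) = (fun x => hdot f (rkhs_section H (x, z))).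
  by apply/funext => x; exact: rkhs_reproducing.
apply: (@continuous_hdot_holder _ _ (2 * eta z ^+ 2)) => [|x y].
  by rewrite mulr_ge0// sqr_ge0.
by rewrite sqr_norm_section_diff_prod mulrCA mulrA.
Qed.

(** The function eta is only measurable, so f need not be continuous on the
    product; by [rkhs_eval_rank1] the variable z enters only through eta z. *)
Lemma measurable_rkhs_eval_prod d1 (S : measurableType d1)
   (f : H) (x : S -> 'rV[R]_n) (z : S -> T) :
  measurable_fun setT x -> measurable_fun setT (eta \o z) ->
  measurable_fun setT (fun s => rkhs_eval f (x s, z s)).
Proof.
move=> mx mz; under eq_fun do rewrite rkhs_eval_rank1.
apply: measurable_funM => //; apply: measurable_funM => //.
apply: (measurableT_comp (continuous_measurable_rV (@continuous_rkhs_eval_prod f z1)) mx).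
Qed.

(** By continuity in x and proportionality in z, the sections at (x, z1) with x
    rational are total. *)
Lemma total_sequence_rkhs_prod :
  exists s : nat -> H, forall f, (forall k, hdot f (s k) = 0) -> f = 0.
Proof.
exists (fun k => if choice.unpickle k is Some q then
  rkhs_section H (map_mx (ratr : rat -> R) (q : 'rV[rat]_n), z1) else 0).
move=> f hf; apply: rkhs_eval_eq0 => -[x z].
rewrite rkhs_eval_rank1; suff -> : rkhs_eval f (x, z1) = 0 by rewrite mul0r mulr0.
apply/eqP/negPn/negP => fx0.
have [q] : exists q : 'rV[rat]_n, rkhs_eval f (map_mx ratr q, z1) != 0.
  apply: (@rV_rat_near R n x [set y | rkhs_eval f (y, z1) != 0]).
  have FF : Filter (nbhs x) := nbhs_filter x.
  have := @continuous_rkhs_eval_prod f z1 x.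
  move=> /cvgrPdist_lt/(_ `|rkhs_eval f (x, z1)|); rewrite normr_gt0 => /(_ fx0).
  apply: filterS => y; apply: contraTneq => ->.
  by rewrite subr0 ltxx.
by rewrite rkhs_reproducing; have := hf (choice.pickle q); rewrite choice.pickleK => ->; rewrite eqxx.
Qed.

End product_kernel_space.

End reproducing_kernel_space.

(** * Two conditionally independent draws *)

Section symmetrized_sample.
Context (R : realType) (p q d : nat).
Context (dO : measure_display) (Omega : measurableType dO) (P : probability Omega R).
Variables (X : {RV P >-> 'rV[R]_p}) (Y : {RV P >-> 'rV[R]_q}) (Z : {RV P >-> 'rV[R]_d}).
Variable kappa : R.-pker 'rV[R]_d ~> ('rV[R]_p * 'rV[R]_q)%type.
Hypothesis kappaP : cond_distribution X Y Z kappa.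

Notation V := ('rV[R]_p * 'rV[R]_q)%type.
Notation zdim := 'rV[R]_d.
Notation PZ := (distribution P Z).

(** Given Z = z, two independent draws from the conditional distribution of
    (X, Y): a point is ((z, (x, y)), (x', y')). *)
Definition two_draws : probability ((zdim * V) * V)%type R :=
  semidirect (kernel_fst V kappa) (semidirect kappa PZ).

Let zxy (o : Omega) : zdim * V := (Z o, (X o, Y o)).

Lemma measurable_sample : measurable_fun setT zxy.
Proof. by apply/measurable_fun_pairP; split => //; apply/measurable_fun_pairP; split. Qed.

(** Both measures are finite and agree on rectangles, by the definition of a
    conditional distribution. *)
Lemma joint_law U : measurable U -> semidirect kappa PZ U = P (zxy @^-1` U).
Proof.
move=> mU; pose zxy_mfun : {mfun Omega >-> (zdim * V)%type} :=
  HB.pack zxy (isMeasurableFun.Build _ _ _ _ zxy measurable_sample).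
pose G : set (set (zdim * V)) := [set S `*` T | S in measurable & T in measurable].
apply: (@measure_unique _ R _ G (fun=> setT) _ _ _ _
  (semidirect kappa PZ) (pushforward P zxy_mfun)) => //.
- by rewrite measurable_prod_measurableType.
- move=> _ _ [S1 mS1 [T1 mT1 <-]] [S2 mS2 [T2 mT2 <-]].
  rewrite -setXI; exists (S1 `&` S2); first exact: measurableI.
  by exists (T1 `&` T2); first exact: measurableI.
- by move=> _; exists setT => //; exists setT => //; rewrite setXTT.
- by rewrite bigcup_const//; exists 0%N.
- move=> _ [S mS [T mT <-]]; transitivity (\int[PZ]_(z in S) kappa z T)%E; first exact: semidirect_rect.
  by rewrite -kappaP// /pushforward; congr (P _); apply/seteqP; split => o /= [].
- move=> _; rewrite (@le_lt_trans _ _ 1%E) ?ltry//.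
  by rewrite -(@probability_setT _ _ _ (semidirect kappa PZ)).
Qed.

Lemma integrable_joint (f : zdim * V -> R) : measurable_fun setT f ->
  P.-integrable setT (EFin \o (fun o => f (zxy o))) ->
  (semidirect kappa PZ).-integrable setT (EFin \o f).
Proof.
move=> mf fi; apply: (integrable_image measurable_sample joint_law) => //.
exact/measurable_EFinP.
Qed.

Lemma integrable_sample (f : zdim * V -> R) :
  (semidirect kappa PZ).-integrable setT (EFin \o f) ->
  P.-integrable setT (EFin \o (fun o => f (zxy o))).
Proof. exact: (integrable_comp_image measurable_sample joint_law). Qed.

Lemma expectation_joint (f : zdim * V -> R) :
  (semidirect kappa PZ).-integrable setT (EFin \o f) ->
  ('E_P[fun o => f (zxy o)] = \int[semidirect kappa PZ]_zv (f zv)%:E)%E.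
Proof.
move=> fi; rewrite unlock (integral_image measurable_sample joint_law)//.
- exact: measurable_int fi.
- exact: integrable_sample.
Qed.

Let first_draw (w : (zdim * V) * V) : zdim * V := w.1.
Let second_draw (w : (zdim * V) * V) : zdim * V := (w.1.1, w.2).

Lemma measurable_second_draw : measurable_fun setT second_draw.
Proof.
have m1 : measurable_fun setT (fun w : (zdim * V) * V => w.1.1) by apply: measurableT_comp.
by apply/measurable_fun_pairP; split; [exact: m1|exact: measurable_snd].
Qed.

Let ge0_integral_first_draw (G : zdim * V -> \bar R) : measurable_fun setT G ->
  (forall zv, 0 <= G zv)%E ->
  (\int[two_draws]_w G (first_draw w) = \int[semidirect kappa PZ]_zv G zv)%E.
Proof.
move=> mG G0; have m : measurable_fun setT (G \o first_draw) by exact: (measurableT_comp mG measurable_fst).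
rewrite (ge0_integral_semidirect _ _ m (fun _ => G0 _)).
by apply: eq_integral => zv _; exact: (integral_kernel_cst (kernel_fst V kappa) zv (G zv)).
Qed.

Let ge0_integral_second_draw (G : zdim * V -> \bar R) : measurable_fun setT G ->
  (forall zv, 0 <= G zv)%E ->
  (\int[two_draws]_w G (second_draw w) = \int[semidirect kappa PZ]_zv G zv)%E.
Proof.
move=> mG G0; have m : measurable_fun setT (G \o second_draw).
  exact: (measurableT_comp mG measurable_second_draw).
rewrite (ge0_integral_semidirect _ _ m (fun _ => G0 _)).
have m' : measurable_fun setT (fun zv : zdim * V => \int[kappa zv.1]_v G (zv.1, v))%E.
  exact: (measurableT_comp (measurable_integral_kernel kappa mG G0) measurable_fst).
rewrite [LHS](ge0_integral_semidirect _ _ m'); last by move=> zv; exact: integral_ge0.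
rewrite (ge0_integral_semidirect _ _ mG G0); apply: eq_integral => z _.
exact: (integral_kernel_cst kappa z (\int[kappa z]_v G (z, v))%E).
Qed.

Lemma first_draw_law U : measurable U ->
  semidirect kappa PZ U = two_draws (first_draw @^-1` U).
Proof.
move=> mU; have mU' : measurable (first_draw @^-1` U).
  by rewrite -[X in measurable X]setTI; exact: measurable_fst.
transitivity (\int[semidirect kappa PZ]_zv (\1_U zv)%:E)%E.
  by rewrite integral_indic// setIT.
rewrite -ge0_integral_first_draw//; last exact/measurable_EFinP.
transitivity (\int[two_draws]_w (\1_(first_draw @^-1` U) w)%:E)%E; first by [].
by rewrite integral_indic// setIT.
Qed.

Lemma second_draw_law U : measurable U ->
  semidirect kappa PZ U = two_draws (second_draw @^-1` U).
Proof.
move=> mU; have mU' : measurable (second_draw @^-1` U).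
  by rewrite -[X in measurable X]setTI; exact: measurable_second_draw.
transitivity (\int[semidirect kappa PZ]_zv (\1_U zv)%:E)%E.
  by rewrite integral_indic// setIT.
rewrite -ge0_integral_second_draw//; last exact/measurable_EFinP.
transitivity (\int[two_draws]_w (\1_(second_draw @^-1` U) w)%:E)%E; first by [].
by rewrite integral_indic// setIT.
Qed.

Lemma integrable_first_draw (f : zdim * V -> R) :
  (semidirect kappa PZ).-integrable setT (EFin \o f) ->
  two_draws.-integrable setT (EFin \o (fun w => f w.1)).
Proof. exact: (integrable_comp_image measurable_fst first_draw_law). Qed.

Lemma integrable_second_draw (f : zdim * V -> R) :
  (semidirect kappa PZ).-integrable setT (EFin \o f) ->
  two_draws.-integrable setT (EFin \o (fun w => f (w.1.1, w.2))).
Proof. exact: (integrable_comp_image measurable_second_draw second_draw_law). Qed.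

(** Independent draws given Z = z turn the product of the two conditional
    expectations into one expectation. *)
Lemma expectation_two_draws (A B : zdim * V -> R) :
  (semidirect kappa PZ).-integrable setT (EFin \o A) -> (semidirect kappa PZ).-integrable setT (EFin \o B) ->
  two_draws.-integrable setT (EFin \o (fun w => A w.1 * B (w.1.1, w.2))) ->
  (\int[two_draws]_w (A w.1 * B (w.1.1, w.2))%:E =
   \int[PZ]_z ((\int[kappa z]_v A (z, v)) * (\int[kappa z]_v B (z, v)))%:E)%E.
Proof.
move=> Ai Bi ABi.
rewrite (integral_semidirect ABi) (integral_semidirect (integrable_integral_kernel ABi)).
have m1 := measurable_int _ (integrable_integral_kernel (integrable_integral_kernel ABi)).
apply: ae_eq_integral => //.
  apply/measurable_EFinP; apply: measurable_funM.
    apply: (measurableT_comp (fine_measurable measurableT)).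
    exact: (measurable_integral_kernel_signed kappa (measurable_int _ Ai)).
  apply: (measurableT_comp (fine_measurable measurableT)).
  exact: (measurable_integral_kernel_signed kappa (measurable_int _ Bi)).
have := ae_integrable_semidirect Ai; have := ae_integrable_semidirect Bi.
apply: filterS2 => z Bz Az _.
transitivity (\int[kappa z]_v ((A (z, v))%:E * (\int[kappa z]_v B (z, v))%:E))%E.
  apply: eq_integral => v _ /=; rewrite [in RHS]/Rintegral fineK ?integrable_fin_num//.
  by rewrite -integralZl//; apply: eq_integral => v' _; rewrite EFinM.
rewrite integralZr// EFinM; congr (_ * _)%E.
by rewrite /Rintegral fineK ?integrable_fin_num.
Qed.

(** Expanding the product of the increments, the two diagonal terms are
    expectations of F G and the two cross terms are expectations of products of
    conditional expectations. *)
Lemma covariance_two_draws (F G : zdim * V -> R) :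
  (semidirect kappa PZ).-integrable setT (EFin \o F) ->
  (semidirect kappa PZ).-integrable setT (EFin \o G) ->
  (semidirect kappa PZ).-integrable setT (EFin \o (fun zv => F zv * G zv)) ->
  two_draws.-integrable setT (EFin \o (fun w => F w.1 * G (w.1.1, w.2))) ->
  two_draws.-integrable setT (EFin \o (fun w => F (w.1.1, w.2) * G w.1)) ->
  (\int[semidirect kappa PZ]_zv (F zv * G zv)%:E -
   \int[PZ]_z ((\int[kappa z]_v F (z, v)) * (\int[kappa z]_v G (z, v)))%:E =
   (\int[two_draws]_w
     (2^-1 * ((F w.1 - F (w.1.1, w.2)) * (G w.1 - G (w.1.1, w.2)))))%:E)%E.
Proof.
move=> Fi Gi fgi ci ci'.
have fg1 := integrable_first_draw fgi; have fg2 := integrable_second_draw fgi.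
have c1 := expectation_two_draws Fi Gi ci.
have c2 : (\int[two_draws]_w (F (w.1.1, w.2) * G w.1)%:E =
    \int[two_draws]_w (F w.1 * G (w.1.1, w.2))%:E)%E.
  rewrite c1; under eq_integral do rewrite mulrC.
  rewrite (expectation_two_draws Gi Fi); last first.
    by move: ci'; congr (_.-integrable _ _); apply/funext => w /=; rewrite mulrC.
  by apply: eq_integral => z _; rewrite mulrC.
have m1 : (\int[two_draws]_w (F w.1 * G w.1)%:E = \int[semidirect kappa PZ]_zv (F zv * G zv)%:E)%E.
  by rewrite (integral_image measurable_fst first_draw_law)//; exact: measurable_int fgi.
have m2 : (\int[two_draws]_w (F (w.1.1, w.2) * G (w.1.1, w.2))%:E =
    \int[semidirect kappa PZ]_zv (F zv * G zv)%:E)%E.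
  by rewrite (integral_image measurable_second_draw second_draw_law)//; exact: measurable_int fgi.
have -> : \int[two_draws]_w
    (2^-1 * ((F w.1 - F (w.1.1, w.2)) * (G w.1 - G (w.1.1, w.2)))) =
    2^-1 * ((\int[two_draws]_w (F w.1 * G w.1) +
             \int[two_draws]_w (F (w.1.1, w.2) * G (w.1.1, w.2))) -
      (\int[two_draws]_w (F w.1 * G (w.1.1, w.2)) + \int[two_draws]_w (F (w.1.1, w.2) * G w.1))).
  rewrite -RintegralD// -RintegralD// -RintegralB//; last 2 first.
  - by rewrite /comp; under eq_fun do rewrite EFinD; exact: integrableD.
  - by rewrite /comp; under eq_fun do rewrite EFinD; exact: integrableD.
  rewrite -RintegralZl//; last first.
    rewrite /comp; under eq_fun do rewrite EFinB !EFinD.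
    by apply: integrableB => //; exact: integrableD.
  by apply: eq_Rintegral => w _; ring.
rewrite /Rintegral m1 m2 c2 -c1.
have := integrable_fin_num measurableT fgi; have := integrable_fin_num measurableT ci.
rewrite /=; move: (\int[two_draws]_w _)%E (\int[semidirect kappa PZ]_zv _)%E => [u| |] [v| |] // _ _.
by rewrite -EFinB /=; congr EFin; field.
Qed.

End symmetrized_sample.

(** * The conditional cross-covariance operator as an integral *)

Section operator_as_covariance.
Context (R : realType) (p q d : nat).
Context (dO : measure_display) (Omega : measurableType dO) (P : probability Omega R).
Variables (X : {RV P >-> 'rV[R]_p}) (Y : {RV P >-> 'rV[R]_q}) (Z : {RV P >-> 'rV[R]_d}).
Variable kappa : R.-pker 'rV[R]_d ~> ('rV[R]_p * 'rV[R]_q)%type.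
Hypothesis kappaP : cond_distribution X Y Z kappa.
Variables (x0 : 'rV[R]_p) (y0 : 'rV[R]_q).
Hypothesis momX : moment_class (distribution P X) 2 (dist_kernel x0).
Hypothesis momY : moment_class (distribution P Y) 2 (dist_kernel y0).

Notation V := ('rV[R]_p * 'rV[R]_q)%type.
Notation zdim := 'rV[R]_d.
Notation PZ := (distribution P Z).
Notation joint := (semidirect kappa PZ).
Notation Q := (two_draws Z kappa).

Lemma dotp_sub_le n (u v : 'rV[R]_n) : dotp (u - v) (u - v) <= 2 * dotp u u + 2 * dotp v v.
Proof.
have := dotp_ge0 (u + v); rewrite dotpBr dotpDr !(dotpC (_ + v)) !(dotpC (_ - v)).
rewrite !dotpBr !dotpDr (dotpC v u); lra.
Qed.

Lemma integrable_sqr_enorm n (U : {RV P >-> 'rV[R]_n}) (u0 : 'rV[R]_n) :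
  moment_class (distribution P U) 2 (dist_kernel u0) ->
  P.-integrable setT (EFin \o (fun o => enorm (U o - u0) ^+ 2)).
Proof.
have md : measurable_fun setT (fun u : 'rV[R]_n => enorm (u - u0)).
  by apply: measurable_enormB => //; exact: measurable_cst.
rewrite /moment_class (@ge0_integral_image _ _ _ _ _ P (distribution P U) U)//; last 2 first.
- apply/measurable_EFinP; apply: (measurableT_comp (@measurable_powR R 2)).
  by under eq_fun do rewrite dist_kernelxx; exact: measurable_funM.
- by move=> u; rewrite lee_fin powR_ge0.
move=> fi; apply/integrableP; split.
  apply/measurable_EFinP; apply: measurable_funX.
  exact: (measurableT_comp md).
apply: le_lt_trans fi; apply: ge0_le_integral => //.
- apply/measurable_EFinP; apply: measurableT_comp => //; apply: measurable_funX.
  exact: (measurableT_comp md).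
- apply/measurable_EFinP; apply: (measurableT_comp (@measurable_powR R 2)).
  under eq_fun do rewrite dist_kernelxx; apply: measurable_funM => //.
  exact: (measurableT_comp md).
- move=> o _; rewrite lee_fin dist_kernelxx ger0_norm ?sqr_ge0//.
  rewrite powR_mulrn ?mulr_ge0 ?enorm_ge0// exprMn ler_peMl ?sqr_ge0//.
  by rewrite expr2 -natrM ler1n.
Qed.

Variable eta : zdim -> R.
Hypothesis meta : measurable_fun setT eta.
Hypothesis momZ : moment_class PZ 1 (rank1_kernel eta).

(** Majorant of the integrands below; its integrability is the three moment
    conditions together. *)
Let N (zv : zdim * V) : R :=
  1 + eta zv.1 ^+ 2 + enorm (zv.2.1 - x0) ^+ 2 + enorm (zv.2.2 - y0) ^+ 2.

Let integrable_eta2 : P.-integrable setT (EFin \o (fun o => eta (Z o) ^+ 2)).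
Proof.
have m2 : measurable_fun setT (fun z => eta z ^+ 2) by exact: measurable_funX.
move: momZ; rewrite /moment_class (eq_integral (fun z => (eta z ^+ 2)%:E)); last first.
  by move=> z _; rewrite /rank1_kernel -expr2 powRr1 ?sqr_ge0.
rewrite (@ge0_integral_image _ _ _ _ _ P PZ Z)//; last 2 first.
- exact/measurable_EFinP.
- by move=> z; rewrite lee_fin sqr_ge0.
move=> fi; apply/integrableP; split.
  by apply/measurable_EFinP; exact: (measurableT_comp m2).
by under eq_integral do rewrite /= ger0_norm ?sqr_ge0//.
Qed.

Let measurable_N : measurable_fun setT N.
Proof.
apply: measurable_funD; [apply: measurable_funD; [apply: measurable_funD => //|]|].
- by apply: measurable_funX; exact: (measurableT_comp meta).
- by apply: measurable_funX; apply: measurable_enormB => //; apply: measurableT_comp.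
- by apply: measurable_funX; apply: measurable_enormB => //; apply: measurableT_comp.
Qed.

Let integrable_N : joint.-integrable setT (EFin \o N).
Proof.
apply: (integrable_joint kappaP) => //.
have -> : EFin \o (fun o => N (Z o, (X o, Y o))) = (fun o => (1%:E + (eta (Z o) ^+ 2)%:E) +
    (enorm (X o - x0) ^+ 2)%:E + (enorm (Y o - y0) ^+ 2)%:E)%E by [].
apply: integrableD => //; last exact: integrable_sqr_enorm.
apply: integrableD => //; last exact: integrable_sqr_enorm.
apply: integrableD => //.
exact: (finite_measure_integrable_cst P 1).
Qed.

Let NN (w : (zdim * V) * V) := N w.1 + N (w.1.1, w.2).

Let N_ge1 zv : 1 <= N zv.
Proof. by rewrite /N -!addrA lerDl !addr_ge0 ?sqr_ge0. Qed.

Let integrable_NN : Q.-integrable setT (EFin \o NN).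
Proof.
have -> : EFin \o NN = (EFin \o (fun w => N w.1)) \+ (EFin \o (fun w => N (w.1.1, w.2))) by [].
by apply: integrableD => //; [exact: integrable_first_draw|exact: integrable_second_draw].
Qed.

Variables (HXZ : rkhs (prod_kernel (dist_kernel x0) (rank1_kernel eta)))
  (HY : rkhs (dist_kernel y0)).

Let F (f : HXZ) (zv : zdim * V) := rkhs_eval f (zv.2.1, zv.1).
Let G (g : HY) (zv : zdim * V) := rkhs_eval g zv.2.2.

Let measurable_F f : measurable_fun setT (F f).
Proof.
apply: (@measurable_rkhs_eval_prod R p x0 zdim eta HXZ).
  by apply: measurableT_comp.
exact: (measurableT_comp meta measurable_fst).
Qed.

Let measurable_G g : measurable_fun setT (G g).
Proof.
apply: (measurableT_comp (continuous_measurable_rV (@continuous_rkhs_eval R q y0 HY g))).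
by apply: measurableT_comp.
Qed.

Let F_bound f zv : F f zv ^+ 2 <= `|f| ^+ 2 * (eta zv.1 ^+ 2 * (2 * enorm (zv.2.1 - x0))).
Proof.
rewrite /F rkhs_reproducing -[_ ^+ 2]real_normK ?num_real//.
have -> : eta zv.1 ^+ 2 * (2 * enorm (zv.2.1 - x0)) = `|rkhs_section HXZ (zv.2.1, zv.1)| ^+ 2.
  by rewrite -hdot_norm hdot_section /prod_kernel/= dist_kernelxx mulrC.
by rewrite -exprMn ler_sqr ?nnegrE ?mulr_ge0// hdot_cauchy_schwarz.
Qed.

Let G_bound g zv : G g zv ^+ 2 <= `|g| ^+ 2 * (2 * enorm (zv.2.2 - y0)).
Proof.
rewrite /G rkhs_reproducing -[_ ^+ 2]real_normK ?num_real//.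
have -> : 2 * enorm (zv.2.2 - y0) = `|rkhs_section HY zv.2.2| ^+ 2.
  by rewrite -hdot_norm hdot_section dist_kernelxx.
by rewrite -exprMn ler_sqr ?nnegrE ?mulr_ge0// hdot_cauchy_schwarz.
Qed.

Let FG_bound f g zv zv' : `|F f zv * G g zv'| <= `|f| * `|g| * (N zv + N zv').
Proof.
have N0 : 0 <= N zv + N zv' by rewrite addr_ge0// (le_trans ler01).
rewrite -ler_sqr ?nnegrE ?mulr_ge0// real_normK ?num_real// !exprMn.
apply: (le_trans (ler_pM (sqr_ge0 _) (sqr_ge0 _) (F_bound f zv) (G_bound g zv'))).
rewrite mulrACA ler_wpM2l ?mulr_ge0 ?sqr_ge0// /N.
have D0 := enorm_ge0 (zv.2.1 - x0); have E0 := enorm_ge0 (zv'.2.2 - y0).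
have := sqr_ge0 (eta zv'.1); have := sqr_ge0 (eta zv.1).
have := sqr_ge0 (enorm (zv.2.2 - y0)); have := sqr_ge0 (enorm (zv'.2.1 - x0)).
move: (enorm (zv.2.1 - x0)) (enorm (zv'.2.2 - y0)) D0 E0 => D E D0 E0.
move: (_ ^+ 2) => r r0; move: (_ ^+ 2) => s s0; move: (_ ^+ 2) => e e0; move: (_ ^+ 2) => e' e'0.
have DE : 0 <= D * E by rewrite mulr_ge0.
apply: (@le_trans _ _ ((e + D * E) ^+ 2)).
  by have := sqr_ge0 (e - D * E); lra.
rewrite ler_sqr ?nnegrE ?addr_ge0 ?sqr_ge0//.
have := sqr_ge0 (D - E); nra.
Qed.

Let N_ge0 zv : 0 <= N zv. Proof. by rewrite (le_trans ler01). Qed.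

Let F_le f zv : `|F f zv| <= `|f| * N zv.
Proof.
rewrite -ler_sqr ?nnegrE ?mulr_ge0// real_normK ?num_real// exprMn.
apply: (le_trans (F_bound f zv)); rewrite ler_wpM2l ?sqr_ge0// /N.
have D0 := enorm_ge0 (zv.2.1 - x0).
have := sqr_ge0 (eta zv.1); have := sqr_ge0 (enorm (zv.2.2 - y0)).
move: (enorm (zv.2.1 - x0)) D0 => D D0.
move: (_ ^+ 2) => r r0; move: (_ ^+ 2) => e e0.
apply: (@le_trans _ _ ((e + D) ^+ 2)); first by have := sqr_ge0 (e - D); nra.
rewrite ler_sqr ?nnegrE ?addr_ge0 ?sqr_ge0//.
have := sqr_ge0 (D - 1); nra.
Qed.

Let G_le g zv : `|G g zv| <= `|g| * N zv.
Proof.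
rewrite -ler_sqr ?nnegrE ?mulr_ge0// real_normK ?num_real// exprMn.
apply: (le_trans (G_bound g zv)); rewrite ler_wpM2l ?sqr_ge0// /N.
have D0 := enorm_ge0 (zv.2.2 - y0).
have := sqr_ge0 (eta zv.1); have := sqr_ge0 (enorm (zv.2.1 - x0)).
move: (enorm (zv.2.2 - y0)) D0 => D D0.
move: (_ ^+ 2) => r r0; move: (_ ^+ 2) => e e0.
apply: (@le_trans _ _ ((1 + D ^+ 2) ^+ 2)).
  by have := sqr_ge0 (D - 1); nra.
rewrite ler_sqr ?nnegrE ?addr_ge0 ?sqr_ge0//; lra.
Qed.

Let integrable_le_N (h : zdim * V -> R) c : measurable_fun setT h ->
  (forall zv, `|h zv| <= c * N zv) -> joint.-integrable setT (EFin \o h).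
Proof.
move=> mh hN; apply: (integrable_le_dominated mh hN).
by rewrite /comp; under eq_fun do rewrite EFinM; exact: integrableZl.
Qed.

Let integrable_le_NN (h : (zdim * V) * V -> R) c : measurable_fun setT h ->
  (forall w, `|h w| <= c * NN w) -> Q.-integrable setT (EFin \o h).
Proof.
move=> mh hN; apply: (integrable_le_dominated mh hN).
by rewrite /comp; under eq_fun do rewrite EFinM; exact: integrableZl.
Qed.

Let integrable_F f : joint.-integrable setT (EFin \o F f).
Proof. exact: integrable_le_N (measurable_F f) (F_le f). Qed.

Let integrable_G g : joint.-integrable setT (EFin \o G g).
Proof. exact: integrable_le_N (measurable_G g) (G_le g). Qed.

Let FG f g zv := F f zv * G g zv.
Let cross f g (w : (zdim * V) * V) := F f w.1 * G g (w.1.1, w.2).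
Let cross' f g (w : (zdim * V) * V) := F f (w.1.1, w.2) * G g w.1.

Let measurable_FG f g : measurable_fun setT (FG f g).
Proof. by apply: measurable_funM; [exact: measurable_F|exact: measurable_G]. Qed.

Let integrable_FG f g : joint.-integrable setT (EFin \o FG f g).
Proof.
apply: (@integrable_le_N _ (2 * (`|f| * `|g|))) => // zv.
rewrite /FG (le_trans (FG_bound _ _ _ _))// le_eqVlt; apply/orP; left; apply/eqP; ring.
Qed.

Let integrable_cross f g : Q.-integrable setT (EFin \o cross f g).
Proof.
apply: (@integrable_le_NN _ (`|f| * `|g|)) => [|w]; last exact: FG_bound.
apply: measurable_funM; first exact: (measurableT_comp (measurable_F f) measurable_fst).
exact: (measurableT_comp (measurable_G g) (@measurable_second_draw R p q d)).
Qed.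

Let integrable_cross' f g : Q.-integrable setT (EFin \o cross' f g).
Proof.
apply: (@integrable_le_NN _ (`|f| * `|g|)) => [|w].
  apply: measurable_funM; first exact: (measurableT_comp (measurable_F f) (@measurable_second_draw R p q d)).
  exact: (measurableT_comp (measurable_G g) measurable_fst).
by rewrite /NN addrC; exact: FG_bound.
Qed.

Variable Sigma : {linear HXZ -> HY}.
Hypothesis SigmaP : cond_cross_cov_op kappa X Y Z Sigma.

Let a (w : (zdim * V) * V) : HXZ :=
  2^-1 *: (rkhs_section HXZ (w.1.2.1, w.1.1) - rkhs_section HXZ (w.2.1, w.1.1)).
Let b (w : (zdim * V) * V) : HY := rkhs_section HY w.1.2.2 - rkhs_section HY w.2.2.

Let hdot_a f w : hdot f (a w) = 2^-1 * (F f w.1 - F f (w.1.1, w.2)).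
Proof. by rewrite hdotZr hdotBr -!rkhs_reproducing. Qed.

Let hdot_b g w : hdot g (b w) = G g w.1 - G g (w.1.1, w.2).
Proof. by rewrite hdotBr -!rkhs_reproducing. Qed.

(** The defining identity of Sigma, symmetrized over two draws. *)
Let SigmaE f g : hdot g (Sigma f) = \int[Q]_w (hdot f (a w) * hdot g (b w)).
Proof.
have [_ /(_ f g)] := SigmaP.
rewrite (expectation_joint kappaP (integrable_FG f g)) unlock => E.
have := covariance_two_draws (integrable_F f) (integrable_G g) (integrable_FG f g)
  (integrable_cross f g) (integrable_cross' f g).
move/(etrans E) => -[->]; apply: eq_Rintegral => w _.
by rewrite hdot_a hdot_b mulrA.
Qed.

(** Second difference of the Euclidean distance; it is the inner product of two
    increments of the feature map of the distance-induced kernel. *)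
Definition cross_dist n (u u' v v' : 'rV[R]_n) : R :=
  enorm (u - v') + enorm (u' - v) - enorm (u - v) - enorm (u' - v').

Lemma measurable_cross_dist d' (T : measurableType d') n (u u' v v' : T -> 'rV[R]_n) :
  measurable_fun setT u -> measurable_fun setT u' -> measurable_fun setT v ->
  measurable_fun setT v' -> measurable_fun setT (fun t => cross_dist (u t) (u' t) (v t) (v' t)).
Proof.
move=> mu mu' mv mv'.
by apply: measurable_funB; [apply: measurable_funB; [apply: measurable_funD|]|]; exact: measurable_enormB.
Qed.

Let x1 (w : (zdim * V) * V) := w.1.2.1.
Let x2 (w : (zdim * V) * V) := w.2.1.
Let y1 (w : (zdim * V) * V) := w.1.2.2.
Let y2 (w : (zdim * V) * V) := w.2.2.

Let hdot_aa w w' : hdot (a w) (a w') =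
  4^-1 * (eta w.1.1 * eta w'.1.1) * cross_dist (x1 w) (x2 w) (x1 w') (x2 w').
Proof.
rewrite /a hdotZl hdotZr hdotBl !hdotBr !hdot_section /prod_kernel /rank1_kernel/=.
rewrite /cross_dist /x1 /x2 !(dist_kernelC _ w'.1.2.1) !(dist_kernelC _ w'.2.1) /dist_kernel.
by field.
Qed.

Let hdot_bb w w' : hdot (b w) (b w') = cross_dist (y1 w) (y2 w) (y1 w') (y2 w').
Proof.
rewrite /b hdotBl !hdotBr !hdot_section.
rewrite /cross_dist /y1 /y2 !(dist_kernelC _ w'.1.2.2) !(dist_kernelC _ w'.2.2) /dist_kernel.
by ring.
Qed.

Let sqr_norm_a w : `|a w| ^+ 2 = eta w.1.1 ^+ 2 * (2^-1 * enorm (x1 w - x2 w)).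
Proof.
by rewrite /a normrZ exprMn sqr_norm_section_diff_prod /x1 /x2 ger0_norm//; field.
Qed.

Let sqr_norm_b w : `|b w| ^+ 2 = 2 * enorm (y1 w - y2 w).
Proof. exact: sqr_norm_section_diff. Qed.

Let M (w : (zdim * V) * V) : R :=
  `|eta w.1.1| * (Num.sqrt (enorm (x1 w - x2 w)) * Num.sqrt (enorm (y1 w - y2 w))).

Let norm_ab w : `|a w| * `|b w| = M w.
Proof.
apply/eqP; rewrite -(eqrXn2 (n := 2))// ?mulr_ge0 ?sqrtr_ge0//.
rewrite /M !exprMn sqr_norm_a sqr_norm_b !sqr_sqrtr ?enorm_ge0// real_normK ?num_real//.
by apply/eqP; field.
Qed.

Let measurable_eta_draw : measurable_fun setT (fun w : (zdim * V) * V => eta w.1.1).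
Proof. by apply: (measurableT_comp meta); apply: measurableT_comp. Qed.

Let measurable_x1 : measurable_fun setT x1.
Proof. by apply: measurableT_comp => //; apply: measurableT_comp. Qed.

Let measurable_y1 : measurable_fun setT y1.
Proof. by apply: measurableT_comp => //; apply: measurableT_comp. Qed.

Let measurable_x2 : measurable_fun setT x2.
Proof. by apply: measurableT_comp. Qed.

Let measurable_y2 : measurable_fun setT y2.
Proof. by apply: measurableT_comp. Qed.

Let M_le_NN w : `|M w| <= 1 * NN w.
Proof.
have NN0 : 0 <= NN w by rewrite addr_ge0.
rewrite mul1r -ler_sqr ?nnegrE// real_normK ?num_real// /M !exprMn.
rewrite !sqr_sqrtr ?enorm_ge0// real_normK ?num_real//.
have Dle n (u v u0 : 'rV[R]_n) : enorm (u - v) ^+ 2 <= 2 * enorm (u - u0) ^+ 2 + 2 * enorm (v - u0) ^+ 2.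
  rewrite !sqr_enorm; have := dotp_sub_le (u - u0) (v - u0).
  by rewrite opprB addrA subrK.
have := Dle _ (x1 w) (x2 w) x0; have := Dle _ (y1 w) (y2 w) y0.
have := enorm_ge0 (x1 w - x2 w); have := enorm_ge0 (y1 w - y2 w).
rewrite /NN /N /= -/(x1 w) -/(x2 w) -/(y1 w) -/(y2 w).
have := sqr_ge0 (eta w.1.1).
have := sqr_ge0 (enorm (x1 w - x0)); have := sqr_ge0 (enorm (x2 w - x0)).
have := sqr_ge0 (enorm (y1 w - y0)); have := sqr_ge0 (enorm (y2 w - y0)).
move: (enorm (x1 w - x2 w)) (enorm (y1 w - y2 w)) (eta w.1.1 ^+ 2) => D E e.
move: (enorm (x1 w - x0) ^+ 2) (enorm (x2 w - x0) ^+ 2) => r1 r2.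
move: (enorm (y1 w - y0) ^+ 2) (enorm (y2 w - y0) ^+ 2) => s1 s2.
move=> s20 s10 r20 r10 e0 E0 D0 hE hD.
have DE : 0 <= D * E by rewrite mulr_ge0.
apply: (@le_trans _ _ (((e + D * E) / 2) ^+ 2)).
  by have := sqr_ge0 (e - D * E); lra.
rewrite ler_sqr ?nnegrE ?divr_ge0 ?addr_ge0//.
have := sqr_ge0 (D - E); nra.
Qed.

Let measurable_M : measurable_fun setT M.
Proof.
apply: measurable_funM; first by apply: measurableT_comp.
by apply: measurable_funM; apply: measurable_sqrtr; exact: measurable_enormB.
Qed.

(** The moment conditions enter through the arithmetic-geometric inequality
    |eta| sqrt(D E) <= (eta^2 + D E)/2 and D E <= (D^2 + E^2)/2. *)
Lemma integrable_eta_sqrt_dist : Q.-integrable setT (EFin \o (fun w =>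
  `|eta w.1.1| * (Num.sqrt (enorm (w.1.2.1 - w.2.1)) * Num.sqrt (enorm (w.1.2.2 - w.2.2))))).
Proof. exact: integrable_le_NN measurable_M M_le_NN. Qed.

(** The increments of the two feature maps are the vectors a and b of
    [hs_norm_double_integral]. *)
Lemma hs_norm_cross_dist :
  (hs_norm Sigma ^+ 2 = \int[(Q \x Q)%E]_ww
    (4^-1 * (eta ww.1.1.1 * eta ww.2.1.1) *
     (cross_dist ww.1.1.2.1 ww.1.2.1 ww.2.1.2.1 ww.2.2.1 *
      cross_dist ww.1.1.2.2 ww.1.2.2 ww.2.1.2.2 ww.2.2.2))%:E)%E.
Proof.
have [s stotal] := total_sequence_rkhs_prod HXZ.
have c1 : measurable_fun setT (fun ww : ((zdim * V) * V) * ((zdim * V) * V) => ww.1).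
  exact: measurable_fst.
have c2 : measurable_fun setT (fun ww : ((zdim * V) * V) * ((zdim * V) * V) => ww.2).
  exact: measurable_snd.
rewrite (@hs_norm_double_integral _ _ R Q HXZ HY a b Sigma _ _ _ _ _ SigmaE s stotal).
- by apply: eq_integral => ww _; rewrite hdot_aa hdot_bb; congr EFin; ring.
- move=> f; under eq_fun do rewrite hdot_a; apply: measurable_funM => //.
  apply: measurable_funB; first exact: (measurableT_comp (measurable_F f) measurable_fst).
  exact: (measurableT_comp (measurable_F f) (@measurable_second_draw R p q d)).
- move=> g; under eq_fun do rewrite hdot_b.
  apply: measurable_funB; first exact: (measurableT_comp (measurable_G g) measurable_fst).
  exact: (measurableT_comp (measurable_G g) (@measurable_second_draw R p q d)).
- under eq_fun do rewrite hdot_aa; apply: measurable_funM.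
    apply: measurable_funM => //; apply: measurable_funM.
      exact: (measurableT_comp measurable_eta_draw c1).
    exact: (measurableT_comp measurable_eta_draw c2).
  apply: measurable_cross_dist.
  + exact: (measurableT_comp measurable_x1 c1).
  + exact: (measurableT_comp measurable_x2 c1).
  + exact: (measurableT_comp measurable_x1 c2).
  + exact: (measurableT_comp measurable_x2 c2).
- under eq_fun do rewrite hdot_bb; apply: measurable_cross_dist.
  + exact: (measurableT_comp measurable_y1 c1).
  + exact: (measurableT_comp measurable_y2 c1).
  + exact: (measurableT_comp measurable_y1 c2).
  + exact: (measurableT_comp measurable_y2 c2).
- rewrite (_ : EFin \o _ = EFin \o M); first exact: integrable_eta_sqrt_dist.
  by apply/funext => w /=; rewrite norm_ab.
Qed.

End operator_as_covariance.

(** * Weighted cosine integrals and distances *)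

Section oscillatory_kernel.
Context (R : realType).

(** One factor of [weight], a multiple of the Riesz kernel of order -1. *)
Definition riesz_weight n (u : 'rV[R]_n) : R := (c_ R n)^-1 * enorm u ^- n.+1.

Lemma riesz_weight_ge0 n (u : 'rV[R]_n) : (0 < n)%N -> 0 <= riesz_weight u.
Proof. by move=> n0; rewrite mulr_ge0// invr_ge0 ?exprn_ge0 ?enorm_ge0// ltW// c_gt0. Qed.

Lemma measurable_riesz_weight n : measurable_fun setT (@riesz_weight n).
Proof. by apply: measurable_funM => //; exact: measurable_enorm_exprVn. Qed.

Lemma weightE p q (us : 'rV[R]_p * 'rV[R]_q) : weight us = riesz_weight us.1 * riesz_weight us.2.
Proof. by rewrite /weight /riesz_weight invfM; ring. Qed.

(** The real part of (e^(i<u,x>) - e^(i<u,x'>)) times the conjugate of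
    e^(i<u,y>) - e^(i<u,y'>). *)
Definition cross_cos n (x x' y y' u : 'rV[R]_n) : R :=
  (cos (dotp u x) - cos (dotp u x')) * (cos (dotp u y) - cos (dotp u y')) +
  (sin (dotp u x) - sin (dotp u x')) * (sin (dotp u y) - sin (dotp u y')).

(** The terms 1 - cos are nonnegative and separately integrable against the
    weight, which single cosines are not. *)
Lemma cross_cosE n (x x' y y' u : 'rV[R]_n) : cross_cos x x' y y' u =
  (1 - cos (dotp u (x - y'))) + (1 - cos (dotp u (x' - y))) -
  (1 - cos (dotp u (x - y))) - (1 - cos (dotp u (x' - y'))).
Proof. by rewrite /cross_cos !dotpBr !cosB; ring. Qed.

Section weighted_integrals.
Variable n : nat.
Hypothesis n0 : (0 < n)%N.

Lemma measurable_onem_cos_weight (x : 'rV[R]_n) :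
  measurable_fun setT (fun u => (1 - cos (dotp u x)) * riesz_weight u).
Proof.
apply: measurable_funM; last exact: measurable_riesz_weight.
by apply: measurable_funB => //; apply: measurable_cos_comp; exact: measurable_dotpr.
Qed.

Lemma onem_cos_weight_ge0 (x u : 'rV[R]_n) : 0 <= (1 - cos (dotp u x)) * riesz_weight u.
Proof. by rewrite mulr_ge0 ?onem_cos_ge0 ?riesz_weight_ge0. Qed.

Lemma integral_onem_cos_weight (x : 'rV[R]_n) :
  (\int[lebesgue_rV R n]_u ((1 - cos (dotp u x)) * riesz_weight u)%:E = (enorm x)%:E)%E.
Proof. exact: enorm_integral_onem_cos. Qed.

Lemma integrable_onem_cos_weight (x : 'rV[R]_n) :
  (lebesgue_rV R n).-integrable setT (EFin \o (fun u => (1 - cos (dotp u x)) * riesz_weight u)).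
Proof.
apply/integrableP; split; first by apply/measurable_EFinP; exact: measurable_onem_cos_weight.
under eq_integral do rewrite /= ger0_norm ?onem_cos_weight_ge0//.
by rewrite integral_onem_cos_weight ltry.
Qed.

Let cross_cos_weightE (x x' y y' : 'rV[R]_n) :
  (fun u => cross_cos x x' y y' u * riesz_weight u) =
  (fun u => ((1 - cos (dotp u (x - y'))) * riesz_weight u + (1 - cos (dotp u (x' - y))) * riesz_weight u) -
    (1 - cos (dotp u (x - y))) * riesz_weight u - (1 - cos (dotp u (x' - y'))) * riesz_weight u).
Proof. by apply/funext => u; rewrite cross_cosE; ring. Qed.

Lemma integrable_cross_cos_weight (x x' y y' : 'rV[R]_n) :
  (lebesgue_rV R n).-integrable setT (EFin \o (fun u => cross_cos x x' y y' u * riesz_weight u)).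
Proof.
rewrite cross_cos_weightE /comp; under eq_fun do rewrite EFinB EFinB EFinD.
by apply: integrableB => //; [apply: integrableB => //; [apply: integrableD => //|]|];
  exact: integrable_onem_cos_weight.
Qed.

Lemma Rintegral_cross_cos_weight (x x' y y' : 'rV[R]_n) :
  \int[lebesgue_rV R n]_u (cross_cos x x' y y' u * riesz_weight u) = cross_dist x x' y y'.
Proof.
have i := integrable_onem_cos_weight.
have E z : \int[lebesgue_rV R n]_u ((1 - cos (dotp u z)) * riesz_weight u) = enorm z.
  by rewrite /Rintegral integral_onem_cos_weight.
have i2 a b : (lebesgue_rV R n).-integrable setT (EFin \o (fun u =>
   (1 - cos (dotp u a)) * riesz_weight u + (1 - cos (dotp u b)) * riesz_weight u)).
  by rewrite /comp; under eq_fun do rewrite EFinD; apply: integrableD => //; exact: i.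
have i3 a b c : (lebesgue_rV R n).-integrable setT (EFin \o (fun u =>
   ((1 - cos (dotp u a)) * riesz_weight u + (1 - cos (dotp u b)) * riesz_weight u)
   - (1 - cos (dotp u c)) * riesz_weight u)).
  by rewrite /comp; under eq_fun do rewrite EFinB; apply: integrableB => //; [exact: i2|exact: i].
by rewrite cross_cos_weightE RintegralB// RintegralB// RintegralD// !E.
Qed.

Lemma sqr_incr_cos_sin (x x' u : 'rV[R]_n) :
  (cos (dotp u x) - cos (dotp u x')) ^+ 2 + (sin (dotp u x) - sin (dotp u x')) ^+ 2 =
  2 * (1 - cos (dotp u (x - x'))).
Proof.
rewrite dotpBr cosB.
have h1 := cos2Dsin2 (dotp u x); have h2 := cos2Dsin2 (dotp u x').
have -> : 2 * (1 - (cos (dotp u x) * cos (dotp u x') + sin (dotp u x) * sin (dotp u x'))) =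
  (cos (dotp u x) ^+ 2 + sin (dotp u x) ^+ 2) + (cos (dotp u x') ^+ 2 + sin (dotp u x') ^+ 2)
  - 2 * (cos (dotp u x) * cos (dotp u x') + sin (dotp u x) * sin (dotp u x')).
  by rewrite h1 h2; ring.
by ring.
Qed.

Lemma measurable_cross_cos_weight (x x' y y' : 'rV[R]_n) :
  measurable_fun setT (fun u => cross_cos x x' y y' u * riesz_weight u).
Proof. by apply/measurable_EFinP; exact: measurable_int (integrable_cross_cos_weight _ _ _ _). Qed.

(** Cauchy-Schwarz for the weighted integral, obtained from the inequality
    2 a b <= k a^2 + b^2 / k with the optimal k. *)
Lemma integral_normr_cross_cos_weight (x x' y y' : 'rV[R]_n) :
  (\int[lebesgue_rV R n]_u (`|cross_cos x x' y y' u| * riesz_weight u)%:E <=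
   (2 * (Num.sqrt (enorm (x - x')) * Num.sqrt (enorm (y - y'))))%:E)%E.
Proof.
have [xx|xx] := eqVneq x x'.
  rewrite integral0_eq ?lee_fin ?mulr_ge0 ?sqrtr_ge0// => u _.
  by rewrite /cross_cos xx !subrr !mul0r addr0 normr0 mul0r.
have [yy|yy] := eqVneq y y'.
  rewrite integral0_eq ?lee_fin ?mulr_ge0 ?sqrtr_ge0// => u _.
  by rewrite /cross_cos yy !subrr !mulr0 addr0 normr0 mul0r.
have pos z z' : z != z' -> 0 < Num.sqrt (enorm (z - z' : 'rV[R]_n)).
  by move=> zz; rewrite !sqrtr_gt0 lt_neqAle dotp_ge0 eq_sym dotp_eq0 subr_eq0 zz.
have a0 := pos _ _ xx; have b0 := pos _ _ yy.
set a := Num.sqrt (enorm (x - x')) in a0 *; set b := Num.sqrt (enorm (y - y')) in b0 *.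
(* This k makes both terms of k a^2 + b^2 / k equal to a b. *)
pose k := b / a; have k0 : 0 < k by rewrite divr_gt0.
apply: (@le_trans _ _ (\int[lebesgue_rV R n]_u
    (k%:E * ((1 - cos (dotp u (x - x'))) * riesz_weight u)%:E +
     k^-1%:E * ((1 - cos (dotp u (y - y'))) * riesz_weight u)%:E))%E).
  apply: ge0_le_integral => //.
  - by move=> u _; rewrite lee_fin mulr_ge0 ?riesz_weight_ge0.
  - apply/measurable_EFinP; have := measurable_cross_cos_weight x x' y y'.
    move=> m; have := measurableT_comp (@normr_measurable R setT) m.
    by apply: eq_measurable_fun => u _ /=; rewrite normrM (ger0_norm (riesz_weight_ge0 u n0)).
  - apply: emeasurable_funD; apply: measurable_funeM;
      by apply/measurable_EFinP; exact: measurable_onem_cos_weight.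
  - move=> u _; rewrite -!EFinM -EFinD lee_fin (mulrA k) (mulrA k^-1) -mulrDl ler_wpM2r ?riesz_weight_ge0//.
    have := sqr_incr_cos_sin x x' u; have := sqr_incr_cos_sin y y' u.
    rewrite /cross_cos; set p1 := cos _ - _; set p2 := sin _ - _.
    set q1 := cos _ - _; set q2 := sin _ - _.
    move: (1 - cos _) (1 - cos _) => A B hA hB.
    rewrite ler_norml; apply/andP; split.
    + rewrite lerNl -(ler_pM2l k0) mulrDr (mulrA k k^-1) mulfV ?gt_eqF// mul1r mulrA.
      have := sqr_ge0 (k * q1 + p1); have := sqr_ge0 (k * q2 + p2); nra.
    + rewrite -(ler_pM2l k0) mulrDr (mulrA k k^-1) mulfV ?gt_eqF// mul1r mulrA.
      have := sqr_ge0 (k * q1 - p1); have := sqr_ge0 (k * q2 - p2); nra.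
rewrite ge0_integralD//; last 4 first.
- by move=> u _; rewrite -EFinM lee_fin mulr_ge0 ?(ltW k0)// onem_cos_weight_ge0.
- by apply: measurable_funeM; by apply/measurable_EFinP; exact: measurable_onem_cos_weight.
- by move=> u _; rewrite -EFinM lee_fin mulr_ge0 ?invr_ge0 ?(ltW k0)// onem_cos_weight_ge0.
- by apply: measurable_funeM; by apply/measurable_EFinP; exact: measurable_onem_cos_weight.
rewrite !ge0_integralZl//; last 6 first.
- by apply/measurable_EFinP; exact: measurable_onem_cos_weight.
- by move=> u _; rewrite lee_fin onem_cos_weight_ge0.
- by rewrite lee_fin invr_ge0 ltW.
- by apply/measurable_EFinP; exact: measurable_onem_cos_weight.
- by move=> u _; rewrite lee_fin onem_cos_weight_ge0.
- by rewrite lee_fin ltW.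
rewrite !integral_onem_cos_weight -!EFinM -EFinD lee_fin.
rewrite -[enorm (x - x')]sqr_sqrtr ?enorm_ge0// -[enorm (y - y')]sqr_sqrtr ?enorm_ge0//.
rewrite -/a -/b /k le_eqVlt; apply/orP; left; apply/eqP.
by field; rewrite !gt_eqF.
Qed.

End weighted_integrals.
End oscillatory_kernel.

(** * Weighted L2 norm of an oscillating covariance *)

Lemma measurable_param_integral d1 d2 (T1 : measurableType d1) (T2 : measurableType d2)
    (R : realType) (mu : {sigma_finite_measure set T2 -> \bar R}) (f : T1 * T2 -> \bar R) :
  measurable_fun setT f -> measurable_fun setT (fun x => \int[mu]_y f (x, y))%E.
Proof.
move=> mf; under eq_fun do rewrite integralE.
have E (g : T1 * T2 -> \bar R) x : (\int[mu]_y g (x, y) = fubini_F mu g x)%E by [].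
apply: emeasurable_funB.
  apply: (eq_measurable_fun (fubini_F mu f^\+%E)); last first.
    apply: measurable_fun_fubini_tonelli_F => //; exact: measurable_funepos.
  by move=> x _; apply: eq_integral => y _; rewrite funepos.unlock.
apply: (eq_measurable_fun (fubini_F mu f^\-%E)); last first.
  apply: measurable_fun_fubini_tonelli_F => //; exact: measurable_funeneg.
by move=> x _; apply: eq_integral => y _; rewrite funeneg.unlock.
Qed.

Section sigma_finite_product.
Context d1 d2 (T1 : measurableType d1) (T2 : measurableType d2) (R : realType).
Variables (m1 : {sigma_finite_measure set T1 -> \bar R})
  (m2 : {sigma_finite_measure set T2 -> \bar R}).

(** The product measure under a name that carries its sigma-finiteness, which
    iterated Fubini needs. *)
Definition prod_measure : set (T1 * T2) -> \bar R := (m1 \x m2)%E.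

HB.instance Definition _ := Measure.on prod_measure.

Let prod_measure_sigma_finite : sigma_finite setT prod_measure.
Proof.
have /sigma_finiteP[F [TF ndF Foo]] := sigma_finiteT m1.
have /sigma_finiteP[G [TG ndG Goo]] := sigma_finiteT m2.
exists (fun k => F k `*` G k).
  apply/seteqP; split => // -[a b] _.
  have [i _ Fa] : (\bigcup_k F k) a by rewrite -TF.
  have [j _ Gb] : (\bigcup_k G k) b by rewrite -TG.
  exists (maxn i j) => //; split => /=.
    by move: a Fa; exact/subsetPset/ndF/leq_maxl.
  by move: b Gb; exact/subsetPset/ndG/leq_maxr.
move=> k; have [mF Fk] := Foo k; have [mG Gk] := Goo k.
split; first exact: measurableX.
by rewrite /prod_measure product_measure1E// lte_mul_pinfty// ge0_fin_numE.
Qed.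

HB.instance Definition _ :=
  Measure_isSigmaFinite.Build _ _ _ prod_measure prod_measure_sigma_finite.

End sigma_finite_product.

Section oscillating_covariance.
Context dW (W : measurableType dW) (R : realType) (Q : probability W R) (p q : nat).
Hypotheses (p0 : (0 < p)%N) (q0 : (0 < q)%N).
Variables (eta : W -> R) (x x' : W -> 'rV[R]_p) (y y' : W -> 'rV[R]_q).
Hypotheses (meta : measurable_fun setT eta).
Hypotheses (mx : measurable_fun setT x) (mx' : measurable_fun setT x').
Hypotheses (my : measurable_fun setT y) (my' : measurable_fun setT y').
Hypothesis etai : Q.-integrable setT (EFin \o eta).
Hypothesis sqrt_disti : Q.-integrable setT (EFin \o (fun w =>
  `|eta w| * (Num.sqrt (enorm (x w - x' w)) * Num.sqrt (enorm (y w - y' w))))).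

Definition trig (b : bool) : R -> R := if b then cos else sin.

Definition trig_incr n b (v v' u : 'rV[R]_n) : R := trig b (dotp u v) - trig b (dotp u v').

Lemma trig_max b t : `|trig b t| <= 1.
Proof. by case: b; [exact: cos_max|exact: sin_max]. Qed.

Lemma measurable_trig b d (T : measurableType d) (f : T -> R) :
  measurable_fun setT f -> measurable_fun setT (fun t => trig b (f t)).
Proof. by case: b => mf; [exact: measurable_cos_comp|exact: measurable_sin_comp]. Qed.

Lemma measurable_trig_incr n b d (T : measurableType d) (v v' u : T -> 'rV[R]_n) :
  measurable_fun setT v -> measurable_fun setT v' -> measurable_fun setT u ->
  measurable_fun setT (fun t => trig_incr b (v t) (v' t) (u t)).
Proof. by move=> mv mv' mu; apply: measurable_funB; apply: measurable_trig; exact: measurable_dotp. Qed.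

Lemma trig_incr_max n b (v v' u : 'rV[R]_n) : `|trig_incr b v v' u| <= 2.
Proof.
by rewrite /trig_incr (le_trans (ler_normB _ _))// (_ : 2 = 1 + 1 :> R)// lerD// trig_max.
Qed.

Lemma trig_incrN n b (v v' u : 'rV[R]_n) :
  trig_incr b v v' (- u) = (if b then 1 else -1) * trig_incr b v v' u.
Proof. by rewrite /trig_incr !dotpNl; case: b; rewrite /= ?cosN ?sinN; ring. Qed.

Notation V := ('rV[R]_p * 'rV[R]_q)%type.
Notation leb := (lebesgue_rV R p \x lebesgue_rV R q)%E.

Let osc_integrand b c (us : V) (w : W) : R :=
  2^-1 * (eta w * (trig_incr b (x w) (x' w) us.1 * trig_incr c (y w) (y' w) us.2)).

(** For b and c ranging over cosine and sine, these four reals determine the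
    real and imaginary parts of the integral against Q of eta/2 times the product
    of the increments of e^(i<u,.>) and e^(i<s,.>). *)
Definition osc b c (us : V) : R := \int[Q]_w osc_integrand b c us w.

Let measurable_osc_integrand2 b c :
  measurable_fun setT (fun usw : V * W => osc_integrand b c usw.1 usw.2).
Proof.
have m11 : measurable_fun setT (fun usw : V * W => usw.1.1) by apply: measurableT_comp.
have m12 : measurable_fun setT (fun usw : V * W => usw.1.2) by apply: measurableT_comp.
have c2 d (T : measurableType d) (f : W -> T) : measurable_fun setT f ->
    measurable_fun setT (fun usw : V * W => f usw.2).
  by move=> mf; exact: (measurableT_comp mf measurable_snd).
apply: measurable_funM => //; apply: measurable_funM; first exact: c2.
by apply: measurable_funM; apply: measurable_trig_incr => //; exact: c2.
Qed.

Lemma measurable_osc b c : measurable_fun setT (osc b c).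
Proof.
apply: (measurableT_comp (fine_measurable measurableT)).
apply: (@measurable_param_integral _ _ _ _ R Q
  (fun usw => (osc_integrand b c usw.1 usw.2)%:E)).
by apply/measurable_EFinP; exact: measurable_osc_integrand2.
Qed.

Let measurable_osc_integrand b c us : measurable_fun setT (osc_integrand b c us).
Proof.
exact: (measurableT_comp (measurable_osc_integrand2 b c) (measurable_pair1 us)).
Qed.

Lemma integrable_osc b c us : Q.-integrable setT (EFin \o osc_integrand b c us).
Proof.
have i : Q.-integrable setT (EFin \o (fun w => 2 * `|eta w|)).
  rewrite /comp; under eq_fun do rewrite EFinM; apply: integrableZl => //.
  exact: (integrable_abse etai).
apply: (integrable_le_dominated (measurable_osc_integrand b c us) _ i) => w.
rewrite /osc_integrand !normrM (ger0_norm (_ : 0 <= 2^-1 :> R))//.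
have := trig_incr_max b (x w) (x' w) us.1; have := trig_incr_max c (y w) (y' w) us.2.
have := normr_ge0 (trig_incr b (x w) (x' w) us.1).
have := normr_ge0 (trig_incr c (y w) (y' w) us.2).
have := normr_ge0 (eta w).
move: `|trig_incr b _ _ _| `|trig_incr c _ _ _| `|eta w| => B C E.
move=> E0 C0 B0 C2 B2; have BC : 0 <= 4 - B * C by nra.
by have := mulr_ge0 E0 BC; lra.
Qed.

Let oscN b c (us : V) : osc b c (- us.1, us.2) = (if b then 1 else -1) * osc b c us.
Proof.
rewrite /osc -RintegralZl//; last exact: integrable_osc.
apply: eq_Rintegral => w _; rewrite /osc_integrand/= trig_incrN. by case: (b); field.
Qed.

Let cross (ww : W * W) (us : V) : R :=
  cross_cos (x ww.1) (x' ww.1) (x ww.2) (x' ww.2) us.1 *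
  cross_cos (y ww.1) (y' ww.1) (y ww.2) (y' ww.2) us.2.

Let eta4 (ww : W * W) : R := 4^-1 * (eta ww.1 * eta ww.2).

Definition osc_energy (us : V) : R :=
  osc true true us ^+ 2 + osc true false us ^+ 2 +
  osc false true us ^+ 2 + osc false false us ^+ 2.

Let integrable_osc_pair b c us : (Q \x Q)%E.-integrable setT
  (EFin \o (fun ww => osc_integrand b c us ww.1 * osc_integrand b c us ww.2)).
Proof. by apply: integrable_prodM; exact: integrable_osc. Qed.

Let integrable_eta_cross us :
  (Q \x Q)%E.-integrable setT (EFin \o (fun ww => eta4 ww * cross ww us)).
Proof.
rewrite (_ : _ \o _ = (fun ww =>
  ((osc_integrand true true us ww.1 * osc_integrand true true us ww.2)%:E +
   (osc_integrand true false us ww.1 * osc_integrand true false us ww.2)%:E) +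
  ((osc_integrand false true us ww.1 * osc_integrand false true us ww.2)%:E +
   (osc_integrand false false us ww.1 * osc_integrand false false us ww.2)%:E)))%E.
  by apply: integrableD => //; apply: integrableD => //; exact: integrable_osc_pair.
apply/funext => ww; rewrite /= -!EFinD; congr EFin.
rewrite /eta4 /cross /cross_cos /osc_integrand /trig_incr /trig.
by field.
Qed.

(** A squared integral against Q is an integral against two copies of Q, and
    the four products of increments add up to a product of two [cross_cos]. *)
Let osc_energyE us : (\int[(Q \x Q)%E]_ww (eta4 ww * cross ww us)%:E = (osc_energy us)%:E)%E.
Proof.
have E b c : (\int[(Q \x Q)%E]_ww
    (osc_integrand b c us ww.1 * osc_integrand b c us ww.2)%:E = (osc b c us ^+ 2)%:E)%E.
  have i := integrable_osc b c us.
  rewrite -[LHS]fineK; last exact: (integrable_fin_num measurableT (integrable_osc_pair b c us)).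
  by congr EFin; exact: (Rintegral_prodM i i).
pose f b c ww := (osc_integrand b c us ww.1 * osc_integrand b c us ww.2)%:E.
have i b c : (Q \x Q)%E.-integrable setT (f b c) by exact: integrable_osc_pair.
have i2 : (Q \x Q)%E.-integrable setT (fun ww => f true true ww + f true false ww)%E.
  exact: integrableD.
have i3 : (Q \x Q)%E.-integrable setT
    (fun ww => f true true ww + f true false ww + f false true ww)%E.
  exact: integrableD.
transitivity (\int[(Q \x Q)%E]_ww
    (f true true ww + f true false ww + f false true ww + f false false ww))%E.
  apply: eq_integral => ww _; rewrite /f -!EFinD; congr EFin.
  rewrite /eta4 /cross /cross_cos /osc_integrand /trig_incr /trig.
  by field.
by rewrite integralD// integralD// integralD// /f !E -!EFinD.
Qed.

Lemma weight_ge0 (us : V) : 0 <= weight us.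
Proof. by rewrite weightE mulr_ge0// riesz_weight_ge0. Qed.

Lemma measurable_weight : measurable_fun setT (@weight R p q).
Proof.
have -> : @weight R p q = (fun us => riesz_weight us.1 * riesz_weight us.2).
  by apply/funext => us; rewrite weightE.
apply: measurable_funM.
  exact: (measurableT_comp (@measurable_riesz_weight R p) measurable_fst).
exact: (measurableT_comp (@measurable_riesz_weight R q) measurable_snd).
Qed.

Let reflect (us : V) : V := (- us.1, us.2).

Let measurable_reflect : measurable_fun setT reflect.
Proof.
apply/measurable_fun_pairP; split; last exact: measurable_snd.
have m : measurable_fun setT (-%R : 'rV[R]_p -> 'rV[R]_p).
  rewrite (_ : -%R = (fun u : 'rV[R]_p => (-1) *: u + 0)); first exact: measurable_affine_rV.
  by apply/funext => u; rewrite scaleN1r addr0.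
exact: (measurableT_comp m measurable_fst).
Qed.

Let ge0_integral_reflect (G : V -> \bar R) : measurable_fun setT G ->
  (forall us, 0 <= G us)%E -> (\int[leb]_us G (reflect us) = \int[leb]_us G us)%E.
Proof.
move=> mG G0; rewrite !fubini_tonelli2//=; last exact: (measurableT_comp mG measurable_reflect).
apply: eq_integral => s _; rewrite /fubini_G/=.
apply: (@ge0_integral_oppr_rV R p (fun u => G (u, s))) => //.
exact: (measurableT_comp mG (measurable_pair2 s)).
Qed.

(** Squared modulus of the integral against Q of eta times half the product of
    the increments of the two complex exponentials. *)
Definition osc_density (us : V) : R :=
  (osc true true us - osc false false us) ^+ 2 +
  (osc false true us + osc true false us) ^+ 2.

Lemma osc_density_ge0 us : 0 <= osc_density us.
Proof. by rewrite addr_ge0 ?sqr_ge0. Qed.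

Lemma measurable_osc_density : measurable_fun setT osc_density.
Proof.
by apply: measurable_funD; apply: measurable_funX;
  [apply: measurable_funB|apply: measurable_funD]; exact: measurable_osc.
Qed.

(** Flipping the sign of u negates the sine increments in u, so the cross terms
    at u and at -u cancel; the weight is even in u. *)
Lemma integral_osc_density : (\int[leb]_us (osc_density us * weight us)%:E =
  \int[leb]_us (osc_energy us * weight us)%:E)%E.
Proof.
pose G (us : V) := (osc_density us * weight us)%:E.
have mG : measurable_fun setT G.
  apply/measurable_EFinP; apply: measurable_funM; first exact: measurable_osc_density.
  exact: measurable_weight.
have G0 us : (0 <= G us)%E by rewrite lee_fin mulr_ge0 ?weight_ge0 ?osc_density_ge0.
have E us : ((osc_energy us * weight us)%:E = 2^-1%:E * G us + 2^-1%:E * G (reflect us))%E.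
  rewrite /G -!EFinM -EFinD; congr EFin.
  have -> : weight (reflect us) = weight us by rewrite /weight /reflect/= enormN.
  by rewrite /osc_energy /osc_density /reflect !oscN/=; field.
under [RHS]eq_integral do rewrite E.
have mGr := measurableT_comp mG measurable_reflect.
rewrite ge0_integralD//; last 4 first.
- by move=> us _; rewrite mule_ge0// lee_fin.
- exact: measurable_funeM.
- by move=> us _; rewrite mule_ge0// lee_fin.
- by apply: measurable_funeM.
rewrite !ge0_integralZl// ?lee_fin// ge0_integral_reflect// -ge0_muleDl ?lee_fin//.
by rewrite -EFinD (_ : 2^-1 + 2^-1 = 1) ?mul1e//; field.
Qed.

Let Phi (ww : W * W) (us : V) : R := eta4 ww * cross ww us * weight us.

Let measurable_cross_cos d (T : measurableType d) n (f f' g g' u : T -> 'rV[R]_n) :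
  measurable_fun setT f -> measurable_fun setT f' -> measurable_fun setT g ->
  measurable_fun setT g' -> measurable_fun setT u ->
  measurable_fun setT (fun t => cross_cos (f t) (f' t) (g t) (g' t) (u t)).
Proof.
move=> mf mf' mg mg' mu; apply: measurable_funD; apply: measurable_funM.
- exact: (measurable_trig_incr true mf mf' mu).
- exact: (measurable_trig_incr true mg mg' mu).
- exact: (measurable_trig_incr false mf mf' mu).
- exact: (measurable_trig_incr false mg mg' mu).
Qed.

Let measurable_Phi : measurable_fun setT (fun wu : (W * W) * V => Phi wu.1 wu.2).
Proof.
have c1 d (T : measurableType d) (f : W -> T) : measurable_fun setT f ->
    measurable_fun setT (fun wu : (W * W) * V => f wu.1.1).
  by move=> mf; apply: (measurableT_comp mf); apply: measurableT_comp.
have c2 d (T : measurableType d) (f : W -> T) : measurable_fun setT f ->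
    measurable_fun setT (fun wu : (W * W) * V => f wu.1.2).
  by move=> mf; apply: (measurableT_comp mf); apply: measurableT_comp.
have u1 : measurable_fun setT (fun wu : (W * W) * V => wu.2.1) by apply: measurableT_comp.
have u2 : measurable_fun setT (fun wu : (W * W) * V => wu.2.2) by apply: measurableT_comp.
apply: measurable_funM; last exact: (measurableT_comp measurable_weight measurable_snd).
apply: measurable_funM.
  by apply: measurable_funM => //; apply: measurable_funM; [exact: c1|exact: c2].
by apply: measurable_funM; apply: measurable_cross_cos => //; [exact: c1|exact: c1|exact: c2
  |exact: c2|exact: c1|exact: c1|exact: c2|exact: c2].
Qed.

Let M (w : W) : R :=
  `|eta w| * (Num.sqrt (enorm (x w - x' w)) * Num.sqrt (enorm (y w - y' w))).

Let PhiE ww us : Phi ww us = eta4 ww *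
  ((cross_cos (x ww.1) (x' ww.1) (x ww.2) (x' ww.2) us.1 * riesz_weight us.1) *
   (cross_cos (y ww.1) (y' ww.1) (y ww.2) (y' ww.2) us.2 * riesz_weight us.2)).
Proof. by rewrite /Phi /cross weightE; ring. Qed.

(** The weight splits, and Cauchy-Schwarz applies in each factor. *)
Let integral_normr_Phi ww : (\int[leb]_us `|(Phi ww us)%:E| <= (M ww.1 * M ww.2)%:E)%E.
Proof.
pose F (u : 'rV[R]_p) := (`|cross_cos (x ww.1) (x' ww.1) (x ww.2) (x' ww.2) u| * riesz_weight u)%:E.
pose G (s : 'rV[R]_q) := (`|cross_cos (y ww.1) (y' ww.1) (y ww.2) (y' ww.2) s| * riesz_weight s)%:E.
have mcc n (n0 : (0 < n)%N) (v1 v2 v3 v4 : 'rV[R]_n) : measurable_fun setT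
    (fun u => (`|cross_cos v1 v2 v3 v4 u| * riesz_weight u)%:E).
  apply/measurable_EFinP; apply: measurable_funM; last exact: measurable_riesz_weight.
  by apply: (measurableT_comp (@normr_measurable R setT)); exact: measurable_cross_cos.
have F0 u : (0 <= F u)%E by rewrite lee_fin mulr_ge0// riesz_weight_ge0.
have G0 u : (0 <= G u)%E by rewrite lee_fin mulr_ge0// riesz_weight_ge0.
have mF : measurable_fun setT F by exact: mcc.
have mG : measurable_fun setT G by exact: mcc.
have E us : (`|(Phi ww us)%:E| = `|eta4 ww|%:E * (F us.1 * G us.2))%E.
  rewrite /F /G -!EFinM PhiE; congr EFin; rewrite [LHS]normrM; congr (_ * _).
  by rewrite [LHS]normrM; congr (_ * _); rewrite [LHS]normrM; congr (_ * _);
    rewrite ger0_norm// riesz_weight_ge0.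
under eq_integral do rewrite E.
rewrite ge0_integralZl//; last 2 first.
- apply: emeasurable_funM; first exact: (measurableT_comp mF measurable_fst).
  exact: (measurableT_comp mG measurable_snd).
- by move=> us _; rewrite mule_ge0.
rewrite ge0_integral_prodM//.
have hF := integral_normr_cross_cos_weight p0 (x ww.1) (x' ww.1) (x ww.2) (x' ww.2).
have hG := integral_normr_cross_cos_weight q0 (y ww.1) (y' ww.1) (y ww.2) (y' ww.2).
apply: (@le_trans _ _ (`|eta4 ww|%:E *
  ((2 * (Num.sqrt (enorm (x ww.1 - x' ww.1)) * Num.sqrt (enorm (x ww.2 - x' ww.2))))%:E *
   (2 * (Num.sqrt (enorm (y ww.1 - y' ww.1)) * Num.sqrt (enorm (y ww.2 - y' ww.2))))%:E))%E).
  by apply: lee_wpmul2l => //; apply: lee_pmul => //; apply: integral_ge0.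
rewrite -!EFinM lee_fin /M /eta4 !normrM ger0_norm//.
by rewrite le_eqVlt; apply/orP; left; apply/eqP; field.
Qed.

Let measurable_M : measurable_fun setT M.
Proof. by apply/measurable_EFinP; exact: measurable_int sqrt_disti. Qed.

Let QQ : probability (W * W)%type R := (Q \x Q)%E.

Let lebs : {sigma_finite_measure set V -> \bar R} :=
  prod_measure (lebesgue_rV R p) (lebesgue_rV R q).

Let integrable_Phi : (QQ \x lebs)%E.-integrable setT
  (fun wu : (W * W) * V => (Phi wu.1 wu.2)%:E).
Proof.
have mPhi : measurable_fun setT (fun wu : (W * W) * V => (Phi wu.1 wu.2)%:E).
  by apply/measurable_EFinP.
have mA : measurable_fun setT (fun wu : (W * W) * V => `|(Phi wu.1 wu.2)%:E|%E).
  exact: measurableT_comp.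
apply/integrableP; split => //.
rewrite (@fubini_tonelli1 _ _ _ _ R QQ lebs _ mA (fun _ => abse_ge0 _))/=.
have MM := integrable_prodM sqrt_disti sqrt_disti.
apply: (@le_lt_trans _ _ (\int[(Q \x Q)%E]_ww (M ww.1 * M ww.2)%:E)%E).
  apply: ge0_le_integral => //.
  - by move=> ww _; exact: integral_ge0.
  - apply: measurable_fun_fubini_tonelli_F => //; exact: measurableT_comp.
  - by apply/measurable_EFinP; apply: measurable_funM; exact: measurableT_comp.
  - by move=> ww _; exact: integral_normr_Phi.
have M0 : (0 <= \int[(Q \x Q)%E]_ww (M ww.1 * M ww.2)%:E)%E.
  by apply: integral_ge0 => ww _; rewrite lee_fin !mulr_ge0 ?sqrtr_ge0.
by rewrite -ge0_fin_numE//; exact: (integrable_fin_num measurableT MM).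
Qed.

Let integral_Phi ww : (\int[leb]_us (Phi ww us)%:E = (eta4 ww *
  (cross_dist (x ww.1) (x' ww.1) (x ww.2) (x' ww.2) *
   cross_dist (y ww.1) (y' ww.1) (y ww.2) (y' ww.2)))%:E)%E.
Proof.
have ix := integrable_cross_cos_weight p0 (x ww.1) (x' ww.1) (x ww.2) (x' ww.2).
have iy := integrable_cross_cos_weight q0 (y ww.1) (y' ww.1) (y ww.2) (y' ww.2).
have ixy := integrable_prodM ix iy.
under eq_integral do rewrite PhiE EFinM.
rewrite (integralZl measurableT ixy) [RHS]EFinM; congr (_ * _)%E.
rewrite -[LHS]fineK; last exact: (integrable_fin_num measurableT ixy).
congr EFin; rewrite -!Rintegral_cross_cos_weight//.
exact: (Rintegral_prodM ix iy).
Qed.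

(** Fubini exchanges the integral over (u, s) with the one over the two copies
    of Q; [integral_normr_Phi] dominates the integrand. *)
Lemma integral_osc_density_cross_dist :
  (\int[leb]_us (osc_density us * weight us)%:E =
   \int[(Q \x Q)%E]_ww (4^-1 * (eta ww.1 * eta ww.2) *
     (cross_dist (x ww.1) (x' ww.1) (x ww.2) (x' ww.2) *
      cross_dist (y ww.1) (y' ww.1) (y ww.2) (y' ww.2)))%:E)%E.
Proof.
rewrite integral_osc_density.
transitivity (\int[leb]_us \int[(Q \x Q)%E]_ww (Phi ww us)%:E)%E.
  apply: eq_integral => us _.
  rewrite EFinM -osc_energyE -(integralZr measurableT (integrable_eta_cross us)).
  by apply: eq_integral => ww _; rewrite -EFinM.
rewrite -(@Fubini _ _ _ _ R QQ lebs _ integrable_Phi).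
by apply: eq_integral => ww _; exact: integral_Phi.
Qed.

End oscillating_covariance.

(** * Conditional characteristic functions *)

Section conditional_covariance.
Context (R : realType) (p q d : nat).
Context (dO : measure_display) (Omega : measurableType dO) (P : probability Omega R).
Variables (X : {RV P >-> 'rV[R]_p}) (Y : {RV P >-> 'rV[R]_q}) (Z : {RV P >-> 'rV[R]_d}).
Variable kappa : R.-pker 'rV[R]_d ~> ('rV[R]_p * 'rV[R]_q)%type.

Notation V := ('rV[R]_p * 'rV[R]_q)%type.
Notation zdim := 'rV[R]_d.
Notation PZ := (distribution P Z).
Notation Q := (two_draws Z kappa).

(** Conditional covariance of cos or sin of <u, X> with cos or sin of <s, Y>. *)
Definition trig_cov b c (us : V) (z : zdim) : R :=
  \int[kappa z]_v (trig b (dotp us.1 v.1) * trig c (dotp us.2 v.2)) -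
  (\int[kappa z]_v trig b (dotp us.1 v.1)) * (\int[kappa z]_v trig c (dotp us.2 v.2)).

Let measurable_trig1 b (us : V) : measurable_fun setT (fun v : V => trig b (dotp us.1 v.1)).
Proof. by apply: measurable_trig; apply: measurable_dotp. Qed.

Let measurable_trig2 c (us : V) : measurable_fun setT (fun v : V => trig c (dotp us.2 v.2)).
Proof. by apply: measurable_trig; apply: measurable_dotp. Qed.

Let measurable_trig12 b c (us : V) :
  measurable_fun setT (fun v : V => trig b (dotp us.1 v.1) * trig c (dotp us.2 v.2)).
Proof. exact: measurable_funM. Qed.

Section bounded_by_one.
Context dT (T : measurableType dT) (mu : {measure set T -> \bar R}) (f : T -> R).
Hypotheses (mu1 : mu setT = 1%E) (mf : measurable_fun setT f) (f1 : forall t, `|f t| <= 1).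

Let integrable1 : mu.-integrable setT (EFin \o (fun=> 1)).
Proof.
apply/integrableP; split; first exact: measurable_cst.
by rewrite (eq_integral (fun=> 1%E)) ?(integral_cst _ measurableT) ?mul1e ?mu1 ?ltry//= => t _;
  rewrite normr1.
Qed.

Lemma integrable_le1 : mu.-integrable setT (EFin \o f).
Proof. exact: integrable_le_dominated mf f1 integrable1. Qed.

Lemma normr_Rintegral_le1 : `|\int[mu]_t f t| <= 1.
Proof.
apply: le_trans (le_normr_Rintegral measurableT integrable_le1) _.
have <- : \int[mu]_t 1 = 1.
  by rewrite /Rintegral (integral_cst _ measurableT) mul1e mu1.
by apply: le_Rintegral => //; exact: (integrable_abse integrable_le1).
Qed.

End bounded_by_one.

Let kappa1 z : kappa z setT = 1%E.
Proof. exact: prob_kernel. Qed.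

Let trig12_max b c (us v : V) : `|trig b (dotp us.1 v.1) * trig c (dotp us.2 v.2)| <= 1.
Proof. by rewrite normrM mulr_ile1// trig_max. Qed.

(** Addition formulas for the cosine and the sine of <u,x> + <s,y>. *)
Lemma cf_diffE z us : cf_diff kappa z us =
  ((trig_cov true true us z - trig_cov false false us z) +i*
   (trig_cov false true us z + trig_cov true false us z))%C.
Proof.
have i1 b : (kappa z).-integrable setT (EFin \o (fun v : V => trig b (dotp us.1 v.1))).
  by apply: integrable_le1 => // v; exact: trig_max.
have i2 c : (kappa z).-integrable setT (EFin \o (fun v : V => trig c (dotp us.2 v.2))).
  by apply: integrable_le1 => // v; exact: trig_max.
have i12 b c : (kappa z).-integrable setT
    (EFin \o (fun v : V => trig b (dotp us.1 v.1) * trig c (dotp us.2 v.2))).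
  by apply: integrable_le1 => //.
rewrite /cf_diff /cf_X /cf_Y /cf_XY /cintegral/= /trig_cov.
under [X in (X +i* _)%C - _]eq_Rintegral do rewrite cosD.
under [X in (_ +i* X)%C - _]eq_Rintegral do rewrite sinD.
rewrite (RintegralB measurableT (i12 true true) (i12 false false)).
rewrite (RintegralD measurableT (i12 false true) (i12 true false)).
have E1 b : \int[kappa z]_v trig b (dotp us.1 v.1 + dotp 0 v.2) = \int[kappa z]_v trig b (dotp us.1 v.1).
  by apply: eq_Rintegral => v _; rewrite dotp0l addr0.
have E2 c : \int[kappa z]_v trig c (dotp 0 v.1 + dotp us.2 v.2) = \int[kappa z]_v trig c (dotp us.2 v.2).
  by apply: eq_Rintegral => v _; rewrite dotp0l add0r.
rewrite (E1 true) (E1 false) (E2 true) (E2 false) /=.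
apply/eqP; rewrite eq_complex/=; apply/andP; split; apply/eqP; ring.
Qed.

(** Joint measurability in z and (u, s) serves both integrals over z with
    (u, s) fixed and measurability in (u, s) of such integrals. *)
Lemma measurable_trig_cov_pair b c :
  measurable_fun setT (fun zus : zdim * V => trig_cov b c zus.2 zus.1).
Proof.
have mu1 : measurable_fun setT (fun x : (zdim * V) * V => x.1.2.1).
  by apply: measurableT_comp => //; apply: measurableT_comp.
have mu2 : measurable_fun setT (fun x : (zdim * V) * V => x.1.2.2).
  by apply: measurableT_comp => //; apply: measurableT_comp.
have mv1 : measurable_fun setT (fun x : (zdim * V) * V => x.2.1) by apply: measurableT_comp.
have mv2 : measurable_fun setT (fun x : (zdim * V) * V => x.2.2) by apply: measurableT_comp.
have m (f : (zdim * V) * V -> R) : measurable_fun setT f ->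
    measurable_fun setT (fun zus : zdim * V => \int[kappa zus.1]_v f (zus, v)).
  move=> mf; apply: (measurableT_comp (fine_measurable measurableT)).
  apply: (measurable_integral_kernel_signed (kernel_fst V kappa) (f := EFin \o f)).
  exact/measurable_EFinP.
have m1 : measurable_fun setT (fun x : (zdim * V) * V => trig b (dotp x.1.2.1 x.2.1)).
  by apply: measurable_trig; exact: measurable_dotp.
have m2 : measurable_fun setT (fun x : (zdim * V) * V => trig c (dotp x.1.2.2 x.2.2)).
  by apply: measurable_trig; exact: measurable_dotp.
apply: measurable_funB.
  exact: (m (fun x => trig b (dotp x.1.2.1 x.2.1) * trig c (dotp x.1.2.2 x.2.2)))
    (measurable_funM m1 m2).
apply: measurable_funM.
  exact: (m (fun x => trig b (dotp x.1.2.1 x.2.1))) m1.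
exact: (m (fun x => trig c (dotp x.1.2.2 x.2.2))) m2.
Qed.

Lemma measurable_trig_cov b c us : measurable_fun setT (trig_cov b c us).
Proof. exact: (measurableT_comp (measurable_trig_cov_pair b c) (measurable_pair2 us)). Qed.

Lemma trig_cov_max b c us z : `|trig_cov b c us z| <= 2.
Proof.
rewrite (le_trans (ler_normB _ _))// (_ : 2 = 1 + 1 :> R)// lerD//.
  exact: normr_Rintegral_le1.
by rewrite normrM mulr_ile1//; apply: normr_Rintegral_le1 => // v; exact: trig_max.
Qed.

Hypothesis kappaP : cond_distribution X Y Z kappa.
Variable eta : zdim -> R.
Hypothesis etai : PZ.-integrable setT (EFin \o eta).

Let meta : measurable_fun setT eta.
Proof. by apply/measurable_EFinP; exact: measurable_int etai. Qed.

Lemma integrable_trig_cov b c us : PZ.-integrable setT (EFin \o (fun z => eta z * trig_cov b c us z)).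
Proof.
have i : PZ.-integrable setT (EFin \o (fun z => 2 * `|eta z|)).
  rewrite /comp; under eq_fun do rewrite EFinM; apply: integrableZl => //.
  exact: (integrable_abse etai).
apply: (integrable_le_dominated _ _ i) => [|z].
  by apply: measurable_funM => //; exact: measurable_trig_cov.
by rewrite normrM mulrC ler_wpM2r// trig_cov_max.
Qed.

Let integrable_joint_eta : (semidirect kappa PZ).-integrable setT (EFin \o (fun zv => eta zv.1)).
Proof.
apply: (integrable_joint kappaP); first exact: measurableT_comp.
apply: (@integrable_comp_image _ _ _ _ R P PZ Z _ _ (EFin \o eta)) => //.
Qed.

Let integrable_joint_le (f : zdim * V -> R) : measurable_fun setT f ->
  (forall zv, `|f zv| <= `|eta zv.1|) -> (semidirect kappa PZ).-integrable setT (EFin \o f).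
Proof.
move=> mf fle; apply: (integrable_le_dominated mf fle).
exact: (integrable_abse integrable_joint_eta).
Qed.

Let integrable_draws_le (f : (zdim * V) * V -> R) : measurable_fun setT f ->
  (forall w, `|f w| <= `|eta w.1.1|) -> Q.-integrable setT (EFin \o f).
Proof.
move=> mf fle; apply: (integrable_le_dominated mf fle).
exact: (integrable_abse (integrable_first_draw integrable_joint_eta)).
Qed.

(** [covariance_two_draws] with eta absorbed in the first function: being a
    function of z it commutes with conditional expectations. *)
Lemma Rintegral_trig_cov b c us : \int[PZ]_z (eta z * trig_cov b c us z) =
  osc Q (fun w => eta w.1.1) (fun w => w.1.2.1) (fun w => w.2.1)
    (fun w => w.1.2.2) (fun w => w.2.2) b c us.
Proof.
pose F (zv : zdim * V) := eta zv.1 * trig b (dotp us.1 zv.2.1).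
pose G (zv : zdim * V) := trig c (dotp us.2 zv.2.2).
have mF : measurable_fun setT F.
  apply: measurable_funM; first exact: (measurableT_comp meta).
  exact: (measurableT_comp (measurable_trig1 b us) measurable_snd).
have mG : measurable_fun setT G by exact: (measurableT_comp (measurable_trig2 c us) measurable_snd).
have leE (e t : R) : `|t| <= 1 -> `|e * t| <= `|e| by move=> t1; rewrite normrM ler_piMr.
have Fi : (semidirect kappa PZ).-integrable setT (EFin \o F).
  by apply: integrable_joint_le => // zv; apply: leE; exact: trig_max.
have Gi : (semidirect kappa PZ).-integrable setT (EFin \o G).
  apply: integrable_le1 => // [|zv]; last exact: trig_max.
  exact: (@probability_setT _ _ _ (semidirect kappa PZ)).
have FGi : (semidirect kappa PZ).-integrable setT (EFin \o (fun zv => F zv * G zv)).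
  apply: integrable_joint_le => [|zv]; first exact: measurable_funM.
  by rewrite /F /G -mulrA; apply: leE; exact: trig12_max.
have m2 : measurable_fun setT (fun w : (zdim * V) * V => (w.1.1, w.2)).
  exact: (@measurable_second_draw R p q d).
have cross : Q.-integrable setT (EFin \o (fun w => F w.1 * G (w.1.1, w.2))).
  apply: integrable_draws_le => [|w].
    by apply: measurable_funM; [exact: (measurableT_comp mF)|exact: (measurableT_comp mG m2)].
  by rewrite /F /G -mulrA; apply: leE; rewrite normrM mulr_ile1// trig_max.
have cross' : Q.-integrable setT (EFin \o (fun w => F (w.1.1, w.2) * G w.1)).
  apply: integrable_draws_le => [|w].
    by apply: measurable_funM; [exact: (measurableT_comp mF m2)|exact: (measurableT_comp mG)].
  by rewrite /F /G -mulrA; apply: leE; rewrite normrM mulr_ile1// trig_max.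
have := covariance_two_draws Fi Gi FGi cross cross'.
rewrite (integral_semidirect FGi).
have E z : (\int[kappa z]_v (F (z, v) * G (z, v))%:E =
    (eta z * \int[kappa z]_v (trig b (dotp us.1 v.1) * trig c (dotp us.2 v.2)))%:E)%E.
  have i : (kappa z).-integrable setT
    (EFin \o (fun v : V => trig b (dotp us.1 v.1) * trig c (dotp us.2 v.2))) by apply: integrable_le1 => //.
  rewrite EFinM /Rintegral fineK; last exact: (integrable_fin_num measurableT i).
  rewrite -(integralZl measurableT i).
  by apply: eq_integral => v _; rewrite -EFinM mulrA.
have E' z : \int[kappa z]_v F (z, v) = eta z * \int[kappa z]_v trig b (dotp us.1 v.1).
  rewrite /F -RintegralZl//.
  by apply: integrable_le1 => // v; exact: trig_max.
under eq_integral do rewrite E.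
under [X in (_ - X)%E]eq_integral do rewrite E'.
pose f z := eta z * \int[kappa z]_v (trig b (dotp us.1 v.1) * trig c (dotp us.2 v.2)).
pose g z := eta z * (\int[kappa z]_v trig b (dotp us.1 v.1)) * (\int[kappa z]_v trig c (dotp us.2 v.2)).
have m (h : V -> R) : measurable_fun setT h -> measurable_fun setT (fun z => \int[kappa z]_v h v).
  move=> mf; apply: (measurableT_comp (fine_measurable measurableT)).
  apply: (measurable_integral_kernel_signed kappa (f := fun zv : zdim * V => (h zv.2)%:E)).
  by apply/measurable_EFinP; exact: measurableT_comp.
have fi : PZ.-integrable setT (EFin \o f).
  apply: (integrable_le_dominated _ _ (integrable_abse etai)) => [|z].
    by apply: measurable_funM => //; exact: m.
  by apply: leE; exact: normr_Rintegral_le1.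
have gi : PZ.-integrable setT (EFin \o g).
  apply: (integrable_le_dominated _ _ (integrable_abse etai)) => [|z].
    by apply: measurable_funM; [apply: measurable_funM => //|]; exact: m.
  rewrite /g -mulrA; apply: leE; rewrite normrM mulr_ile1//;
    by apply: normr_Rintegral_le1 => // v; exact: trig_max.
rewrite -(integralB measurableT fi gi) => H.
transitivity (fine (\int[PZ]_z (f z - g z)%:E)%E).
  by apply: eq_Rintegral => z _; rewrite /f /g /trig_cov; ring.
rewrite [X in fine X = _]H; apply: eq_Rintegral => w _.
by rewrite /F /G /trig_incr/=; ring.
Qed.

End conditional_covariance.

(** * Hilbert-Schmidt norm and weighted L2 norm *)

Section hs_norm_is_weighted_L2_norm.
Context (R : realType) (p q d : nat).
Hypotheses (p_gt0 : (0 < p)%N) (q_gt0 : (0 < q)%N).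

Lemma sqr_L2w_norm (f : 'rV[R]_p * 'rV[R]_q -> R[i]) :
  (L2w_norm f ^+ 2 = \int[lebesgue_rV R p \x lebesgue_rV R q]_us
    (normC (f us) ^+ 2 * weight us)%:E)%E.
Proof.
rewrite /L2w_norm sqr_poweR12//; apply: integral_ge0 => us _.
by rewrite lee_fin mulr_ge0 ?sqr_ge0 ?weight_ge0.
Qed.

Lemma sqr_normC (z : R[i]) : normC z ^+ 2 = complex.Re z ^+ 2 + complex.Im z ^+ 2.
Proof.
case: z => a b; rewrite /normC /ComplexField.Normc.normc sqr_sqrtr//.
by rewrite addr_ge0 ?sqr_ge0.
Qed.

Context (dO : measure_display) (Omega : measurableType dO) (P : probability Omega R).
Variables (X : {RV P >-> 'rV[R]_p}) (Y : {RV P >-> 'rV[R]_q}) (Z : {RV P >-> 'rV[R]_d}).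
Variable kappa : R.-pker 'rV[R]_d ~> ('rV[R]_p * 'rV[R]_q)%type.
Hypothesis kappaP : cond_distribution X Y Z kappa.

Notation V := ('rV[R]_p * 'rV[R]_q)%type.
Notation zdim := 'rV[R]_d.
Notation PZ := (distribution P Z).
Notation Q := (two_draws Z kappa).

Lemma cintegral_cf_diffE (eta : zdim -> R) us : PZ.-integrable setT (EFin \o eta) ->
  cintegral PZ (fun z => ((eta z)%:C%C * cf_diff kappa z us)%R) =
  ((\int[PZ]_z (eta z * trig_cov kappa true true us z) -
    \int[PZ]_z (eta z * trig_cov kappa false false us z)) +i*
   (\int[PZ]_z (eta z * trig_cov kappa false true us z) +
    \int[PZ]_z (eta z * trig_cov kappa true false us z)))%C.
Proof.
move=> etai; have i b c := integrable_trig_cov kappa etai b c us.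
rewrite -(RintegralB measurableT (i true true) (i false false)).
rewrite -(RintegralD measurableT (i false true) (i true false)) /cintegral.
by congr (_ +i* _)%C; apply: eq_Rintegral => z _; rewrite cf_diffE /=; ring.
Qed.

Variables (x0 : 'rV[R]_p) (y0 : 'rV[R]_q).
Hypothesis momX : moment_class (distribution P X) 2 (dist_kernel x0).
Hypothesis momY : moment_class (distribution P Y) 2 (dist_kernel y0).
Variable eta : zdim -> R.
Hypothesis meta : measurable_fun setT eta.
Hypothesis momZ : moment_class PZ 1 (rank1_kernel eta).

Let integrable_eta : PZ.-integrable setT (EFin \o eta).
Proof.
have i1 : PZ.-integrable setT (fun z => 1%:E + (eta z ^+ 2)%:E)%E.
  apply: integrableD => //; first by apply: finite_measure_integrable_cst.
  apply/integrableP; split; first by apply/measurable_EFinP; exact: measurable_funX.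
  rewrite (eq_integral (fun z => (rank1_kernel eta z z `^ 1)%:E))// => z _.
  by rewrite /rank1_kernel -expr2 powRr1 ?sqr_ge0//= ger0_norm ?sqr_ge0.
apply: (integrable_le_dominated (g := fun z => 1 + eta z ^+ 2) meta _ i1) => z.
have := sqr_ge0 (`|eta z| - 1); have := sqr_ge0 (`|eta z|).
by rewrite -(real_normK (num_real (eta z))) sqrrB; nra.
Qed.

Variable HY : rkhs (dist_kernel y0).
Variable HXZ : rkhs (prod_kernel (dist_kernel x0) (rank1_kernel eta)).
Variable Sigma : {linear HXZ -> HY}.
Hypothesis SigmaP : cond_cross_cov_op kappa X Y Z Sigma.

(** Both sides are the same integral of products of second differences of
    distances over two independent copies of (z, two draws). *)
Theorem hs_norm_L2w_norm : (hs_norm Sigma ^+ 2 =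
  L2w_norm (fun us => cintegral PZ (fun z => ((eta z)%:C%C * cf_diff kappa z us)%R)) ^+ 2)%E.
Proof.
rewrite (hs_norm_cross_dist kappaP momX momY meta momZ SigmaP) sqr_L2w_norm.
have e1 : measurable_fun setT (fun w : (zdim * V) * V => eta w.1.1).
  by apply: (measurableT_comp meta); apply: measurableT_comp.
have ei : Q.-integrable setT (EFin \o (fun w => eta w.1.1)).
  apply: (integrable_first_draw (f := fun zv => eta zv.1)).
  apply: (integrable_joint kappaP); first exact: measurableT_comp.
  by apply: (@integrable_comp_image _ _ _ _ R P PZ Z _ _ (EFin \o eta)).
have Mi := integrable_eta_sqrt_dist kappaP momX momY meta momZ.
have mx1 : measurable_fun setT (fun w : (zdim * V) * V => w.1.2.1).
  by apply: measurableT_comp => //; apply: measurableT_comp.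
have my1 : measurable_fun setT (fun w : (zdim * V) * V => w.1.2.2).
  by apply: measurableT_comp => //; apply: measurableT_comp.
have mx2 : measurable_fun setT (fun w : (zdim * V) * V => w.2.1) by apply: measurableT_comp.
have my2 : measurable_fun setT (fun w : (zdim * V) * V => w.2.2) by apply: measurableT_comp.
have := integral_osc_density_cross_dist p_gt0 q_gt0 e1 mx1 mx2 my1 my2 ei Mi.
move=> <-; apply: eq_integral => us _; congr (_ * _)%:E.
by rewrite cintegral_cf_diffE// sqr_normC/= !(Rintegral_trig_cov kappaP).
Qed.

End hs_norm_is_weighted_L2_norm.

(** * Nonnegative integrals and densities *)

(** The integral of a nonnegative function is a supremum over the simple
    functions below it, so monotonicity needs no measurability. *)
Lemma ge0_integral_mono d (T : measurableType d) (R : realType)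
    (mu : {measure set T -> \bar R}) (f g : T -> \bar R) :
  (forall x, 0 <= f x)%E -> (forall x, f x <= g x)%E ->
  (\int[mu]_x f x <= \int[mu]_x g x)%E.
Proof.
move=> f0 fg; have g0 x : (0 <= g x)%E by exact: le_trans (f0 x) (fg x).
rewrite !ge0_integralTE//; apply: le_ereal_sup => _ [h /= hf <-].
by exists h => // x; exact: le_trans (hf x) (fg x).
Qed.

(** The integral is the difference of those of the positive and the negative
    part; in the extended reals it would be infinite if one of them were. *)
Lemma integrable_integral1 d (T : measurableType d) (R : realType)
    (mu : {measure set T -> \bar R}) (f : T -> R) : measurable_fun setT f ->
  (\int[mu]_x (f x)%:E = 1)%E -> mu.-integrable setT (EFin \o f).
Proof.
move=> mf; rewrite integralE => E.
have mp : measurable_fun setT (fun x => (f x)%:E)^\+%E.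
  by apply: measurable_funepos; exact/measurable_EFinP.
have mn : measurable_fun setT (fun x => (f x)%:E)^\-%E.
  by apply: measurable_funeneg; exact/measurable_EFinP.
apply/integrableP; split; first exact/measurable_EFinP.
rewrite (eq_integral (fun x => (fun x => (f x)%:E)^\+ x + (fun x => (f x)%:E)^\- x))%E; last first.
  by move=> x _; rewrite -[LHS]/((abse \o (EFin \o f)) x) fune_abse.
rewrite ge0_integralD//; move: E.
have : (0 <= \int[mu]_x (fun x => (f x)%:E)^\+ x)%E by apply: integral_ge0.
have : (0 <= \int[mu]_x (fun x => (f x)%:E)^\- x)%E by apply: integral_ge0.
case: (\int[mu]_x (fun x => (f x)%:E)^\+ x)%E => [a| |] //;
  case: (\int[mu]_x (fun x => (f x)%:E)^\- x)%E => [b| |] //= _ _ _.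
by rewrite -EFinD ltry.
Qed.

Section density.
Context d (T : measurableType d) (R : realType).
Variables (nu : probability T R) (mu : {sigma_finite_measure set T -> \bar R}) (h : T -> R).
Hypothesis mh : measurable_fun setT h.
Hypothesis h0 : forall x, 0 <= h x.
Hypothesis nuE : forall A, measurable A -> (nu A = \int[mu]_(x in A) (h x)%:E)%E.

(** The density is almost everywhere the Radon-Nikodym derivative. *)
Lemma ge0_integral_density (f : T -> \bar R) : measurable_fun setT f ->
  (forall x, 0 <= f x)%E -> (\int[nu]_x f x = \int[mu]_x (f x * (h x)%:E))%E.
Proof.
move=> mf f0.
have numu : nu `<< mu.
  apply/null_content_dominatesP => A mA muA; rewrite nuE//.
  by apply: null_set_integral => //; apply: measurable_funTS; exact/measurable_EFinP.
have hi : mu.-integrable setT (EFin \o h).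
  apply/integrableP; split; first exact/measurable_EFinP.
  under eq_integral do rewrite /= ger0_norm//.
  by rewrite -nuE// probability_setT ltry.
have gi := Radon_Nikodym_SigmaFinite.f_integrable numu.
rewrite -(Radon_Nikodym_SigmaFinite.change_of_variables numu f0 measurableT mf).
apply: ae_eq_integral => //.
- by apply: emeasurable_funM => //; exact: measurable_int gi.
- by apply: emeasurable_funM => //; exact/measurable_EFinP.
apply: ae_eqe_mul2l; apply: integral_ae_eq => //; first exact/measurable_EFinP.
by move=> A _ mA; rewrite -nuE// (Radon_Nikodym_SigmaFinite.f_integral numu).
Qed.

End density.

(** * Approximate identities at a Lebesgue point *)

Section approximate_identity.
Context (R : realType) (d : nat) (nu : probability 'rV[R]_d R).
Variables (pZ theta : 'rV[R]_d -> R) (a : 'rV[R]_d) (B Th : R).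
Hypotheses (mtheta : measurable_fun setT theta) (theta_le : forall v, `|theta v| <= Th).
Hypothesis theta1 : (\int[lebesgue_rV R d]_z (theta z)%:E = 1)%E.
Hypotheses (mpZ : measurable_fun setT pZ) (pZ0 : forall z, 0 <= pZ z).
Hypotheses (pZ_le : forall z, pZ z <= B) (pZ_cvg : {for a, continuous pZ}).
Hypothesis nuE : forall A, measurable A ->
  (nu A = \int[lebesgue_rV R d]_(z in A) (pZ z)%:E)%E.

Notation leb := (lebesgue_rV R d).
Let K (t : R) : 'rV[R]_d -> R := bandwidth_kernel theta a t.

Let measurable_rescale (t : R) :
  measurable_fun setT (fun z : 'rV[R]_d => t^-1 *: (a - z)).
Proof.
rewrite (_ : (fun _ => _) = (fun z => (- t^-1) *: z + t^-1 *: a)).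
  exact: measurable_affine_rV.
by apply/funext => z; rewrite scalerBr scaleNr addrC.
Qed.

Let measurable_dilate (t : R) : measurable_fun setT (fun v : 'rV[R]_d => a - t *: v).
Proof.
rewrite (_ : (fun _ => _) = (fun v => (- t) *: v + a)); first exact: measurable_affine_rV.
by apply/funext => v; rewrite scaleNr addrC.
Qed.

(** The substitution z = a - t v. *)
Lemma ge0_integral_bandwidth (t : R) (f : 'rV[R]_d -> R) : 0 < t ->
  measurable_fun setT f -> (forall v, 0 <= f v) ->
  (\int[nu]_z (t ^- d * f (t^-1 *: (a - z)))%:E =
   \int[leb]_v (f v * pZ (a - t *: v))%:E)%E.
Proof.
move=> t0 mf f0.
have mG : measurable_fun setT (fun z : 'rV[R]_d => (t ^- d * f (t^-1 *: (a - z)))%:E).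
  apply/measurable_EFinP; apply: measurable_funM => //.
  exact: (measurableT_comp mf (measurable_rescale t)).
have td : 0 <= t ^- d by rewrite invr_ge0 exprn_ge0// ltW.
rewrite (ge0_integral_density mpZ pZ0 nuE mG); last by move=> z; rewrite lee_fin mulr_ge0.
rewrite [LHS](@ge0_integral_affine_rV R d (- t) a); last 3 first.
- by rewrite oppr_eq0 gt_eqF.
- by apply: emeasurable_funM => //; exact/measurable_EFinP.
- by move=> z; rewrite mule_ge0// lee_fin ?mulr_ge0.
rewrite normrN (gtr0_norm t0) -ge0_integralZl//; last 3 first.
- apply/measurable_EFinP; apply: measurable_funM.
    apply: measurable_funM => //; apply: (measurableT_comp mf).
    exact: (measurableT_comp (measurable_rescale t) (measurable_affine_rV _ _)).
  exact: (measurableT_comp mpZ (measurable_affine_rV _ _)).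
- by move=> z _; rewrite mule_ge0// lee_fin ?mulr_ge0.
- by rewrite lee_fin exprn_ge0// ltW.
apply: eq_integral => v _; rewrite -!EFinM; congr EFin.
rewrite !mulrA mulfV ?mul1r; last by rewrite expf_neq0// gt_eqF.
congr (f _ * pZ _); last by rewrite scaleNr addrC.
by rewrite scaleNr opprD opprK addrCA subrr addr0 scalerA mulVf ?scale1r// gt_eqF.
Qed.

Lemma integral_bandwidth (t : R) : 0 < t ->
  (\int[nu]_z (K t z)%:E = \int[leb]_v (theta v * pZ (a - t *: v))%:E)%E.
Proof.
move=> t0; rewrite [LHS]integralE [RHS]integralE.
have td : 0 <= t ^- d by rewrite invr_ge0 exprn_ge0// ltW.
pose pos v := Num.max (theta v) 0; pose neg v := Num.max (- theta v) 0.
have mp : measurable_fun setT pos by exact: measurable_maxr.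
have mn : measurable_fun setT neg by apply: measurable_maxr => //; exact: measurableT_comp.
have -> : (\int[nu]_z (fun z => (K t z)%:E)^\+ z = \int[leb]_v (pos v * pZ (a - t *: v))%:E)%E.
  rewrite -(ge0_integral_bandwidth t0 mp); last by move=> v; rewrite le_max lexx orbT.
  apply: eq_integral => z _; rewrite funeposE /K /bandwidth_kernel -EFin_max.
  by rewrite maxr_pMr// mulr0.
have -> : (\int[nu]_z (fun z => (K t z)%:E)^\- z = \int[leb]_v (neg v * pZ (a - t *: v))%:E)%E.
  rewrite -(ge0_integral_bandwidth t0 mn); last by move=> v; rewrite le_max lexx orbT.
  apply: eq_integral => z _; rewrite funenegE /K /bandwidth_kernel -EFinN -EFin_max.
  by rewrite maxr_pMr// mulr0 mulrN.
congr (_ - _)%E; apply: eq_integral => v _.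
  by rewrite funeposE -EFin_max maxr_pMl// mul0r.
by rewrite funenegE -EFinN -EFin_max maxr_pMl// mul0r mulNr.
Qed.
Let theta_int : leb.-integrable setT (EFin \o theta).
Proof. exact: integrable_integral1. Qed.

Let B0 : 0 <= B. Proof. exact: le_trans (pZ0 a) (pZ_le a). Qed.

Let Th0 : 0 <= Th. Proof. exact: le_trans (normr_ge0 _) (theta_le a). Qed.

Let measurable_shifted_density (t : R) :
  measurable_fun setT (fun v : 'rV[R]_d => pZ (a - t *: v)).
Proof. exact: (measurableT_comp mpZ (measurable_dilate t)). Qed.

Lemma measurable_bandwidth (t : R) : measurable_fun setT (K t).
Proof.
by apply: measurable_funM => //; exact: (measurableT_comp mtheta (measurable_rescale t)).
Qed.

Lemma bandwidth_le (t : R) z : 0 < t -> `|K t z| <= t ^- d * Th.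
Proof.
move=> t0; have td : 0 <= t ^- d by rewrite invr_ge0 exprn_ge0// ltW.
by rewrite /K /bandwidth_kernel normrM ger0_norm// ler_wpM2l.
Qed.

Lemma integrable_bandwidth (t : R) : 0 < t -> nu.-integrable setT (EFin \o K t).
Proof.
move=> t0; apply: (@integrable_le_dominated _ _ R nu (K t) (fun=> t ^- d * Th)).
- exact: measurable_bandwidth.
- by move=> z; exact: bandwidth_le.
- by apply: finite_measure_integrable_cst.
Qed.

Lemma integral_normr_bandwidth (t : R) : 0 < t ->
  (\int[nu]_z (`|K t z|)%:E <= (B * \int[leb]_v `|theta v|)%:E)%E.
Proof.
move=> t0; have mn : measurable_fun setT (fun v => `|theta v|) by exact: measurableT_comp.
have td : 0 <= t ^- d by rewrite invr_ge0 exprn_ge0// ltW.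
have ni := integrable_abse theta_int.
rewrite (eq_integral (fun z : 'rV[R]_d => (t ^- d * `|theta (t^-1 *: (a - z))|)%:E)); last first.
  by move=> z _; rewrite /K /bandwidth_kernel normrM ger0_norm.
rewrite (ge0_integral_bandwidth t0 mn)// EFinM /Rintegral fineK; last first.
  exact: (integrable_fin_num measurableT ni).
rewrite -ge0_integralZl//; last exact/measurable_EFinP.
apply: ge0_integral_mono => v; rewrite ?lee_fin ?mulr_ge0//.
by rewrite mulrC ler_wpM2r.
Qed.

(** After the substitution z = a - t v the density converges pointwise to its
    value at a, and B |theta| dominates. *)
Lemma cvg_bandwidth_mass (u : R^nat) : (forall n, 0 < u n) -> u @ \oo --> 0 ->
  (fun n => \int[nu]_z K (u n) z) @ \oo --> pZ a.
Proof.
move=> u0 ucvg; have ni := integrable_abse theta_int.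
have [| | | | |_ _ cv] := @dominated_convergence _ _ R leb setT measurableT
    (fun n v => (theta v * pZ (a - u n *: v))%:E) (fun v => (theta v * pZ a)%:E)
    (fun v => (B * `|theta v|)%:E).
- by move=> n; apply/measurable_EFinP; exact: measurable_funM.
- by apply/measurable_EFinP; exact: measurable_funM.
- apply: aeW => v _; apply: cvg_EFin; first by near=> n.
  have h : (fun n => a - u n *: v) @ \oo --> a.
    have : (fun n => a - u n *: v) @ \oo --> a - 0 *: v.
      by apply: cvgB; [exact: cvg_cst|exact: cvgZr_tmp].
    by rewrite scale0r subr0.
  by apply: cvgMl_tmp; exact: (cvg_comp _ _ h pZ_cvg).
- by under eq_fun do rewrite EFinM; exact: integrableZl.
- apply: aeW => v n _; rewrite /= lee_fin normrM mulrC (ger0_norm (pZ0 _)).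
  by rewrite ler_wpM2r.
have E : (\int[leb]_v (theta v * pZ a)%:E = (pZ a)%:E)%E.
  by under eq_integral do rewrite EFinM; rewrite integralZr// theta1 mul1e.
move: cv; rewrite E => /fine_cvg; apply: cvg_trans; apply: near_eq_cvg.
by near=> n; rewrite /= /Rintegral integral_bandwidth.
Unshelve. all: by end_near. Qed.

Let tail (N : nat) (v : 'rV[R]_d) : R := `|theta v| * \1_(~` ball (0 : 'rV[R]_d) N%:R) v.

Let measurable_ball (b : 'rV[R]_d) (s : R) : measurable (ball b s).
Proof. by apply: open_measurable_rV; exact: ball_open. Qed.

Let measurable_tail N : measurable_fun setT (tail N).
Proof.
apply: measurable_funM; first exact: measurableT_comp.
by apply: measurable_indic; apply: measurableC.
Qed.

Let tail_ge0 N v : 0 <= tail N v.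
Proof. by rewrite mulr_ge0// indicE. Qed.

Let tail_le N v : tail N v <= `|theta v|.
Proof. by rewrite ler_piMr// indicE; case: (_ \in _). Qed.

Let integrable_tail N : leb.-integrable setT (EFin \o tail N).
Proof.
apply: (@integrable_le_dominated _ _ R leb (tail N) (fun v => `|theta v|)) => [|v|].
- exact: measurable_tail.
- by rewrite ger0_norm// tail_le.
- exact: (integrable_abse theta_int).
Qed.

Let cvg_tail : (fun N => \int[leb]_v tail N v) @ \oo --> (0 : R).
Proof.
have [| | | | |_ _ cv] := @dominated_convergence _ _ R leb setT measurableT
    (fun N v => (tail N v)%:E) (fun=> 0%E) (fun v => (`|theta v|)%:E).
- by move=> n; exact/measurable_EFinP.
- exact: measurable_cst.
- apply: aeW => v _; apply: cvg_EFin; first by near=> n.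
  apply: cvg_near_cst; near=> N; rewrite /tail/= indicE memNset ?mulr0//.
  apply; rewrite -ball_normE/= sub0r normrN.
  near: N; exact: nbhs_infty_gtr.
- exact: (integrable_abse theta_int).
- by apply: aeW => v n _; rewrite /= lee_fin ger0_norm// tail_le.
by move: cv; rewrite integral0 => /fine_cvg.
Unshelve. all: by end_near. Qed.
Variables (r : 'rV[R]_d -> R) (C : R).
Hypotheses (mr : measurable_fun setT r) (r_le : forall z, `|r z| <= C).

Let osc_mean (s : R) : \bar R :=
  ((s ^- d)%:E * \int[nu]_(z in ball a s) (`|r z - r a|)%:E)%E.

Hypothesis lebesgue_pt : osc_mean s @[s --> 0^'+] --> 0%E.

Let mra : measurable_fun setT (fun z => `|r z - r a|).
Proof.
by apply: (measurableT_comp (@normr_measurable R setT)); apply: measurable_funB.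
Qed.

Let C0 : 0 <= C. Proof. exact: le_trans (normr_ge0 _) (r_le a). Qed.

Let ra_le z : `|r z - r a| <= 2 * C.
Proof. by rewrite (le_trans (ler_normB _ _))// mulr_natl mulr2n lerD. Qed.

(** The substitution v = (a - z)/t sends the ball of radius N t around a to the
    ball of radius N around 0: inside, |theta| is at most Th; outside, the
    oscillation of r is at most 2 C. *)
Let near_tail (t : R) (N : nat) : 0 < t -> (0 < N)%N ->
  (\int[nu]_z (`|K t z| * `|r z - r a|)%:E <=
   (Th * N%:R ^+ d)%:E * osc_mean (N%:R * t) +
   (2 * C * B * \int[leb]_v tail N v)%:E)%E.
Proof.
move=> t0 N0; have td : 0 <= t ^- d by rewrite invr_ge0 exprn_ge0// ltW.
have N0' : 0 < N%:R :> R by rewrite ltr0n.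
pose A z := t ^- d * (\1_(ball a (N%:R * t)) z * `|r z - r a|).
pose D z := t ^- d * tail N (t^-1 *: (a - z)).
have mA : measurable_fun setT A.
  by do 2!apply: measurable_funM => //; exact: measurable_indic.
have mD : measurable_fun setT D.
  by apply: measurable_funM => //; exact: (measurableT_comp (measurable_tail N) (measurable_rescale t)).
have A0 z : 0 <= A z by rewrite !mulr_ge0// indicE.
have D0 z : 0 <= D z by rewrite mulr_ge0// tail_ge0.
apply: (@le_trans _ _ (\int[nu]_z (Th%:E * (A z)%:E + (2 * C)%:E * (D z)%:E))%E).
  apply: ge0_integral_mono => z; first by rewrite lee_fin mulr_ge0.
  rewrite -!EFinM -EFinD lee_fin /A /D /tail indicE.
  have [zin|zout] := boolP (z \in (ball a (N%:R * t) : set 'rV[R]_d)).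
    rewrite mul1r; apply: (@le_trans _ _ (Th * (t ^- d * `|r z - r a|))).
      by rewrite mulrA ler_wpM2r// mulrC; exact: bandwidth_le.
    by rewrite lerDl !mulr_ge0// indicE.
  rewrite mul0r mulr0 mulr0 add0r.
  have -> : \1_(~` ball (0 : 'rV[R]_d) N%:R) (t^-1 *: (a - z)) = 1 :> R.
    rewrite indicE mem_set// -ball_normE/= sub0r normrN normrZ => h.
    move: zout; rewrite notin_setE; apply; rewrite -ball_normE/=.
    move: h; rewrite ger0_norm ?invr_ge0 ?(ltW t0)//.
    by rewrite mulrC ltr_pdivrMr.
  rewrite mulr1 mulrC /K /bandwidth_kernel normrM (ger0_norm td).
  by rewrite ler_pM// mulr_ge0.
rewrite ge0_integralD//; last 4 first.
- by move=> z _; rewrite -EFinM lee_fin mulr_ge0.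
- by apply: measurable_funeM; exact/measurable_EFinP.
- by move=> z _; rewrite -EFinM lee_fin !mulr_ge0.
- by apply: measurable_funeM; exact/measurable_EFinP.
rewrite !ge0_integralZl//; last 5 first.
- exact/measurable_EFinP.
- by move=> z _; rewrite lee_fin.
- by rewrite lee_fin mulr_ge0.
- exact/measurable_EFinP.
- by move=> z _; rewrite lee_fin.
apply: leeD.
  have -> : (\int[nu]_z (A z)%:E = (t ^- d)%:E *
      \int[nu]_z (\1_(ball a (N%:R * t)) z * `|r z - r a|)%:E)%E.
    rewrite -ge0_integralZl//.
    by apply/measurable_EFinP; apply: measurable_funM => //; exact: measurable_indic.
  have tdE : Th * t ^- d = Th * N%:R ^+ d * (N%:R * t) ^- d.
    by rewrite exprMn; field; rewrite !expf_neq0// gt_eqF.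
  by rewrite /osc_mean (integral_setE_indic nu (ball a (N%:R * t))) !muleA -!EFinM tdE.
rewrite ge0_integral_bandwidth//.
have -> : ((2 * C * B * \int[leb]_v tail N v)%:E =
    (2 * C)%:E * \int[leb]_v (B%:E * (tail N v)%:E))%E.
  rewrite ge0_integralZl//; last 2 first.
  - exact/measurable_EFinP.
  - by move=> v _; rewrite lee_fin tail_ge0.
  have -> : (\int[leb]_v (tail N v)%:E = (\int[leb]_v tail N v)%:E)%E.
    by rewrite /Rintegral fineK//; exact: (integrable_fin_num measurableT (integrable_tail N)).
  by rewrite -!EFinM; congr EFin; ring.
apply: lee_wpmul2l; first by rewrite lee_fin mulr_ge0.
apply: ge0_integral_mono => v; first by rewrite lee_fin mulr_ge0// tail_ge0.
by rewrite -EFinM lee_fin mulrC ler_wpM2r// tail_ge0.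
Qed.

(** Near a the Lebesgue point property controls the oscillation of r; far from
    a the mass of the rescaled kernel is a tail of the integral of |theta|. *)
Lemma cvg_bandwidth (u : R^nat) : (forall n, 0 < u n) -> u @ \oo --> 0 ->
  (fun n => \int[nu]_z (K (u n) z * r z)) @ \oo --> pZ a * r a.
Proof.
move=> u0 ucvg.
pose D n := \int[nu]_z (`|K (u n) z| * `|r z - r a|).
have Di n : nu.-integrable setT (EFin \o (fun z => `|K (u n) z| * `|r z - r a|)).
  have i : nu.-integrable setT (EFin \o (fun z => (2 * C) * `|K (u n) z|)).
    rewrite /comp; under eq_fun do rewrite EFinM; apply: integrableZl => //.
    exact: (integrable_abse (integrable_bandwidth (u0 n))).
  apply: (integrable_le_dominated _ _ i) => [|z].
    apply: measurable_funM => //; apply: (measurableT_comp (@normr_measurable R setT)).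
    exact: measurable_bandwidth.
  by rewrite ger0_norm ?mulr_ge0// mulrC ler_wpM2r.
have Kri n : nu.-integrable setT (EFin \o (fun z => K (u n) z * r z)).
  have i : nu.-integrable setT (EFin \o (fun z => C * `|K (u n) z|)).
    rewrite /comp; under eq_fun do rewrite EFinM; apply: integrableZl => //.
    exact: (integrable_abse (integrable_bandwidth (u0 n))).
  apply: (integrable_le_dominated _ _ i) => [|z].
    by apply: measurable_funM => //; exact: measurable_bandwidth.
  by rewrite normrM mulrC ler_wpM2r.
have Kai n : nu.-integrable setT (EFin \o (fun z => K (u n) z * r a)).
  rewrite /comp; under eq_fun do rewrite EFinM; apply: integrableZr => //.
  exact: integrable_bandwidth.
have Dcvg : D @ \oo --> 0.
  apply/cvgrPdist_le => /= e e0.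
  have [N N0 hN] : exists2 N, (0 < N)%N & 2 * C * B * \int[leb]_v tail N v <= e / 2.
    have h : (fun N => 2 * C * B * \int[leb]_v tail N v) @ \oo --> 0.
      by rewrite -[X in _ --> X](mulr0 (2 * C * B)); apply: cvgMl_tmp; exact: cvg_tail.
    have /cvgrPdist_le/(_ (e / 2)) := h.
    rewrite divr_gt0// => /(_ isT)[M _ hM]; exists M.+1 => //.
    have := hM M.+1 (leqnSn M); rewrite /= sub0r normrN; exact: le_trans (ler_norm _).
  have N0' : 0 < N%:R :> R by rewrite ltr0n.
  have Lcvg : (fun n => osc_mean (N%:R * u n)) @ \oo --> 0%E.
    move/cvge_at_rightP : lebesgue_pt; apply; split => [n|]; first by rewrite mulr_gt0.
    by rewrite -[X in _ --> X](mulr0 N%:R); exact: cvgMl_tmp.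
  have /fine_cvgP[Lfin Lfine] := Lcvg.
  have cL : (fun n => Th * N%:R ^+ d * fine (osc_mean (N%:R * u n))) @ \oo --> 0.
    by rewrite -[X in _ --> X](mulr0 (Th * N%:R ^+ d)); exact: cvgMl_tmp.
  move/cvgrPdist_le : cL => /(_ (e / 2)); rewrite divr_gt0// => /(_ isT) cL.
  near=> n.
  have Dn0 : 0 <= D n by apply: Rintegral_ge0 => z _; rewrite mulr_ge0.
  rewrite sub0r normrN (ger0_norm Dn0) -lee_fin /D /Rintegral fineK; last first.
    exact: (integrable_fin_num measurableT (Di n)).
  apply: le_trans (near_tail (u0 n) N0) _.
  have fin : osc_mean (N%:R * u n) \is a fin_num by near: n.
  rewrite -(fineK fin) -EFinM -EFinD lee_fin (splitr e) lerD//.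
  have : `|0 - Th * N%:R ^+ d * fine (osc_mean (N%:R * u n))| <= e / 2 by near: n.
  by rewrite sub0r normrN; exact: le_trans (ler_norm _).
have mass := cvg_bandwidth_mass u0 ucvg.
have mass' : (fun n => (\int[nu]_z K (u n) z) * r a) @ \oo --> pZ a * r a by exact: cvgMr_tmp.
have diff : (fun n => \int[nu]_z (K (u n) z * r z) - (\int[nu]_z K (u n) z) * r a) @ \oo --> 0.
  apply/cvgr0Pnorm_le => e e0; move/cvgr0Pnorm_le : Dcvg => /(_ _ e0) De.
  near=> n; have : `|D n| <= e by near: n.
  apply: le_trans; rewrite -RintegralZr//; last exact: integrable_bandwidth.
  rewrite -RintegralB// (le_trans (le_normr_Rintegral measurableT _))//.
    rewrite /comp; under eq_fun do rewrite EFinB.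
    exact: (integrableB measurableT (Kri n) (Kai n)).
  apply: le_trans (ler_norm _); rewrite le_eqVlt; apply/orP; left; apply/eqP.
  by apply: eq_Rintegral => z _; rewrite -mulrBr normrM.
rewrite -[X in _ --> X]add0r.
rewrite (_ : (fun n => _) = (fun n => (\int[nu]_z (K (u n) z * r z) - (\int[nu]_z K (u n) z) * r a)
  + (\int[nu]_z K (u n) z) * r a)); last by apply/funext => n; rewrite subrK.
exact: cvgD diff mass'.
Unshelve. all: by end_near. Qed.
End approximate_identity.

(** * Vanishing bandwidth *)

Section bandwidth_limit.
Context (R : realType) (p q d : nat).
Hypotheses (p_gt0 : (0 < p)%N) (q_gt0 : (0 < q)%N).
Context (dO : measure_display) (Omega : measurableType dO) (P : probability Omega R).
Variables (Z : {RV P >-> 'rV[R]_d}).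
Variable kappa : R.-pker 'rV[R]_d ~> ('rV[R]_p * 'rV[R]_q)%type.

Notation V := ('rV[R]_p * 'rV[R]_q)%type.
Notation zdim := 'rV[R]_d.
Notation PZ := (distribution P Z).
Notation leb := (lebesgue_rV R p \x lebesgue_rV R q)%E.

Let psiR (z : zdim) (us : V) : R := complex.Re (cf_diff kappa z us).
Let psiI (z : zdim) (us : V) : R := complex.Im (cf_diff kappa z us).

Let measurable_psiR : measurable_fun setT (fun zus : zdim * V => psiR zus.1 zus.2).
Proof.
rewrite /psiR; under eq_fun do rewrite cf_diffE/=.
by apply: measurable_funB; exact: measurable_trig_cov_pair.
Qed.

Let measurable_psiI : measurable_fun setT (fun zus : zdim * V => psiI zus.1 zus.2).
Proof.
rewrite /psiI; under eq_fun do rewrite cf_diffE/=.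
by apply: measurable_funD; exact: measurable_trig_cov_pair.
Qed.

Let psiR_le z us : `|psiR z us| <= 4.
Proof.
rewrite /psiR cf_diffE/= (le_trans (ler_normB _ _))// (_ : 4 = 2 + 2 :> R); last by ring.
by rewrite lerD// trig_cov_max.
Qed.

Let psiI_le z us : `|psiI z us| <= 4.
Proof.
rewrite /psiI cf_diffE/= (le_trans (ler_normD _ _))// (_ : 4 = 2 + 2 :> R); last by ring.
by rewrite lerD// trig_cov_max.
Qed.

Let sqr_le (b c : R) : 0 <= c -> `|b| <= c -> b ^+ 2 <= c ^+ 2.
Proof. by move=> c0 bc; rewrite -(real_normK (num_real b)) ler_sqr. Qed.

Let sqr_psi_le z us : normC (cf_diff kappa z us) ^+ 2 <= 32.
Proof.
rewrite sqr_normC (_ : 32 = 4 ^+ 2 + 4 ^+ 2 :> R); last by ring.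
by rewrite lerD// sqr_le// ?psiR_le ?psiI_le.
Qed.

Lemma normC_ge0 (z : R[i]) : 0 <= normC z.
Proof. by case: z => b c; exact: sqrtr_ge0. Qed.

Lemma normr_Re_le (z : R[i]) : `|complex.Re z| <= normC z.
Proof.
rewrite -ler_sqr ?nnegrE ?normC_ge0// real_normK ?num_real// sqr_normC.
by rewrite lerDl sqr_ge0.
Qed.

Lemma normr_Im_le (z : R[i]) : `|complex.Im z| <= normC z.
Proof.
rewrite -ler_sqr ?nnegrE ?normC_ge0// real_normK ?num_real// sqr_normC.
by rewrite lerDr sqr_ge0.
Qed.

Let phi (eta : zdim -> R) (us : V) : R[i] :=
  cintegral PZ (fun z => ((eta z)%:C%C * cf_diff kappa z us)%R).

Let phiE (eta : zdim -> R) us : phi eta us =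
  ((\int[PZ]_z (eta z * psiR z us)) +i* (\int[PZ]_z (eta z * psiI z us)))%C.
Proof.
rewrite /phi /cintegral; congr (_ +i* _)%C; apply: eq_Rintegral => z _;
  rewrite /psiR /psiI; case: (cf_diff kappa z us) => b c /=; ring.
Qed.

Let measurable_sqr_phi eta : measurable_fun setT eta ->
  measurable_fun setT (fun us => normC (phi eta us) ^+ 2).
Proof.
move=> meta; under eq_fun do rewrite phiE sqr_normC/=.
have m (f : zdim -> V -> R) : measurable_fun setT (fun zus : zdim * V => f zus.1 zus.2) ->
    measurable_fun setT (fun us => \int[PZ]_z (eta z * f z us)).
  move=> mf; apply: (measurableT_comp (fine_measurable measurableT)).
  apply: (@measurable_param_integral _ _ _ _ R PZ (fun usz : V * zdim => (eta usz.2 * f usz.2 usz.1)%:E)).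
  apply/measurable_EFinP; apply: measurable_funM; first exact: (measurableT_comp meta).
  have ms : measurable_fun setT (fun usz : V * zdim => (usz.2, usz.1)).
    by apply/measurable_fun_pairP; split; [exact: measurable_snd|exact: measurable_fst].
  exact: (measurableT_comp mf ms).
by apply: measurable_funD; apply: measurable_funX; exact: m.
Qed.

Let measurable_sqr_psi a : measurable_fun setT (fun us => normC (cf_diff kappa a us) ^+ 2).
Proof.
under eq_fun do rewrite sqr_normC.
apply: measurable_funD; apply: measurable_funX.
  exact: (measurableT_comp measurable_psiR (measurable_pair1 a)).
exact: (measurableT_comp measurable_psiI (measurable_pair1 a)).
Qed.

(** Each of the real and imaginary parts is at most A times the square root
    of s. *)
Let sqr_phi_le (eta : zdim -> R) (A s : R) us : PZ.-integrable setT (EFin \o eta) ->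
  (\int[PZ]_z (`|eta z|)%:E <= A%:E)%E ->
  (forall z, normC (cf_diff kappa z us) ^+ 2 <= s) ->
  normC (phi eta us) ^+ 2 <= 2 * A ^+ 2 * s.
Proof.
move=> etai etaA psis.
have s0 : 0 <= s by apply: le_trans (psis 0); rewrite sqr_ge0.
have etaA' : \int[PZ]_z `|eta z| <= A.
  rewrite -lee_fin /Rintegral fineK//.
  exact: (integrable_fin_num measurableT (integrable_abse etai)).
have meta : measurable_fun setT eta by apply/measurable_EFinP; exact: measurable_int etai.
have A0 : 0 <= A by apply: le_trans etaA'; apply: Rintegral_ge0.
have bound (f : zdim -> R) : measurable_fun setT f -> (forall z, `|f z| <= Num.sqrt s) ->
    (\int[PZ]_z (eta z * f z)) ^+ 2 <= A ^+ 2 * s.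
  move=> mf fs; rewrite -[X in _ <= _ * X](sqr_sqrtr s0) -exprMn sqr_le// ?mulr_ge0 ?sqrtr_ge0//.
  have i : PZ.-integrable setT (EFin \o (fun z => `|eta z| * Num.sqrt s)).
    rewrite /comp; under eq_fun do rewrite EFinM; apply: integrableZr => //.
    exact: (integrable_abse etai).
  have i' : PZ.-integrable setT (EFin \o (fun z => eta z * f z)).
    apply: (integrable_le_dominated _ _ i) => [|z]; first exact: measurable_funM.
    by rewrite normrM ler_wpM2l.
  apply: le_trans (le_normr_Rintegral measurableT i') _.
  apply: (@le_trans _ _ (\int[PZ]_z (`|eta z| * Num.sqrt s))).
    apply: le_Rintegral => //; first exact: (integrable_abse i').
    by move=> z _; rewrite normrM ler_wpM2l.
  rewrite RintegralZr//; last exact: (integrable_abse etai).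
  by rewrite ler_wpM2r// sqrtr_ge0.
have normC_le z : normC (cf_diff kappa z us) <= Num.sqrt s.
  by rewrite -ler_sqr ?nnegrE ?normC_ge0 ?sqrtr_ge0// (sqr_sqrtr s0) psis.
rewrite phiE sqr_normC/= (_ : 2 * A ^+ 2 * s = A ^+ 2 * s + A ^+ 2 * s); last by ring.
rewrite lerD// bound//.
- exact: (measurableT_comp measurable_psiR (measurable_pair2 us)).
- by move=> z; exact: le_trans (normr_Re_le _) (normC_le z).
- exact: (measurableT_comp measurable_psiI (measurable_pair2 us)).
- by move=> z; exact: le_trans (normr_Im_le _) (normC_le z).
Qed.
Variables (pZ theta : zdim -> R) (a : zdim) (B Th : R).
Hypotheses (mtheta : measurable_fun setT theta) (theta_le : forall v, `|theta v| <= Th).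
Hypothesis theta1 : (\int[lebesgue_rV R d]_z (theta z)%:E = 1)%E.
Hypotheses (mpZ : measurable_fun setT pZ) (pZ0 : forall z, 0 <= pZ z).
Hypotheses (pZ_le : forall z, pZ z <= B) (pZ_cvg : {for a, continuous pZ}).
Hypothesis PZ_density : forall A, measurable A ->
  (PZ A = \int[lebesgue_rV R d]_(z in A) (pZ z)%:E)%E.

(** The averages of a 1-Lipschitz function of psi are squeezed between 0 and
    those of |psi - psi_a|. *)
Let lebesgue_pt_part (g : R[i] -> R) us :
  (forall w w', `|g w - g w'| <= normC (w - w')) ->
  cond_lebesgue_point PZ (fun z => cf_diff kappa z us) a ->
  (fun s : R => (s ^- d)%:E * \int[PZ]_(z in ball a s)
     (`|g (cf_diff kappa z us) - g (cf_diff kappa a us)|)%:E)%E @ 0^'+ --> 0%E.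
Proof.
move=> gle; apply: squeeze_cvge; last exact: (cvg_cst 0%E).
near=> s; have sd : 0 <= s ^- d.
  by rewrite invr_ge0 exprn_ge0// ltW//; near: s; exact: nbhs_right_gt.
apply/andP; split; first by rewrite mule_ge0// integral_ge0.
apply: lee_wpmul2l; first by rewrite lee_fin.
rewrite 2!(integral_setE_indic PZ (ball a s)); apply: ge0_integral_mono => z.
  by rewrite lee_fin mulr_ge0// indicE.
by rewrite lee_fin ler_wpM2l// indicE.
Unshelve. all: by end_near. Qed.

Lemma cvg_sqr_bandwidth (u : R^nat) us : (forall n, 0 < u n) -> u @ \oo --> 0 ->
  cond_lebesgue_point PZ (fun z => cf_diff kappa z us) a ->
  (fun n => normC (phi (bandwidth_kernel theta a (u n)) us) ^+ 2) @ \oo -->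
  pZ a ^+ 2 * normC (cf_diff kappa a us) ^+ 2.
Proof.
move=> u0 ucvg lp.
have part (g : R[i] -> R) : (forall w w', `|g w - g w'| <= normC (w - w')) ->
    measurable_fun setT (fun z => g (cf_diff kappa z us)) ->
    (forall z, `|g (cf_diff kappa z us)| <= 4) ->
    (fun n => \int[PZ]_z (bandwidth_kernel theta a (u n) z * g (cf_diff kappa z us))) @ \oo -->
      pZ a * g (cf_diff kappa a us).
  move=> gle mg g4; have lpg := lebesgue_pt_part gle lp.
  exact: (cvg_bandwidth mtheta theta_le theta1 mpZ pZ0 pZ_le pZ_cvg PZ_density mg g4 lpg u0 ucvg).
have ReB (w w' : R[i]) : `|complex.Re w - complex.Re w'| <= normC (w - w').
  by case: w w' => [w1 w2] [w1' w2']; exact: (normr_Re_le ((w1 - w1') +i* (w2 - w2'))%C).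
have ImB (w w' : R[i]) : `|complex.Im w - complex.Im w'| <= normC (w - w').
  by case: w w' => [w1 w2] [w1' w2']; exact: (normr_Im_le ((w1 - w1') +i* (w2 - w2'))%C).
have cR := part (@complex.Re R) ReB (measurableT_comp measurable_psiR (measurable_pair2 us))
  (fun z => psiR_le z us).
have cI := part (@complex.Im R) ImB (measurableT_comp measurable_psiI (measurable_pair2 us))
  (fun z => psiI_le z us).
rewrite sqr_normC mulrDr -!exprMn.
under eq_fun do rewrite phiE sqr_normC/=.
rewrite !expr2; under eq_fun do rewrite !expr2.
by apply: cvgD; apply: cvgM; [exact: cR|exact: cR|exact: cI|exact: cI].
Qed.

Hypothesis sup_lty : (\int[leb]_us
  (ereal_sup (range (fun z => (normC (cf_diff kappa z us) ^+ 2)%:E)) * (weight us)%:E) < +oo)%E.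
Hypothesis lebesgue_pts : {ae leb, forall us,
  cond_lebesgue_point PZ (fun z => cf_diff kappa z us) a}.

Let Su us := ereal_sup (range (fun z => (normC (cf_diff kappa z us) ^+ 2)%:E)).

Let le_Su z us : ((normC (cf_diff kappa z us) ^+ 2)%:E <= Su us)%E.
Proof. by apply: ereal_sup_ubound; exists z. Qed.

Let Su_fin us : Su us \is a fin_num.
Proof.
rewrite ge0_fin_numE; last by apply: le_trans (le_Su a us); rewrite lee_fin sqr_ge0.
apply: (@le_lt_trans _ _ 32%:E); last exact: ltry.
by apply: ge_ereal_sup => _ [z _ <-]; rewrite lee_fin.
Qed.

Let A := B * \int[lebesgue_rV R d]_v `|theta v|.
Let c : R := 2 * A ^+ 2 + 1.

Let c0 : 0 < c. Proof. by rewrite /c ltr_wpDl// mulr_ge0// sqr_ge0. Qed.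

Let F (u : R^nat) n us := normC (phi (bandwidth_kernel theta a (u n)) us) ^+ 2 * weight us.

Let F_le u n us : 0 < u n -> ((c^-1 * F u n us)%:E <= Su us * (weight us)%:E)%E.
Proof.
move=> un0; rewrite -(fineK (Su_fin us)) -EFinM lee_fin /F mulrA ler_wpM2r ?weight_ge0//.
have Ki := integrable_bandwidth PZ a mtheta theta_le un0.
have KA := integral_normr_bandwidth a mtheta theta1 mpZ pZ0 pZ_le PZ_density un0.
have Sz z : normC (cf_diff kappa z us) ^+ 2 <= fine (Su us) by rewrite -lee_fin fineK.
have S0 : 0 <= fine (Su us) by apply: le_trans (Sz a); rewrite sqr_ge0.
rewrite mulrC ler_pdivrMr//; apply: le_trans (sqr_phi_le Ki KA Sz) _.
by rewrite mulrC ler_wpM2l// /c lerDl.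
Qed.

(** Dominated convergence along a sequence of bandwidths. *)
Theorem cvg_L2w_norm_bandwidth (u : R^nat) : (forall n, 0 < u n) -> u @ \oo --> 0 ->
  ((fun n => L2w_norm (phi (bandwidth_kernel theta a (u n))) ^+ 2) @ \oo -->
    (pZ a ^+ 2)%:E * cond_dcov2 kappa a)%E /\ 
  ((pZ a ^+ 2)%:E * cond_dcov2 kappa a)%E \is a fin_num.
Proof.
move=> u0 ucvg.
have mF n : measurable_fun setT (fun us => (F u n us)%:E).
  apply/measurable_EFinP; apply: measurable_funM; last exact: measurable_weight.
  by apply: measurable_sqr_phi; exact: measurable_bandwidth.
have F0 n us : 0 <= F u n us by rewrite mulr_ge0 ?weight_ge0 ?sqr_ge0.
pose h n us : \bar R := (c^-1 * F u n us)%:E.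
have mh n : measurable_fun setT (h n).
  by apply/measurable_EFinP; apply: measurable_funM => //; apply/measurable_EFinP; exact: mF.
(* The supremum over all z need not be measurable in (u, s); the one over the
   sequence is, and it is below the former up to the constant c. *)
pose g us : \bar R := esups (h ^~ us) 0.
have hg n us : (h n us <= g us)%E by apply: ereal_sup_ubound; exists n.
have g0 us : (0 <= g us)%E.
  by apply: le_trans (hg 0%N us); rewrite lee_fin mulr_ge0// invr_ge0 ltW.
have gi : leb.-integrable setT g.
  apply/integrableP; split; first exact: measurable_fun_esups.
  apply: le_lt_trans sup_lty; apply: ge0_integral_mono => us; first exact: abse_ge0.
  rewrite gee0_abs//; apply: ge_ereal_sup => _ [n _ <-]; exact: F_le.
have [| | | | |fi _ cv] := @dominated_convergence _ _ R leb setT measurableT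
    (fun n us => (F u n us)%:E)
    (fun us => (pZ a ^+ 2 * normC (cf_diff kappa a us) ^+ 2 * weight us)%:E)
    (fun us => c%:E * g us)%E.
- exact: mF.
- apply/measurable_EFinP; apply: measurable_funM; last exact: measurable_weight.
  exact: measurable_funM.
- apply: filterS lebesgue_pts => us lp _; apply: cvg_EFin; first by near=> n.
  by apply: cvgMr_tmp; exact: cvg_sqr_bandwidth.
- exact: integrableZl.
- apply: aeW => us n _; rewrite gee0_abs ?lee_fin//.
  rewrite -(mulVKf (lt0r_neq0 c0) (F u n us)) EFinM.
  by apply: lee_wpmul2l; [rewrite lee_fin ltW|exact: hg].
have E : (\int[leb]_us (pZ a ^+ 2 * normC (cf_diff kappa a us) ^+ 2 * weight us)%:E =
    (pZ a ^+ 2)%:E * cond_dcov2 kappa a)%E.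
  have mw : measurable_fun setT (fun us => (normC (cf_diff kappa a us) ^+ 2 * weight us)%:E).
    by apply/measurable_EFinP; apply: measurable_funM => //; exact: measurable_weight.
  have w0 us : setT us -> (0 <= (normC (cf_diff kappa a us) ^+ 2 * weight us)%:E)%E.
    by move=> _; rewrite lee_fin mulr_ge0 ?weight_ge0 ?sqr_ge0.
  have pa0 : (0 <= (pZ a ^+ 2)%:E)%E by rewrite lee_fin sqr_ge0.
  rewrite /cond_dcov2 sqr_L2w_norm// -(ge0_integralZl leb measurableT mw w0 pa0).
  by apply: eq_integral => us _; rewrite -mulrA EFinM.
split; last by rewrite -E; exact: integrable_fin_num fi.
rewrite -E; move: cv; apply: cvg_trans; apply: near_eq_cvg; near=> n.
by rewrite sqr_L2w_norm.
Unshelve. all: by end_near. Qed.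

End bandwidth_limit.

(** * Rank-one kernels of varying bandwidth *)

Lemma bounded_setT_le (T : Type) (R : realType) (f : T -> R) :
  [bounded f z | z in setT] -> exists M, forall z, `|f z| <= M.
Proof.
by move=> [M [Mr fM]]; exists (M + 1) => z; apply: (fM (M + 1)) => //; rewrite ltrDl.
Qed.

Lemma unif_continuous_cvg (R : realType) n (f : 'rV[R]_n -> R) :
  unif_continuous f -> continuous f.
Proof.
move=> /unif_continuousP uf z; have FF : Filter (nbhs z) := nbhs_filter z.
apply/cvg_ballP => e e0.
have [r r0 h] := uf e e0; apply: (filterS _ (nbhsx_ballx z r r0)) => z' zz'.
exact: (h (z, z')).
Qed.

Lemma moment_class_bounded (R : realType) d (dO : measure_display)
    (Omega : measurableType dO) (P : probability Omega R) (Z : {RV P >-> 'rV[R]_d})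
    (eta : 'rV[R]_d -> R) (M : R) : measurable_fun setT eta -> (forall z, `|eta z| <= M) ->
  moment_class (distribution P Z) 1 (rank1_kernel eta).
Proof.
move=> meta etaM; rewrite /moment_class.
apply: (@le_lt_trans _ _ (\int[distribution P Z]_z (M ^+ 2)%:E)%E).
  apply: ge0_integral_mono => z; first by rewrite lee_fin powR_ge0.
  rewrite lee_fin /rank1_kernel -expr2 powRr1 ?sqr_ge0//.
  by rewrite -(real_normK (num_real (eta z))) lerXn2r// nnegrE// (le_trans _ (etaM z)).
rewrite (integral_cst _ measurableT).
apply: (@le_lt_trans _ _ (M ^+ 2)%:E); last exact: ltry.
rewrite -[leRHS]mule1; apply: lee_wpmul2l; first by rewrite lee_fin sqr_ge0.
exact: (@probability_le1 _ _ _ (distribution P Z) setT measurableT).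
Qed.

Theorem corollary4 (R : realType) (p q d : nat)
    (p_gt0 : (0 < p)%N) (q_gt0 : (0 < q)%N) (d_gt0 : (0 < d)%N)
    (dO : measure_display) (Omega : measurableType dO) (P : probability Omega R)
    (X : {RV P >-> 'rV[R]_p}) (Y : {RV P >-> 'rV[R]_q}) (Z : {RV P >-> 'rV[R]_d})
    (kappa : R.-pker 'rV[R]_d ~> ('rV[R]_p * 'rV[R]_q)%type)
    (kappaP : cond_distribution X Y Z kappa)
    (x0 : 'rV[R]_p) (y0 : 'rV[R]_q)
    (momX : moment_class (distribution P X) 2 (dist_kernel x0))
    (momY : moment_class (distribution P Y) 2 (dist_kernel y0))
    (HY : rkhs (dist_kernel y0)) :
  (forall (eta : 'rV[R]_d -> R)
      (HXZ : rkhs (prod_kernel (dist_kernel x0) (rank1_kernel eta)))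
      (Sigma : {linear HXZ -> HY}),
    measurable_fun setT eta ->
    moment_class (distribution P Z) 1 (rank1_kernel eta) ->
    (\int[distribution P Z]_z
        (`|eta z|%:E * L2w_norm (cf_diff kappa z)) < +oo)%E ->
    cond_cross_cov_op kappa X Y Z Sigma ->
    (hs_norm Sigma ^+ 2 =
     L2w_norm (fun us => cintegral (distribution P Z)
       (fun z => ((eta z)%:C%C * cf_diff kappa z us)%R)) ^+ 2)%E) /\
  (forall (theta : 'rV[R]_d -> R) (a : 'rV[R]_d) (pZ : 'rV[R]_d -> R)
      (HXZ : forall t : R, rkhs (prod_kernel (dist_kernel x0)
         (rank1_kernel (bandwidth_kernel theta a t))))
      (Sigma : forall t : R, {linear HXZ t -> HY}),
    [bounded theta z | z in setT] ->
    continuous theta ->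
    (\int[lebesgue_rV R d]_z (theta z)%:E = 1)%E ->
    (forall z, 0 <= pZ z) ->
    [bounded pZ z | z in setT] ->
    unif_continuous pZ ->
    (forall A, measurable A ->
      distribution P Z A = \int[lebesgue_rV R d]_(z in A) (pZ z)%:E)%E ->
    (\int[lebesgue_rV R p \x lebesgue_rV R q]_us
        (ereal_sup (range (fun z => (normC (cf_diff kappa z us) ^+ 2)%:E))
         * (weight us)%:E) < +oo)%E ->
    {ae (lebesgue_rV R p \x lebesgue_rV R q)%E, forall us,
      cond_lebesgue_point (distribution P Z) (fun z => cf_diff kappa z us) a} ->
    (forall t, 0 < t -> cond_cross_cov_op kappa X Y Z (Sigma t)) ->
    (fun t : R => (hs_norm (Sigma t) ^+ 2)%E) @ 0^'+ -->
      ((pZ a ^+ 2)%:E * cond_dcov2 kappa a)%E).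
Proof.
split=> [eta HXZ Sigma meta momZ _ SigmaP|].
  exact: (hs_norm_L2w_norm p_gt0 q_gt0 kappaP momX momY meta momZ SigmaP).
move=> theta a pZ HXZ Sigma /bounded_setT_le[Th thetaTh] ctheta theta1 pZ0
  /bounded_setT_le[B pZB] /unif_continuous_cvg cpZ dens suplty lps SigmaP.
have mtheta := continuous_measurable_rV ctheta.
have mpZ := continuous_measurable_rV cpZ.
have pZ_le z : pZ z <= B by exact: le_trans (ler_norm _) (pZB z).
have E t : 0 < t -> (hs_norm (Sigma t) ^+ 2 = L2w_norm (fun us => cintegral (distribution P Z)
    (fun z => ((bandwidth_kernel theta a t z)%:C%C * cf_diff kappa z us)%R)) ^+ 2)%E.
  move=> t0; have meta := measurable_bandwidth a mtheta t.
  have momZ := moment_class_bounded Z meta (fun z => bandwidth_le a thetaTh z t0).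
  exact: (hs_norm_L2w_norm p_gt0 q_gt0 kappaP momX momY meta momZ (SigmaP t t0)).
have lim := cvg_L2w_norm_bandwidth p_gt0 q_gt0 mtheta thetaTh theta1 mpZ pZ0 pZ_le (cpZ a)
  dens suplty lps.
(* Any sequence of bandwidths shows that the limit is finite, which the
   sequential criterion needs. *)
have harmonic0 n : 0 < harmonic n :> R by rewrite /harmonic invr_gt0.
have [_ fin] := lim harmonic harmonic0 (@cvg_harmonic R).
rewrite -(fineK fin); apply/cvge_at_rightP => u [u0 ucvg]; rewrite fineK//.
have [cv _] := lim u u0 ucvg; move: cv; apply: cvg_trans; apply: near_eq_cvg; near=> n.
by rewrite E.
Unshelve. all: by end_near. Qed.
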